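(* Let $\mathcal T=\{T_s\}_{s\ge 0}$ be a semigroup of Dunford-Schwartz operators that is strongly continuous in $\mathcal L^1$, and let $\beta:\mathbb R_+\to\mathbb C$ be a bounded locally Besicovitch function with $\|\beta\|_\infty<C<\infty$. Then, given $1\le p<\infty$ and $f\in\mathcal L^p$, the averages $M_t(\mathcal T,\beta)(f)=\frac1t\int_0^t\beta(s)T_s(f)\,ds$, $t>0$, converge almost uniformly to $\lambda(f)\,f$ as $t\to0^+$ for some $\lambda(f)\in\mathbb C$.
   Context: Let $(\Omega,\mathcal A,\mu)$ be a $\sigma$-finite measure space with $\mu(\Omega)=\infty$. $\mathcal L^0$ is the algebra of equivalence classes of a.e. finite complex-valued measurable functions on $\Omega$, and $\mathcal L^p=\mathcal L^p(\Omega,\mu)\subset\mathcal L^0$ ($1\le p\le\infty$) is the usual space with norm $\|\cdot\|_p$. A Dunford-Schwartz operator ($T\in DS$) is a linear operator $T:\mathcal L^1\to\mathcal L^1$ with $\|T(f)\|_1\le\|f\|_1$ for all $f\in\mathcal L^1$ and $\|T(f)\|_\infty\le\|f\|_\infty$ for all $f\in\mathcal L^1\cap\mathcal L^\infty$. Such $T$ is identified with its unique linear extension to $\mathcal L^1+\mathcal L^\infty$ that contracts $\mathcal L^\infty$ and whose restriction to $\mathcal L^\infty$ is $\sigma(\mathcal L^\infty,\mathcal L^1)$-continuous; the extension also contracts every $\mathcal L^p$, $1<p<\infty$. A semigroup $\{T_s\}_{s\ge0}\subset DS$ satisfies $T_0=I$ and $T_{r+s}=T_rT_s$ for $r,s\ge0$.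 It is strongly continuous in $\mathcal L^1$ if $\|T_s(f)-T_{s_0}(f)\|_1\to0$ whenever $s\to s_0$, for all $f\in\mathcal L^1$. For $f\in\mathcal L^p$, $1\le p<\infty$, and $\beta:\mathbb R_+\to\mathbb C$ Lebesgue measurable with $\|\beta\|_\infty<\infty$, the integral $\int_0^t\beta(s)T_s(f)\,ds$ is a Bochner integral in $\mathcal L^p$. A net $\{f_\alpha\}\subset\mathcal L^0$ converges almost uniformly (a.u.) to $f\in\mathcal L^0$ if for every $\varepsilon>0$ there is a measurable set $G\subset\Omega$ with $\mu(\Omega\setminus G)\le\varepsilon$ and $\|(f-f_\alpha)\chi_G\|_\infty\to0$. Let $\mathbb C_1=\{z\in\mathbb C:|z|=1\}$. A trigonometric polynomial is a function $p:\mathbb R_+\to\mathbb C$ of the form $p(s)=\sum_{j=1}^nw_j\lambda_j^s$ with $n\in\mathbb N$, $w_j\in\mathbb C$, $\lambda_j\in\mathbb C_1$, where $\lambda_j^s=e^{i\theta_js}$ for a real number $\theta_j$ with $e^{i\theta_j}=\lambda_j$ (any real $\theta_j$ allowed). A Lebesgue measurable function $\beta:\mathbb R_+\to\mathbb C$ is a bounded locally Besicovitch function if $\|\beta\|_\infty<\infty$ and for every $\varepsilon>0$ there is a trigonometric polynomial $p_\varepsilon$ such that $\limsup_{t\to0^+}\frac1t\int_0^t|\beta(s)-p_\varepsilon(s)|\,ds<\varepsilon$. *)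

(* Defs.v *)
From HB Require Import structures.
From mathcomp Require Import all_boot all_order all_algebra.
From mathcomp Require Export complex.
From mathcomp Require Import all_classical all_reals all_analysis.
From mathcomp Require Import measurable_realfun.

Set Implicit Arguments.
Unset Strict Implicit.
Unset Printing Implicit Defensive.

Import Order.TTheory GRing.Theory Num.Theory.
Import numFieldNormedType.Exports.
Import Normc.

Local Open Scope classical_set_scope.
Local Open Scope ring_scope.

(** The elements of L^0 are represented by everywhere defined functions
    [Omega -> R[i]]; identities between elements of L^0 are stated up to a.e.
    equality, and operators are required to respect a.e. equality.  The space
    C of complex numbers is [R[i]], and [normc : R[i] -> R] is its modulus. *)

Section complex_Lp.
Context {d : measure_display} {Omega : measurableType d} {R : realType}.
Variable mu : {measure set Omega -> \bar R}.
Implicit Types (p : \bar R) (f g h : Omega -> R[i]).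

Definition cmeasurable f :=
  measurable_fun setT (fun x => complex.Re (f x)) /\
  measurable_fun setT (fun x => complex.Im (f x)).

Definition cLnorm p f : \bar R := Lnorm mu p (fun x => (normc (f x))%:E).

Definition cLp p : set (Omega -> R[i]) :=
  [set f | cmeasurable f /\ (cLnorm p f < +oo)%E].

Definition cL1_plus_Loo : set (Omega -> R[i]) :=
  [set f | exists g h, [/\ cLp 1%E g, cLp +oo%E h & f = g + h]].

Definition cintegral f : R[i] :=
  Complex (\int[mu]_x complex.Re (f x)) (\int[mu]_x complex.Im (f x)).

(** [S] induces a linear operator on the space of classes of members of [D]. *)
Definition linear_operator_on (D : set (Omega -> R[i]))
    (S : (Omega -> R[i]) -> Omega -> R[i]) :=
  [/\ forall f, D f -> D (S f),
      forall f g, D f -> D g -> f = g %[ae mu] -> S f = S g %[ae mu] &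
      forall (a : R[i]) f g, D f -> D g ->
        S (a *: f + g) = a *: S f + S g %[ae mu]].

(** Convergence of a filter on L^oo for the topology sigma(L^oo, L^1). *)
Definition weakstar_cvg (F : set_system (Omega -> R[i])) h :=
  forall g, cLp 1%E g ->
    normc (cintegral (k * g) - cintegral (h * g)) @[k --> F] --> (0 : R).

(** Continuity for a topology, expressed by convergence of filters. *)
Definition weakstar_continuous (S : (Omega -> R[i]) -> Omega -> R[i]) :=
  forall (F : set_system (Omega -> R[i])) h, ProperFilter F ->
    F (cLp +oo%E) -> cLp +oo%E h ->
    weakstar_cvg F h -> weakstar_cvg (S @ F) (S h).

(** Only the values of [T] on L^1 matter. *)
Definition dunford_schwartz (T : (Omega -> R[i]) -> Omega -> R[i]) :=
  [/\ linear_operator_on (cLp 1%E) T,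
      forall f, cLp 1%E f -> (cLnorm 1%E (T f) <= cLnorm 1%E f)%E &
      forall f, cLp 1%E f -> cLp +oo%E f ->
        (cLnorm +oo%E (T f) <= cLnorm +oo%E f)%E].

(** [S] is the extension to L^1 + L^oo with which the Dunford-Schwartz operator
    [T] is identified. *)
Definition dunford_schwartz_extension
    (T S : (Omega -> R[i]) -> Omega -> R[i]) :=
  [/\ linear_operator_on cL1_plus_Loo S,
      forall f, cLp 1%E f -> S f = T f %[ae mu],
      forall h, cLp +oo%E h -> (cLnorm +oo%E (S h) <= cLnorm +oo%E h)%E &
      weakstar_continuous S].

(** Only the [T s] with [0 <= s] matter. *)
Definition semigroup (T : R -> (Omega -> R[i]) -> Omega -> R[i]) :=
  (forall f, cLp 1%E f -> T 0 f = f %[ae mu]) /\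
  (forall r s f, 0 <= r -> 0 <= s -> cLp 1%E f ->
     T (r + s) f = T r (T s f) %[ae mu]).

Definition strongly_continuous_L1
    (T : R -> (Omega -> R[i]) -> Omega -> R[i]) :=
  forall f s0, cLp 1%E f -> 0 <= s0 ->
    cLnorm 1%E (T s f - T s0 f) @[s --> within `[0, +oo[ (nbhs s0)] --> 0%E.

Definition almost_uniformly_cvg {I : Type} (F : set_system I)
    (u : I -> Omega -> R[i]) f :=
  forall e : R, 0 < e -> exists G : set Omega,
    [/\ measurable G, (mu (~` G) <= e%:E)%E &
        cLnorm +oo%E (fun x => \1_G x * (f x - u i x)) @[i --> F] --> 0%E].

End complex_Lp.

Section bochner.
Context {d : measure_display} {Omega : measurableType d} {R : realType}.
Variables (mu : {measure set Omega -> \bar R}) (p : \bar R).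
Local Notation lambda := (@lebesgue_measure R).

(** The simple function [\sum_j \1_(step_set j) * step_val j] from the real
    line to L^p. *)
Record step := Step {
  step_size : nat ;
  step_set : 'I_step_size -> set R ;
  step_val : 'I_step_size -> Omega -> R[i] }.

Definition step_on (D : set R) (phi : step) :=
  forall j : 'I_(step_size phi),
    [/\ measurable (step_set j), step_set j `<=` D & cLp mu p (step_val j)].

Definition step_fun (phi : step) (s : R) : Omega -> R[i] :=
  \sum_(j < step_size phi) (\1_(step_set j) s : R[i]) *: step_val j.

Definition step_integral (phi : step) : Omega -> R[i] :=
  \sum_(j < step_size phi) (fine (lambda (step_set j)))%:C%C *: step_val j.

(** [J] is (a representative of) the Bochner integral over [D], a set of finite
    Lebesgue measure, of the L^p-valued function [F]. *)
Definition is_bochner_integral (D : set R) (F : R -> Omega -> R[i])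
    (J : Omega -> R[i]) :=
  [/\ forall s, D s -> cLp mu p (F s),
      cLp mu p J &
      exists phi : nat -> step,
        [/\ forall n, step_on D (phi n),
            {ae lambda, forall s, D s ->
               cLnorm mu p (F s - step_fun (phi n) s) @[n --> \oo] --> 0%E},
            (\int[lambda]_(s in D) cLnorm mu p (F s - step_fun (phi n) s)%R)%E
               @[n --> \oo] --> 0%E &
            cLnorm mu p (J - step_integral (phi n)) @[n --> \oo] --> 0%E]].

Definition bochner_integrable (D : set R) (F : R -> Omega -> R[i]) :=
  exists J, is_bochner_integral D F J.

(** Some representative of the integral, and [0] if [F] is not integrable. *)
Definition bochner_integral (D : set R) (F : R -> Omega -> R[i]) :
    Omega -> R[i] :=
  xget 0 [set J | is_bochner_integral D F J].

End bochner.

Section besicovitch.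
Context {R : realType}.
Local Notation lambda := (@lebesgue_measure R).
Implicit Types (beta q : R -> R[i]).

(** Functions on the half-line are functions on [R] of which only the values at
    nonnegative reals matter. *)

(** The sigma-algebra of Lebesgue measurable sets; the measurable sets of [R]
    itself are the Borel sets. *)
Definition lebesgueR := g_sigma_algebraType (completed_algebra_gen lambda).

Definition lebesgue_cmeasurable beta :=
  measurable_fun (`[0, +oo[ : set lebesgueR) (fun s : lebesgueR => complex.Re (beta s))
  /\
  measurable_fun (`[0, +oo[ : set lebesgueR) (fun s : lebesgueR => complex.Im (beta s)).

Definition essup_norm beta : \bar R :=
  Lnorm lambda +oo%E ((fun s : R => (normc (beta s))%:E) \_ `[0, +oo[).

Definition expi (x : R) : R[i] := Complex (cos x) (sin x).

Definition trig_polynomial q :=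
  exists (n : nat) (w lam : 'I_n -> R[i]) (theta : 'I_n -> R),
    (forall j, normc (lam j) = 1 /\ expi (theta j) = lam j) /\
    (forall s, 0 <= s -> q s = \sum_(j < n) w j * expi (theta j * s)).

(** The integrand below is only Lebesgue measurable.  On a nonnegative function
    [\int] is the supremum of the integrals of the Borel simple functions below
    it, which is the Lebesgue integral. *)
Definition bounded_locally_besicovitch beta :=
  [/\ lebesgue_cmeasurable beta,
      (essup_norm beta < +oo)%E &
      forall e : R, 0 < e -> exists2 q, trig_polynomial q &
        (limf_esup (fun t : R => (t^-1)%:E *
           \int[lambda]_(s in `[0%R, t]) (normc (beta s - q s)%R)%:E)
           (0%R)^'+ < e%:E)%E].

End besicovitch.

(** The average over [0, t], for [f] in L^p. *)
Definition average {d : measure_display} {Omega : measurableType d}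
    {R : realType} (mu : {measure set Omega -> \bar R}) (p : \bar R)
    (T : R -> (Omega -> R[i]) -> Omega -> R[i]) (beta : R -> R[i])
    (f : Omega -> R[i]) (t : R) : Omega -> R[i] :=
  (t^-1)%:C%C *: bochner_integral mu p `[0, t] (fun s => beta s *: T s f).

(* Main.v *)
(** The limit is [lam * f], where [lam] is the value of [beta] at the Lebesgue
    point [0]: trigonometric polynomials being continuous at [0], there is [lam]
    with [1/t * \int_0^t |beta - lam| -> 0].

    For each [n], take a grid of mesh [h_n <= 2^-n] independent of [t].  The
    integral [J_t] of [beta(s) T_s f] over [0, t] is the a.e. limit of Riemann
    sums [R_n f = \sum_i c_i T_(i h_n) f] with [|c_i| <= 2 C h_n], which reduces the
    problem to the discrete semigroups [(T_(h_n))^i].  Split [f = g + w + v] with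
    [g] bounded and integrable, [w] small in L^1 and [v] small in L^oo, and
    replace [g] by its average [A] over the grid points of [0, a], so that
    [|T_(i h_n) A - A| <= (2 i h_n / a) |g|_oo] a.e.  The error [(g - A) + w] is
    small in L^1, so outside a set [E_n] of small measure its Riemann sums are
    controlled by a maximal inequality.  As this bound is used for infinitely many
    [n] only, the exceptional set is [liminf E_n], which is still small; it depends
    neither on [t] nor on the representatives of the uncountably many [J_t].

    The operators need not be positive, so the maximal inequality is obtained by a
    filling scheme applied to moduli, with no recourse to a linear modulus.
    Boundedness on [L^p] comes from a Hardy-Littlewood-Polya majorization, which
    needs only the truncations of [f], instead of interpolation. *)

Require Import Defs.
From mathcomp Require Import all_boot all_order all_algebra.
From mathcomp Require Import all_classical all_reals all_analysis.
From mathcomp Require Import measurable_realfun ess_sup_inf ring lra.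

Set Implicit Arguments.
Unset Strict Implicit.
Unset Printing Implicit Defensive.

Import Order.TTheory GRing.Theory Num.Theory.
Import numFieldNormedType.Exports.

Local Open Scope classical_set_scope.
Local Open Scope ring_scope.

(** Almost uniform convergence tolerates a null set for each [t], but the set of small positive
    measure must serve all small [t] at once, so grids, splitting and exceptional sets have to be
    fixed before [t]. The coefficients of the Riemann sums do depend on [t]; this is why the maximal
    inequality is proved for arbitrary complex weights of modulus at most 1, with an exceptional set
    that ignores the weights. It bounds a sum of [k] terms by [k] times the level, and [0, t]
    carries up to [t / h_n + 1] grid points: the extra point costs a multiple of [h_n], negligible
    against [t] only when [n] is large depending on [t].

    Estimates in L^p enter through the existence of [J_t] and the convergence of the Riemann sums:
    continuity of the semigroup is given in L^1 and has to be carried over to L^p. The pointwise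
    bounds themselves come from L^1 and L^oo.

    Neither [beta] nor the norms of the integrand are known to be Borel, so integrals are compared
    by lemmas that require measurability of at most one side. *)

Local Notation normc := Normc.normc.

(** * Complex moduli, measurability, integrals of nonnegative functions *)

Section complex_facts.
Context {R : realType}.
Implicit Types (x y z : R[i]) (r : R).

Lemma normc_ge0 x : 0 <= normc x.
Proof. by case: x => a b; exact: sqrtr_ge0. Qed.

Lemma ReD x y : complex.Re (x + y) = complex.Re x + complex.Re y.
Proof. by case: x; case: y. Qed.

Lemma ImD x y : complex.Im (x + y) = complex.Im x + complex.Im y.
Proof. by case: x; case: y. Qed.

Lemma ReN x : complex.Re (- x) = - complex.Re x.
Proof. by case: x. Qed.

Lemma ImN x : complex.Im (- x) = - complex.Im x.
Proof. by case: x. Qed.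

Lemma ReM x y : complex.Re (x * y) =
  complex.Re x * complex.Re y - complex.Im x * complex.Im y.
Proof. by case: x; case: y. Qed.

Lemma ImM x y : complex.Im (x * y) =
  complex.Re x * complex.Im y + complex.Im x * complex.Re y.
Proof. by case: x => a b; case: y => c e /=. Qed.

Lemma normcE x :
  normc x = Num.sqrt (complex.Re x ^+ 2 + complex.Im x ^+ 2).
Proof. by case: x. Qed.

Lemma le_normc_Re x : `|complex.Re x| <= normc x.
Proof.
by rewrite normcE -sqrtr_sqr ler_sqrt ?addr_ge0 ?sqr_ge0// lerDl sqr_ge0.
Qed.

Lemma le_normc_Im x : `|complex.Im x| <= normc x.
Proof.
by rewrite normcE -sqrtr_sqr ler_sqrt ?addr_ge0 ?sqr_ge0// lerDr sqr_ge0.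
Qed.

Lemma normc_le_ReIm x :
  normc x <= `|complex.Re x| + `|complex.Im x|.
Proof.
rewrite normcE -[leRHS]ger0_norm ?addr_ge0// -sqrtr_sqr ler_sqrt ?sqr_ge0//.
rewrite sqrrD !real_normK ?num_real// -addrA (addrC (_ *+ 2)) addrA lerDl.
by rewrite mulrn_wge0// mulr_ge0.
Qed.

Lemma normc_real r : normc (r%:C%C : R[i]) = `|r|.
Proof. by rewrite normcE/= expr0n addr0 sqrtr_sqr. Qed.

Lemma ler_normcB x y : normc (x - y) <= normc x + normc y.
Proof. by rewrite (le_trans (le_normcD _ _))// normcN. Qed.

Lemma ler_normc_dist x y : `|normc x - normc y| <= normc (x - y).
Proof.
have le (a b : R[i]) : normc a - normc b <= normc (a - b).
  by rewrite lerBlDr -[in leLHS](subrK b a) le_normcD.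
by rewrite ler_norml le andbT lerNl opprB (le_trans (le _ _))// -normcN opprB.
Qed.

Lemma ler_normc_sum I (s : seq I) (P : pred I) (F : I -> R[i]) :
  normc (\sum_(i <- s | P i) F i) <=
  \sum_(i <- s | P i) normc (F i).
Proof.
elim/big_ind2 : _ => [|x a y b xa yb|//]; first by rewrite Normc.normc0.
by rewrite (le_trans (le_normcD _ _))// lerD.
Qed.

End complex_facts.

Section cmeasurable_facts.
Context {d : measure_display} {Omega : measurableType d} {R : realType}.
Implicit Types (f g : Omega -> R[i]) (r : Omega -> R).

Lemma cmeasurable_cst (z : R[i]) : cmeasurable (cst z : Omega -> R[i]).
Proof. by split; exact: measurable_cst. Qed.

Lemma cmeasurable0 : cmeasurable (0 : Omega -> R[i]).
Proof. exact: cmeasurable_cst. Qed.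

Lemma cmeasurableD f g : cmeasurable f -> cmeasurable g -> cmeasurable (f + g).
Proof.
move=> [f1 f2] [g1 g2]; split.
- by under eq_fun do rewrite ReD; exact: measurable_funD.
- by under eq_fun do rewrite ImD; exact: measurable_funD.
Qed.

Lemma cmeasurableM f g : cmeasurable f -> cmeasurable g -> cmeasurable (f * g).
Proof.
move=> [f1 f2] [g1 g2]; split.
- by under eq_fun do rewrite ReM; apply: measurable_funB; exact: measurable_funM.
- by under eq_fun do rewrite ImM; apply: measurable_funD; exact: measurable_funM.
Qed.

Lemma cmeasurableZ (a : R[i]) f : cmeasurable f -> cmeasurable (a *: f).
Proof. by move=> mf; exact: (cmeasurableM (cmeasurable_cst a) mf). Qed.

Lemma cmeasurableN f : cmeasurable f -> cmeasurable (- f).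
Proof. by move=> mf; rewrite -scaleN1r; exact: cmeasurableZ. Qed.

Lemma cmeasurableB f g : cmeasurable f -> cmeasurable g -> cmeasurable (f - g).
Proof. by move=> mf mg; apply: cmeasurableD => //; exact: cmeasurableN. Qed.

Lemma cmeasurable_sum I (s : seq I) (P : pred I) (F : I -> Omega -> R[i]) :
  (forall i, P i -> cmeasurable (F i)) ->
  cmeasurable (\sum_(i <- s | P i) F i).
Proof.
move=> mF; apply: (big_ind (@cmeasurable d Omega R)) => //.
exact: cmeasurableD.
Qed.

Lemma cmeasurable_real r : measurable_fun setT r ->
  cmeasurable (fun x => (r x)%:C%C : R[i]).
Proof. by move=> mr; split => //=; exact: measurable_cst. Qed.

Lemma cmeasurable_indic (A : set Omega) : measurable A ->
  cmeasurable (fun x => \1_A x : R[i]).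
Proof.
move=> mA; rewrite (_ : (fun _ => _) = fun x => (\1_A x : R)%:C%C).
  by apply: cmeasurable_real; exact: measurable_indic.
by apply/funext => x; rewrite /indic; case: (_ \in _).
Qed.

Lemma measurable_normc f : cmeasurable f ->
  measurable_fun setT (fun x => normc (f x)).
Proof.
move=> [f1 f2]; under eq_fun do rewrite normcE.
have ms : measurable_fun setT (@Num.sqrt R).
  by apply: continuous_measurable_fun; exact: sqrt_continuous.
apply: (measurableT_comp ms).
by apply: measurable_funD; exact: measurable_funX.
Qed.

Lemma measurable_inv r : measurable_fun setT r -> (forall x, 0 <= r x) ->
  measurable_fun setT (fun x => (r x)^-1).
Proof.
move=> mr r0; rewrite (_ : (fun _ => _) = (@powR R ^~ (-1)) \o r).
  by apply: measurableT_comp => //; exact: measurable_powR.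
by apply/funext => x /=; rewrite powR_inv1.
Qed.

End cmeasurable_facts.

Section integral_facts.
Context {d : measure_display} {Omega : measurableType d} {R : realType}.
Variable mu : {measure set Omega -> \bar R}.
Local Open Scope ereal_scope.

(** The integral of a nonnegative function is a supremum over the simple functions below it, so
    monotonicity requires no measurability. *)
Lemma le_integral_ge0 (D : set Omega) (f g : Omega -> \bar R) :
  (forall x, D x -> 0 <= f x) -> (forall x, D x -> f x <= g x) ->
  \int[mu]_(x in D) f x <= \int[mu]_(x in D) g x.
Proof.
move=> f0 fg; rewrite !ge0_integralE//; last first.
  by move=> x Dx; rewrite (le_trans (f0 x Dx))// fg.
apply: ge_ereal_sup => _ [h /= hf <-]; apply: ereal_sup_ubound => /=.
exists h => // x; apply: le_trans (hf x) _.
rewrite /patch; case: ifPn => // /set_mem; exact: fg.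
Qed.

Lemma ae_le_integral_ge0 (D : set Omega) (f g : Omega -> \bar R) :
  measurable D -> measurable_fun D f -> (forall x, D x -> 0 <= f x) ->
  (forall x, D x -> 0 <= g x) ->
  {ae mu, forall x, D x -> f x <= g x} ->
  \int[mu]_(x in D) f x <= \int[mu]_(x in D) g x.
Proof.
move=> mD mf f0 g0 [N [mN N0 sN]].
rewrite (ge0_negligible_integral mN)// integral_mkcond [leRHS]integral_mkcond.
apply: le_integral_ge0 => x _.
  by apply: erestrict_ge0 => y [Dy _]; exact: f0.
rewrite /patch; case: ifPn => [|_]; last by case: ifPn => // /set_mem /g0.
move/set_mem => [Dx Nx]; rewrite mem_set//.
by apply: contrapT => h; apply: Nx; apply: sN => /= /(_ Dx).
Qed.

Lemma integral_ae_le_cst (D : set Omega) (f : Omega -> \bar R) (c : R) :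
  measurable D -> (0 <= c)%R -> (forall x, D x -> 0 <= f x) ->
  {ae mu, forall x, D x -> f x <= c%:E} ->
  \int[mu]_(x in D) f x <= c%:E * mu D.
Proof.
move=> mD c0 f0 [N [mN N0 sN]].
(* As [f] may fail to be measurable, [N] cannot be removed from its integral directly. The function
   equal to [+oo] on [N] and to [c] elsewhere is a measurable majorant with integral [c * mu D]. *)
have mg : measurable_fun D (fun x => (if x \in N then +oo else c%:E) : \bar R).
  apply: measurable_fun_if => //; try exact: measurable_cst.
  apply: (@measurable_fun_bool _ _ _ _ true).
  rewrite (_ : _ @^-1` _ = N); first exact: measurableI.
  by apply/seteqP; split => x /=; [move/set_mem|move/mem_set].
apply: (@le_trans _ _
    (\int[mu]_(x in D) (if x \in N then +oo else c%:E))).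
  apply: le_integral_ge0 => // x Dx; case: ifPn => [_|/negP xN].
    exact: leey.
  by apply: contrapT => h; apply: xN; apply/mem_set/sN => /= /(_ Dx).
rewrite -integral_cst//; apply: ae_le_integral_ge0 => //.
- by move=> x _; case: ifPn => // _; rewrite lee_fin.
- exists N; split => // x /= h; apply: contrapT => xN; apply: h => _.
  by rewrite memNset.
Qed.

Lemma measurable_set_ge (r : Omega -> R) (a : R) : measurable_fun setT r ->
  measurable [set x | (a <= r x)%R].
Proof.
move=> mr; rewrite -[X in measurable X]setTI.
have := @measurable_fun_ler _ _ R setT (cst a) r (measurable_cst a) mr.
by move=> /(_ measurableT [set true] I); rewrite !setTI.
Qed.

Lemma measure_ge_level (r : Omega -> R) (a : R) :
  measurable_fun setT r -> (forall x, 0 <= r x)%R -> (0 <= a)%R ->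
  a%:E * mu [set x | (a <= r x)%R] <= \int[mu]_x (r x)%:E.
Proof.
move=> mr r0 a0; have mA := measurable_set_ge a mr.
rewrite -integral_cst// integral_mkcond; apply: le_integral_ge0 => x _.
  by apply: erestrict_ge0 => y _; rewrite lee_fin.
by rewrite /patch; case: ifPn => [/set_mem/=|_]; rewrite lee_fin.
Qed.

End integral_facts.

(** * The spaces L^p *)

Section cLnorm_facts.
Context {d : measure_display} {Omega : measurableType d} {R : realType}.
Variable mu : {measure set Omega -> \bar R}.
Implicit Types (f g : Omega -> R[i]) (p : R).
Local Open Scope ereal_scope.

Lemma cLnorm_ge0 (q : \bar R) f : 0 <= cLnorm mu q f.
Proof. exact: Lnorm_ge0. Qed.

Lemma cLnorm_poweR p f : p != 0%R ->
  cLnorm mu p%:E f `^ p = \int[mu]_x (normc (f x) `^ p)%:E.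
Proof.
move=> p0; rewrite /cLnorm poweR_Lnorm//; apply: eq_integral => x _.
by rewrite -poweR_EFin abse_EFin ger0_norm// normc_ge0.
Qed.

Lemma cLnormE p f : p != 0%R ->
  cLnorm mu p%:E f = (\int[mu]_x (normc (f x) `^ p)%:E) `^ p^-1.
Proof.
by move=> p0; rewrite -cLnorm_poweR// -poweRrM mulfV// poweRe1// cLnorm_ge0.
Qed.

Lemma cLnorm1E f : cLnorm mu 1 f = \int[mu]_x (normc (f x))%:E.
Proof.
rewrite /cLnorm Lnorm1; apply: eq_integral => x _.
by rewrite abse_EFin ger0_norm// normc_ge0.
Qed.

Lemma ae_le_cLnorm p f g : (0 < p)%R -> cmeasurable f ->
  (\forall x \ae mu, (normc (f x) <= normc (g x))%R) ->
  cLnorm mu p%:E f <= cLnorm mu p%:E g.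
Proof.
move=> p0 mf fg; rewrite !cLnormE ?gt_eqF//.
have pos h : 0 <= \int[mu]_x (normc (h x) `^ p)%:E.
  by apply: integral_ge0 => x _; rewrite lee_fin powR_ge0.
apply: gt0_ler_poweR; rewrite ?invr_ge0 ?(ltW p0)//.
- by rewrite in_itv/= pos leey.
- by rewrite in_itv/= pos leey.
apply: ae_le_integral_ge0 => //.
- apply/measurable_EFinP; apply: (measurableT_comp (measurable_powR p)).
  exact: measurable_normc.
- by move=> x _; rewrite lee_fin powR_ge0.
- by move=> x _; rewrite lee_fin powR_ge0.
apply: filterS fg => x fgx _.
by rewrite lee_fin ge0_ler_powR// ?nnegrE ?normc_ge0// ltW.
Qed.

Lemma eq_cLnorm p f g : (0 < p)%R -> cmeasurable f -> cmeasurable g ->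
  f = g %[ae mu] -> cLnorm mu p%:E f = cLnorm mu p%:E g.
Proof.
move=> p0 mf mg fg; apply/eqP; rewrite eq_le !ae_le_cLnorm//.
- by apply: filterS fg => x ->.
- by apply: filterS fg => x ->.
Qed.

Lemma cLnormD p f g : (1 <= p)%R -> cmeasurable f -> cmeasurable g ->
  cLnorm mu p%:E (f + g)%R <= cLnorm mu p%:E f + cLnorm mu p%:E g.
Proof.
move=> p1 mf mg; have p0 : (0 < p)%R by rewrite (lt_le_trans _ p1).
rewrite (le_trans _ (minkowski_EFin mu _ _ p1))//; [|exact: measurable_normc..].
pose h x : R[i] := ((normc (f x) + normc (g x))%:C)%C.
have -> : Lnorm mu p%:E (EFin \o ((fun x => normc (f x)) \+
    (fun x => normc (g x)))%R) = cLnorm mu p%:E h.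
  rewrite /cLnorm; apply: eq_Lnorm => x.
  by rewrite /h normc_real ger0_norm// addr_ge0// normc_ge0.
apply: ae_le_cLnorm => //; first exact: cmeasurableD.
apply: nearW => x.
by rewrite /h normc_real ger0_norm ?addr_ge0 ?normc_ge0// le_normcD.
Qed.

Lemma cLnormZ p (a : R[i]) f : (0 < p)%R -> cmeasurable f ->
  cLnorm mu p%:E (a *: f)%R = (normc a)%:E * cLnorm mu p%:E f.
Proof.
move=> p0 mf; rewrite !cLnormE ?gt_eqF//.
under eq_integral do rewrite Normc.normcM powRM ?normc_ge0// EFinM.
rewrite ge0_integralZl//; first last.
- by rewrite lee_fin powR_ge0.
- by move=> x _; rewrite lee_fin powR_ge0.
- apply/measurable_EFinP; apply: (measurableT_comp (measurable_powR p)).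
  exact: measurable_normc.
rewrite poweRM ?lee_fin ?powR_ge0//; last first.
  by apply: integral_ge0 => x _; rewrite lee_fin powR_ge0.
by rewrite poweR_EFin -powRrM mulfV ?gt_eqF// powRr1// normc_ge0.
Qed.

Lemma cLnorm0 p : (0 < p)%R -> cLnorm mu p%:E 0%R = 0.
Proof.
move=> p0; rewrite -(scale0r (0%R : Omega -> R[i])).
by rewrite cLnormZ ?Normc.normc0 ?mul0e//; exact: cmeasurable0.
Qed.

Lemma cLnormN p f : (0 < p)%R -> cmeasurable f ->
  cLnorm mu p%:E (- f)%R = cLnorm mu p%:E f.
Proof.
move=> p0 mf; rewrite -scaleN1r cLnormZ// normcN.
by rewrite (_ : normc 1%R = 1%R) ?mul1e// Normc.normc1.
Qed.

Lemma cLnormB p f g : (1 <= p)%R -> cmeasurable f -> cmeasurable g ->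
  cLnorm mu p%:E (f - g)%R <= cLnorm mu p%:E f + cLnorm mu p%:E g.
Proof.
move=> p1 mf mg; have p0 : (0 < p)%R by rewrite (lt_le_trans _ p1).
rewrite (le_trans (cLnormD p1 mf (cmeasurableN mg)))// cLnormN//.
Qed.

Lemma cLnorm_sum p I (s : seq I) (P : pred I) (F : I -> Omega -> R[i]) :
  (1 <= p)%R -> (forall i, P i -> cmeasurable (F i)) ->
  cLnorm mu p%:E (\sum_(i <- s | P i) F i)%R <=
  \sum_(i <- s | P i) cLnorm mu p%:E (F i).
Proof.
move=> p1 mF; have p0 : (0 < p)%R by rewrite (lt_le_trans _ p1).
elim: s => [|i s ih]; first by rewrite !big_nil cLnorm0.
rewrite !big_cons; case: ifPn => // Pi.
rewrite (le_trans (cLnormD p1 (mF i Pi) _)) ?leeD2l//.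
exact: cmeasurable_sum.
Qed.

Lemma cLp1P f :
  cLp mu 1 f <-> cmeasurable f /\ \int[mu]_x (normc (f x))%:E < +oo.
Proof. by rewrite /cLp /= cLnorm1E. Qed.

Lemma cLpP p f : (0 < p)%R -> cLp mu p%:E f <->
  cmeasurable f /\ \int[mu]_x (normc (f x) `^ p)%:E < +oo.
Proof.
move=> p0; rewrite /cLp /= -cLnorm_poweR ?gt_eqF//; split => -[? h]; split => //.
  exact: poweR_lty.
by apply: lty_poweRy h; rewrite gt_eqF.
Qed.

Lemma cLpD p f g : (1 <= p)%R -> cLp mu p%:E f -> cLp mu p%:E g ->
  cLp mu p%:E (f + g)%R.
Proof.
move=> p1 [mf f1] [mg g1]; split; first exact: cmeasurableD.
by rewrite (le_lt_trans (cLnormD p1 mf mg))// lte_add_pinfty.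
Qed.

Lemma cLpZ p (a : R[i]) f : (1 <= p)%R -> cLp mu p%:E f ->
  cLp mu p%:E (a *: f)%R.
Proof.
move=> p1 [mf f1]; split; first exact: cmeasurableZ.
by rewrite cLnormZ ?(lt_le_trans _ p1)// lte_mul_pinfty// lee_fin normc_ge0.
Qed.

Lemma cLpB p f g : (1 <= p)%R -> cLp mu p%:E f -> cLp mu p%:E g ->
  cLp mu p%:E (f - g)%R.
Proof.
by move=> p1 fp gp; apply: cLpD => //; rewrite -scaleN1r; exact: cLpZ.
Qed.

Lemma cLp0 p : (1 <= p)%R -> cLp mu p%:E 0%R.
Proof.
move=> p1; split; first exact: cmeasurable0.
by rewrite cLnorm0// (lt_le_trans _ p1).
Qed.

Lemma cLp_sum p I (s : seq I) (P : pred I) (F : I -> Omega -> R[i]) :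
  (1 <= p)%R -> (forall i, P i -> cLp mu p%:E (F i)) ->
  cLp mu p%:E (\sum_(i <- s | P i) F i)%R.
Proof.
move=> p1 Fp; apply: (big_ind (cLp mu p%:E)) => //; first exact: cLp0.
by move=> f g; exact: cLpD.
Qed.

Lemma ae_le_cLp p f g : (0 < p)%R -> cmeasurable f ->
  (\forall x \ae mu, (normc (f x) <= normc (g x))%R) ->
  cLp mu p%:E g -> cLp mu p%:E f.
Proof.
by move=> p0 mf fg [_ gp]; split => //; exact: le_lt_trans (ae_le_cLnorm _ _ fg) gp.
Qed.

(** [Lnorm] at [+oo] is the essential supremum subject to the test [0 < mu setT], hence this
    hypothesis here and below; the theorem obtains it from the infinite measure. *)
Lemma cLnormyP f (c : R) : 0 < mu setT ->
  cLnorm mu +oo f <= c%:E <-> \forall x \ae mu, (normc (f x) <= c)%R.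
Proof.
move=> mu0; rewrite /cLnorm unlock mu0; split => [/ess_supP|] h.
  by apply: filterS h => x /=; rewrite ger0_norm ?normc_ge0.
by apply/ess_supP; apply: filterS h => x /=; rewrite ger0_norm ?normc_ge0.
Qed.

Lemma cLpyP f : 0 < mu setT -> cLp mu +oo f <->
  cmeasurable f /\ exists2 c : R, (0 <= c)%R & \forall x \ae mu, (normc (f x) <= c)%R.
Proof.
move=> mu0; split => [[mf fy]|[mf [c c0 fc]]]; split => //.
  exists (fine (cLnorm mu +oo f)); first by rewrite fine_ge0// cLnorm_ge0.
  by apply/cLnormyP => //; rewrite fineK// ge0_fin_numE// cLnorm_ge0.
by rewrite /= (@le_lt_trans _ _ c%:E) ?ltry//; apply/cLnormyP.
Qed.

End cLnorm_facts.

(** * Contractions of L^1 and L^oo *)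

Section dyadic_hinges.
Context {R : realType}.
Variables (q : R) (q0 : 0 < q).
Let r := 2 `^ q.

Let r_gt1 : 1 < r.
Proof.
have := @gt0_ltr_powR R q q0 1 2; rewrite !nnegrE powR1 /r => -> //.
by rewrite ltr1n.
Qed.

Let r_gt0 : 0 < r. Proof. exact: lt_trans r_gt1. Qed.

Let powR_ge1 (u : R) : 1 < u -> 1 <= u `^ q.
Proof.
move=> u1; have h : 1 `^ q = 1 :> R by rewrite powR1.
rewrite -[leLHS]h.
by rewrite ge0_ler_powR// ?nnegrE ?(ltW q0) ?(ltW u1)// (le_trans _ (ltW u1)).
Qed.

(** The bound [B u] extends the closed form of a geometric sum to real [u]. It satisfies
    [B u = 1 + r * B (u / 2)] exactly ([key]), so an induction that removes the term [n = 0] and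
    halves [u] loses nothing. *)
Lemma sum_dyadic_powers_le (N : nat) (u : R) : 0 <= u ->
  \sum_(n < N) r ^+ n * (2 ^+ n < u)%R%:R <=
  if 1 < u then (r * u `^ q - 1) / (r - 1) else 0.
Proof.
have r1 : 0 < r - 1 by rewrite subr_gt0.
elim: N u => [|N ih] u u0.
  rewrite big_ord0; case: ifPn => // u1.
  rewrite divr_ge0 ?(ltW r1)// subr_ge0 (le_trans (ltW r_gt1))// ler_peMr//.
    exact: ltW.
  exact: powR_ge1.
rewrite big_ord_recl [_ ^+ ord0]expr0 [_ ^+ ord0]expr0 mul1r.
have -> : \sum_(i < N) r ^+ lift ord0 i * (2 ^+ lift ord0 i < u)%R%:R =
    r * \sum_(i < N) r ^+ i * (2 ^+ i < u / 2)%R%:R.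
  rewrite mulr_sumr; apply: eq_bigr => i _.
  by rewrite lift0 !exprS mulrA ltr_pdivlMr// (mulrC _ 2).
have {ih} := ih (u / 2) (divr_ge0 u0 (ler0n R 2)).
have -> : r * (u / 2) `^ q = u `^ q.
  have uE : u = 2 * (u / 2) by field.
  by rewrite [in RHS]uE [RHS]powRM ?divr_ge0.
case: (ltP 1 u) => u1; last first.
  case: (ltP 1 (u / 2)) => u2 ih; first lra.
  by rewrite add0r pmulr_rle0.
have uq : 1 <= u `^ q.
  exact: powR_ge1.
have key : 1 + r * ((u `^ q - 1) / (r - 1)) = (r * u `^ q - 1) / (r - 1).
  by field; rewrite gt_eqF.
rewrite -key lerD2l ler_pM2l// => ih; apply: le_trans ih _.
by case: ifPn => // _; rewrite divr_ge0 ?subr_ge0// ltW.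
Qed.

(* With [r = 2^q], the sum of the functions [r^n (u - 2^n)^+] is comparable to
   [u^(1+q)]; it is to such truncated differences that the majorization
   [contr_majorization] applies. *)
Lemma sum_hinges_le (N : nat) (u : R) : 0 <= u ->
  \sum_(n < N) r ^+ n * Num.max (u - 2 ^+ n) 0 <= r / (r - 1) * u `^ (1 + q).
Proof.
move=> u0; have r1 : 0 < r - 1 by rewrite subr_gt0.
have [->|un0] := eqVneq u 0.
  rewrite powR0 ?gt_eqF ?addr_gt0// mulr0 big1// => n _.
  by rewrite sub0r max_r ?mulr0// oppr_le0 exprn_ge0.
apply: (@le_trans _ _ (u * \sum_(n < N) r ^+ n * (2 ^+ n < u)%R%:R)).
  rewrite mulr_sumr ler_sum// => n _; rewrite mulrCA ler_pM2l ?exprn_gt0//.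
  case: ltP => un; last by rewrite mulr0 max_r// subr_le0.
  rewrite mulr1 max_l ?subr_ge0 ?(ltW un)// gerBl exprn_ge0//.
rewrite powRD ?(negbTE un0) ?implybT// powRr1// mulrCA ler_wpM2l//.
apply: le_trans (sum_dyadic_powers_le N u0) _.
case: ifPn => _; last by rewrite mulr_ge0 ?powR_ge0// divr_ge0// ltW.
by rewrite mulrAC ler_pM2r ?invr_gt0// gerBl.
Qed.

(** One term is enough: if [2^(n+1) <= u < 2^(n+2)], then both [2^n] and [u - 2^n] are at least
    [u / 4], and [r^n = (2^n)^q]. *)
Lemma le_hinge (u : R) : 2 <= u ->
  exists n, (u / 4) `^ (1 + q) <= r ^+ n * Num.max (u - 2 ^+ n) 0.
Proof.
move=> u2; have exm : exists m, u < 2 ^+ m.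
  exists (Num.bound u); apply: lt_le_trans (archi_boundP _) _; first lra.
  by rewrite -natrX ler_nat ltnW// ltn_expl.
case: (ex_minnP exm) => m um mmin.
have m2 : (2 <= m)%N.
  case: m um {mmin} => [|[|//]]; rewrite ?expr0 ?expr1; lra.
case: m m2 um mmin => [|[|n]]// _ um mmin; exists n.
have un : 2 ^+ n.+1 <= u.
  by rewrite leNgt; apply/negP => /mmin; rewrite ltnn.
rewrite !exprS in um un.
set a := 2 ^+ n in um un *; have a0 : 0 < a by rewrite exprn_gt0.
have u4 : 0 < u / 4 by lra.
rewrite max_l; last lra.
have -> : (u / 4) `^ (1 + q) = (u / 4) `^ q * (u / 4).
  rewrite powRD; first by rewrite powRr1 ?(ltW u4)// mulrC.
  by apply/implyP => _; rewrite gt_eqF.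
apply: ler_pM; rewrite ?powR_ge0 ?(ltW u4)//; last lra.
have -> : r ^+ n = a `^ q.
  by rewrite /a /r -!powR_mulrn ?powR_ge0// powRAC.
by rewrite ge0_ler_powR// ?nnegrE ?(ltW u4) ?(ltW q0) ?(ltW a0)//; lra.
Qed.

End dyadic_hinges.

Section truncation.
Context {d : measure_display} {Omega : measurableType d} {R : realType}.
Variable mu : {measure set Omega -> \bar R}.
Implicit Types (f : Omega -> R[i]) (a : Omega -> R).

(** Radial truncation: the modulus is cut at [a x] and the argument is kept. The level varies with
    [x] because the filling scheme cuts at the remaining capacity. At a zero of [f] the quotient is
    0 by convention, and so is the value. *)
Definition ctrunc a f (x : Omega) : R[i] :=
  (Num.min 1 (a x / normc (f x)))%:C%C * f x.

Lemma normc_ctrunc_coef a f x : 0 <= a x ->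
  Num.min 1 (a x / normc (f x)) * normc (f x) = Num.min (normc (f x)) (a x).
Proof.
move=> a0; have [f0|fn0] := eqVneq (normc (f x)) 0.
  by rewrite f0 mulr0 min_l.
have fp : 0 < normc (f x) by rewrite lt0r fn0 normc_ge0.
by rewrite minr_pMl ?(ltW fp)// mul1r divfK.
Qed.

Lemma normc_ctrunc a f x : 0 <= a x ->
  normc (ctrunc a f x) = Num.min (normc (f x)) (a x).
Proof.
move=> a0; rewrite /ctrunc Normc.normcM normc_real ger0_norm.
  exact: normc_ctrunc_coef.
by rewrite le_min ler01 divr_ge0// normc_ge0.
Qed.

Lemma normc_ctruncB a f x : 0 <= a x ->
  normc (f x - ctrunc a f x) = normc (f x) - Num.min (normc (f x)) (a x).
Proof.
move=> a0; rewrite -(normc_ctrunc_coef f a0) /ctrunc.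
set c := Num.min 1 _; have c1 : c <= 1 by rewrite /c ge_min lexx.
have -> : f x - c%:C%C * f x = (1 - c)%:C%C * f x.
  by rewrite rmorphB mulrBl rmorph1 mul1r.
by rewrite Normc.normcM normc_real ger0_norm ?subr_ge0// mulrBl mul1r.
Qed.

Lemma cmeasurable_ctrunc a f : measurable_fun setT a -> cmeasurable f ->
  cmeasurable (ctrunc a f).
Proof.
move=> ma mf; apply: cmeasurableM => //; apply: cmeasurable_real.
apply: measurable_minr => //; apply: measurable_funM => //.
apply: measurable_inv; first exact: measurable_normc.
by move=> x; exact: normc_ge0.
Qed.

End truncation.

Section contraction.
Context {d : measure_display} {Omega : measurableType d} {R : realType}.
Variable mu : {measure set Omega -> \bar R}.
Hypothesis mu0 : (0 < mu setT)%E.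
Implicit Types (f g : Omega -> R[i]) (p c : R).

Definition L1_Loo_contraction (S : (Omega -> R[i]) -> Omega -> R[i]) :=
  [/\ linear_operator_on mu (cL1_plus_Loo mu) S,
      forall f, cLp mu 1 f -> (cLnorm mu 1 (S f) <= cLnorm mu 1 f)%E &
      forall f, cLp mu +oo f -> (cLnorm mu +oo (S f) <= cLnorm mu +oo f)%E].

Local Notation D := (cL1_plus_Loo mu).

Lemma cLpy0 : cLp mu +oo (0 : Omega -> R[i]).
Proof.
apply/cLpyP => //; split; first exact: cmeasurable0.
by exists 0 => //; apply: nearW => x; rewrite Normc.normc0.
Qed.

Lemma cLpyD f g : cLp mu +oo f -> cLp mu +oo g -> cLp mu +oo (f + g).
Proof.
move=> /(cLpyP _ mu0)[mf [c c0 fc]] /(cLpyP _ mu0)[mg [e e0 ge]].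
apply/cLpyP => //; split; first exact: cmeasurableD.
exists (c + e); first exact: addr_ge0.
by apply: filterS2 fc ge => x fx gx; rewrite (le_trans (le_normcD _ _))// lerD.
Qed.

Lemma cLpyZ (a : R[i]) f : cLp mu +oo f -> cLp mu +oo (a *: f).
Proof.
move=> /(cLpyP _ mu0)[mf [c c0 fc]].
apply/cLpyP => //; split; first exact: cmeasurableZ.
exists (normc a * c); first by rewrite mulr_ge0// normc_ge0.
by apply: filterS fc => x fx; rewrite Normc.normcM ler_wpM2l// normc_ge0.
Qed.

Lemma L1_sub f : cLp mu 1 f -> D f.
Proof. by move=> f1; exists f, 0; split; rewrite ?addr0//; exact: cLpy0. Qed.

Lemma Loo_sub f : cLp mu +oo f -> D f.
Proof. by move=> f1; exists 0, f; split; rewrite ?add0r//; exact: cLp0. Qed.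

Lemma L1_plus_LooD f g : D f -> D g -> D (f + g).
Proof.
move=> [f1 [f2 [f1L f2L ->]]] [g1 [g2 [g1L g2L ->]]].
exists (f1 + g1), (f2 + g2); split; last by rewrite addrACA.
  exact: cLpD.
exact: cLpyD.
Qed.

Lemma L1_plus_LooZ (a : R[i]) f : D f -> D (a *: f).
Proof.
move=> [f1 [f2 [f1L f2L ->]]]; exists (a *: f1), (a *: f2).
by split; [exact: cLpZ|exact: cLpyZ|rewrite scalerDr].
Qed.

Lemma L1_plus_Loo_cmeasurable f : D f -> cmeasurable f.
Proof. by move=> [f1 [f2 [[mf1 _] [mf2 _] ->]]]; exact: cmeasurableD. Qed.

Lemma L1_plus_Loo_sum I (s : seq I) (P : pred I) (F : I -> Omega -> R[i]) :
  (forall i, P i -> D (F i)) -> D (\sum_(i <- s | P i) F i).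
Proof.
move=> DF; apply: (big_ind D) => //; last exact: L1_plus_LooD.
by apply: Loo_sub; exact: cLpy0.
Qed.

(** The remainder has modulus [(|f| - c)^+], and [|f| <= c^(1-p) |f|^p] where [|f| > c]. This gives
    the inclusion of L^p in L^1 + L^oo. *)
Lemma Lp_ctrunc p c f : 1 <= p -> 0 < c -> cLp mu p%:E f ->
  cLp mu +oo (ctrunc (cst c) f) /\ cLp mu 1 (f - ctrunc (cst c) f).
Proof.
move=> p1 c0 fp; have p0 : 0 < p by rewrite (lt_le_trans _ p1).
have mf := fp.1; split.
  apply/cLpyP => //; split; first exact: cmeasurable_ctrunc.
  exists c; first exact: ltW.
  by apply: nearW => x; rewrite normc_ctrunc ?(ltW c0)// ge_min lexx orbT.
apply/cLp1P; split; first exact/cmeasurableB/cmeasurable_ctrunc.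
have /(cLpP _ _ p0)[_ fp1] := fp.
apply: (@le_lt_trans _ _
  (\int[mu]_x ((c `^ (1 - p))%:E * (normc (f x) `^ p)%:E))%E); last first.
  rewrite ge0_integralZl//.
  - by rewrite lte_mul_pinfty// lee_fin powR_ge0.
  - apply/measurable_EFinP; apply: (measurableT_comp (measurable_powR p)).
    exact: measurable_normc.
  - by move=> x _; rewrite lee_fin powR_ge0.
  - by rewrite lee_fin powR_ge0.
apply: le_integral_ge0 => x _; first by rewrite lee_fin normc_ge0.
rewrite -EFinM lee_fin normc_ctruncB ?(ltW c0)//=.
case: (leP (normc (f x)) c) => fc; first by rewrite subrr mulr_ge0// powR_ge0.
apply: (@le_trans _ _ (normc (f x))); first by rewrite gerBl ltW.
have f0 : 0 < normc (f x) by exact: lt_trans fc.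
have -> : c `^ (1 - p) * normc (f x) `^ p =
    normc (f x) * (c^-1 * normc (f x)) `^ (p - 1).
  rewrite powRM ?invr_ge0 ?(ltW c0) ?(ltW f0)//.
  rewrite mulrCA mulr_powRB1 ?(ltW f0)//; congr (_ * _).
  by rewrite -powR_inv1 ?(ltW c0)// -powRrM; congr (_ `^ _); ring.
rewrite ler_peMr ?(ltW f0)//.
apply: (@le_trans _ _ (1 `^ (p - 1))); first by rewrite powR1.
rewrite ge0_ler_powR ?nnegrE ?subr_ge0//.
  by rewrite mulr_ge0 ?invr_ge0 ?(ltW c0) ?(ltW f0).
by rewrite mulrC ler_pdivlMr// mul1r ltW.
Qed.

Lemma Lp_sub p f : 1 <= p -> cLp mu p%:E f -> D f.
Proof.
move=> p1 fp; have [ty e1] := Lp_ctrunc p1 ltr01 fp.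
by exists (f - ctrunc (cst 1) f), (ctrunc (cst 1) f); split; rewrite ?subrK.
Qed.

Section operator.
Variable S : (Omega -> R[i]) -> Omega -> R[i].
Hypothesis S_contr : L1_Loo_contraction S.

Lemma contr_cmeasurable f : D f -> cmeasurable (S f).
Proof.
by case: S_contr => -[SD _ _] _ _ Df; exact: L1_plus_Loo_cmeasurable (SD _ Df).
Qed.

Lemma contr0 : S 0 = 0 %[ae mu].
Proof.
case: S_contr => -[_ _ Sl] _ _.
have D0 : D 0 by apply: Loo_sub; exact: cLpy0.
have := Sl 1 0 0 D0 D0; rewrite scaler0 addr0 scale1r; apply: filterS => x /= h hx.
have e : S 0 x = S 0 x + S 0 x := h hx.
by apply: (addrI (S 0 x)); rewrite -e [RHS]addr0.
Qed.

Lemma contrD f g : D f -> D g -> S (f + g) = S f + S g %[ae mu].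
Proof.
case: S_contr => -[_ _ Sl] _ _ Df Dg.
have := Sl 1 f g Df Dg; rewrite scale1r; apply: filterS => x /= h hx.
by rewrite (h hx) scale1r.
Qed.

Lemma contrZ (a : R[i]) f : D f -> S (a *: f) = a *: S f %[ae mu].
Proof.
case: S_contr => -[_ _ Sl] _ _ Df.
have D0 : D 0 by apply: Loo_sub; exact: cLpy0.
have := Sl a f 0 Df D0; rewrite addr0; apply: filterS2 contr0 => x /= h1 h2 hx.
have h1x : S 0 x = 0 := h1 hx.
by rewrite (h2 hx) /= [X in X = _](_ : _ = a *: S f x + S 0 x)// h1x addr0.
Qed.

Lemma contrB f g : D f -> D g -> S (f - g) = S f - S g %[ae mu].
Proof.
move=> Df Dg; have DNg : D (- g) by rewrite -scaleN1r; exact: L1_plus_LooZ.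
have := contrZ (-1) Dg; rewrite !scaleN1r => h.
apply: filterS2 h (contrD Df DNg) => x /= h1 h2 hx.
have h1x : S (- g) x = - S g x := h1 hx.
by rewrite (h2 hx) [LHS](_ : _ = S f x + S (- g) x)// h1x.
Qed.

Lemma contr_sum I (s : seq I) (F : I -> Omega -> R[i]) :
  (forall i, D (F i)) ->
  S (\sum_(i <- s) F i) = \sum_(i <- s) S (F i) %[ae mu].
Proof.
move=> DF; elim: s => [|i s ih]; first by rewrite !big_nil; exact: contr0.
rewrite !big_cons; have DFs : D (\sum_(j <- s) F j) by exact: L1_plus_Loo_sum.
apply: filterS2 ih (contrD (DF i) DFs) => x /= h1 h2 hx.
rewrite (h2 hx) [LHS](_ : _ = S (F i) x + S (\sum_(j <- s) F j) x)//.
by rewrite (h1 hx).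
Qed.

Lemma contr_L1 f : cLp mu 1 f -> cLp mu 1 (S f).
Proof.
move=> f1; split; first by apply: contr_cmeasurable; exact: L1_sub.
by case: S_contr => _ S1 _; rewrite (le_lt_trans (S1 _ f1))//; case: f1.
Qed.

Lemma contr_L1_le f : cLp mu 1 f -> (cLnorm mu 1 (S f) <= cLnorm mu 1 f)%E.
Proof. by case: S_contr => _ S1 _; exact: S1. Qed.

Lemma contr_Loo_le c f : 0 <= c -> cmeasurable f ->
  (\forall x \ae mu, normc (f x) <= c) ->
  \forall x \ae mu, normc (S f x) <= c.
Proof.
move=> c0 mf fc; have fy : cLp mu +oo f by apply/cLpyP => //; split=> //; exists c.
apply/cLnormyP => //; case: S_contr => _ _ Sy.
by rewrite (le_trans (Sy _ fy))//; apply/cLnormyP.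
Qed.

(* Truncating [f] at height [c] leaves a remainder of modulus [(|f| - c)^+] and
   changes [S f] by at most [c], hence this Hardy-Littlewood-Polya majorization,
   from which the bounds in [L^p] follow. *)
Lemma contr_majorization p c f : 1 <= p -> 0 < c -> cLp mu p%:E f ->
  (\int[mu]_x (Num.max (normc (S f x) - c) 0)%:E <=
   \int[mu]_x (Num.max (normc (f x) - c) 0)%:E)%E.
Proof.
move=> p1 c0 fp; have [ty e1] := Lp_ctrunc p1 c0 fp.
set t := ctrunc (cst c) f in ty e1.
apply: (@le_trans _ _ (\int[mu]_x (normc (S (f - t) x))%:E)%E).
  apply: ae_le_integral_ge0 => //.
  - apply/measurable_EFinP; apply: measurable_maxr => //.
    apply: measurable_funB => //; apply: measurable_normc.
    by apply: contr_cmeasurable; exact: Lp_sub fp.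
  - by move=> x _; rewrite lee_fin le_max lexx orbT.
  - by move=> x _; rewrite lee_fin normc_ge0.
  have tc : \forall x \ae mu, normc (S t x) <= c.
    apply: contr_Loo_le; [exact: ltW|exact: ty.1|apply: nearW => x].
    by rewrite normc_ctrunc ?(ltW c0)// ge_min lexx orbT.
  apply: filterS2 tc (contrB (Lp_sub p1 fp) (Loo_sub ty)) => x tcx Sx _.
  have {}Sx : S (f - t) x = S f x - S t x := Sx I.
  rewrite lee_fin ge_max normc_ge0 andbT lerBlDr Sx.
  rewrite -[in leLHS](subrK (S t x) (S f x)) (le_trans (le_normcD _ _))//.
  by rewrite lerD2l.
have := contr_L1_le e1; rewrite !cLnorm1E => /le_trans; apply.
apply: le_integral_ge0 => x _; first by rewrite lee_fin normc_ge0.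
rewrite lee_fin [leLHS]normc_ctruncB ?(ltW c0)//=.
by case: (leP (normc (f x)) c) => h; rewrite ?subrr le_max lexx ?orbT.
Qed.

End operator.
End contraction.

Section contraction_Lp.
Context {d : measure_display} {Omega : measurableType d} {R : realType}.
Variable mu : {measure set Omega -> \bar R}.
Hypothesis mu0 : (0 < mu setT)%E.
Implicit Types (f g : Omega -> R[i]) (p c : R).
Variable S : (Omega -> R[i]) -> Omega -> R[i].
Hypothesis S_contr : L1_Loo_contraction mu S.

Lemma measurable_max_normcB f c : cmeasurable f ->
  measurable_fun setT (fun x => (Num.max (normc (f x) - c) 0)%:E).
Proof.
move=> mf; apply/measurable_EFinP; apply: measurable_maxr => //.
by apply: measurable_funB => //; exact: measurable_normc.
Qed.

Lemma measurable_normc_powR f p : cmeasurable f ->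
  measurable_fun setT (fun x => (normc (f x) `^ p)%:E).
Proof.
move=> mf; apply/measurable_EFinP; apply: (measurableT_comp (measurable_powR p)).
exact: measurable_normc.
Qed.

Lemma normc_powR_ge0 p (z : R[i]) : (0 <= (normc z `^ p)%:E)%E.
Proof. by rewrite lee_fin powR_ge0. Qed.

Let r q : R := 2 `^ q.
Let K p := 4 `^ p * (r (p - 1) / (r (p - 1) - 1)).

Let r_gt1 q : 0 < q -> 1 < r q.
Proof.
move=> q0; have := @gt0_ltr_powR R q q0 1 2; rewrite !nnegrE powR1 /r => -> //.
by rewrite ltr1n.
Qed.

(** The sum [H] of hinges is the intermediary: majorization compares [H (S f)] and [H f] term by
    term, a single hinge bounds [H] from below at the price [4^p], and the sum of all hinges bounds
    it from above with the factor [r / (r - 1)]. The lower bound works only for values at least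
    2. *)
Lemma contr_Lp_level p f : 1 < p -> cLp mu p%:E f ->
  (\int[mu]_(x in [set x | (2 <= normc (S f x))%R]) (normc (S f x) `^ p)%:E <=
   (K p)%:E * \int[mu]_x (normc (f x) `^ p)%:E)%E.
Proof.
move=> p1 fp; have p0 : 0 < p by rewrite (lt_trans _ p1).
have q0 : 0 < p - 1 by rewrite subr_gt0.
have rpos : 0 < r (p - 1) by rewrite powR_gt0.
have mSf : cmeasurable (S f).
  by apply: (contr_cmeasurable S_contr); exact: Lp_sub (ltW p1) fp.
have mf := fp.1.
pose h (n : nat) (u : R) : R := r (p - 1) ^+ n * Num.max (u - 2 ^+ n) 0.
have h0 n u : 0 <= h n u by rewrite mulr_ge0 ?exprn_ge0 ?(ltW rpos)// le_max lexx orbT.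
have mh n g : cmeasurable g -> measurable_fun setT (fun x => (h n (normc (g x)))%:E).
  move=> mg; apply/measurable_EFinP; apply: measurable_funM => //.
  by apply/measurable_EFinP; exact: measurable_max_normcB.
pose H (g : Omega -> R[i]) x : \bar R := (\sum_(n <oo) (h n (normc (g x)))%:E)%E.
have mH g : cmeasurable g -> measurable_fun setT (H g).
  move=> mg; apply: (@ge0_emeasurable_sum _ _ _ setT
    (fun n x => (h n (normc (g x)))%:E) xpredT) => n; last by move=> _; exact: mh.
  by move=> x _ _; rewrite lee_fin.
have H0 g x : (0 <= H g x)%E by apply: nneseries_ge0 => n _ _; rewrite lee_fin.
have intH : (\int[mu]_x H (S f) x <= \int[mu]_x H f x)%E.
  have hx0 g n x : setT x -> (0 <= (h n (normc (g x)))%:E)%E by rewrite lee_fin.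
  rewrite (integral_nneseries mu measurableT (fun n => mh n _ mSf) (hx0 _)).
  rewrite (integral_nneseries mu measurableT (fun n => mh n _ mf) (hx0 _)).
  apply: lee_nneseries => n _; first by move=> _; apply: integral_ge0 => x _; exact: hx0.
  rewrite /h; under eq_integral do rewrite EFinM.
  under [leRHS]eq_integral do rewrite EFinM.
  have rn0 : (0 <= (r (p - 1) ^+ n)%:E)%E by rewrite lee_fin exprn_ge0// ltW.
  have max0 g x : setT x -> (0 <= (Num.max (normc (g x) - 2 ^+ n) 0)%:E)%E.
    by rewrite lee_fin le_max lexx orbT.
  rewrite (ge0_integralZl mu measurableT (measurable_max_normcB (2 ^+ n) mSf)
    (max0 _) rn0).
  rewrite (ge0_integralZl mu measurableT (measurable_max_normcB (2 ^+ n) mf)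
    (max0 _) rn0).
  rewrite lee_wpmul2l ?lee_fin ?exprn_ge0 ?(ltW rpos)//.
  by apply: (contr_majorization mu0 S_contr (ltW p1)) fp; rewrite exprn_gt0.
have mF : measurable [set x | 2 <= normc (S f x)].
  exact/measurable_set_ge/measurable_normc.
apply: (@le_trans _ _ (\int[mu]_x ((4 `^ p)%:E * H (S f) x))%E).
  rewrite integral_mkcond; apply: le_integral_ge0 => x _.
    by apply: erestrict_ge0 => y _; rewrite lee_fin powR_ge0.
  rewrite /patch; case: ifPn => [/set_mem/= u2|_]; last first.
    by rewrite mule_ge0// lee_fin powR_ge0.
  have [n] := le_hinge q0 u2; rewrite addrC subrK => hn.
  have -> : normc (S f x) `^ p = 4 `^ p * (normc (S f x) / 4) `^ p.
    by rewrite -powRM ?divr_ge0 ?normc_ge0//; congr (_ `^ _); field.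
  rewrite EFinM lee_wpmul2l ?lee_fin ?powR_ge0//.
  apply: (@le_trans _ _ (h n (normc (S f x)))%:E); first by rewrite lee_fin.
  apply: (@le_trans _ _ (\sum_(0 <= i < n.+1) (h i (normc (S f x)))%:E)%E).
    rewrite big_nat_recr//= leeDr// sume_ge0// => i _; by rewrite lee_fin.
  by apply: nneseries_lim_ge => i _ _; rewrite lee_fin.
have c4 : (0 <= (4 `^ p)%:E :> \bar R)%E by rewrite lee_fin powR_ge0.
rewrite (ge0_integralZl mu measurableT (mH _ mSf) (fun x _ => H0 _ x) c4).
rewrite /K EFinM -muleA lee_wpmul2l ?lee_fin ?powR_ge0//.
apply: (le_trans intH).
have cr : (0 <= (r (p - 1) / (r (p - 1) - 1))%:E)%E.
  by rewrite lee_fin divr_ge0 ?(ltW rpos)// subr_ge0 ltW// r_gt1.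
rewrite -(ge0_integralZl mu measurableT (measurable_normc_powR p mf)
  (fun x _ => normc_powR_ge0 p (f x)) cr).
apply: le_integral_ge0 => x _; first exact: H0.
apply: lime_le; first by apply: is_cvg_nneseries => n _ _; rewrite lee_fin.
apply: nearW => n; rewrite sumEFin -EFinM lee_fin big_mkord.
have := sum_hinges_le q0 n (normc_ge0 (f x)).
by rewrite (addrC 1) subrK.
Qed.

(** Homogeneity removes the restriction to values at least 2: applied to [(i + 1) f], the previous
    bound concerns the set where [|S f| >= 2 / (i + 1)], and the factor [(i + 1)^p] cancels. These
    sets increase to the set where [S f] is nonzero. *)
Lemma contr_Lp_int p f : 1 < p -> cLp mu p%:E f ->
  (\int[mu]_x (normc (S f x) `^ p)%:E <=
   (K p)%:E * \int[mu]_x (normc (f x) `^ p)%:E)%E.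
Proof.
move=> p1 fp; have p0 : 0 < p by rewrite (lt_trans _ p1).
have Df := Lp_sub mu0 (ltW p1) fp.
have mSf : cmeasurable (S f) by exact: (contr_cmeasurable S_contr Df).
have mf := fp.1.
pose F (i : nat) : set Omega := [set x | 2 / i.+1%:R <= normc (S f x)].
have mF i : measurable (F i) by exact/measurable_set_ge/measurable_normc.
have ndF : nondecreasing_seq F.
  move=> m n mn; apply/subsetPset => x; rewrite /F /=; apply: le_trans.
  by rewrite ler_pM2l// lef_pV2 ?posrE// ler_nat.
have := @ge0_nondecreasing_set_cvg_integral _ _ _ F
  (fun x => (normc (S f x) `^ p)%:E) mu ndF mF.
have mp : measurable_fun setT (fun x => (normc (S f x) `^ p)%:E).
  exact: measurable_normc_powR.
move=> /(_ (fun i => measurable_funS measurableT (@subsetT _ _) mp)).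
have p_ge0 i x : F i x -> (0 <= (normc (S f x) `^ p)%:E)%E.
  by rewrite lee_fin powR_ge0.
move=> /(_ p_ge0) cvgF.
have -> : (\int[mu]_x (normc (S f x) `^ p)%:E =
    \int[mu]_(x in \bigcup_i F i) (normc (S f x) `^ p)%:E)%E.
  rewrite [RHS]integral_mkcond; apply: eq_integral => x _.
  rewrite /patch; case: ifPn => // /negP xF.
  have -> : normc (S f x) = 0; last by rewrite powR0// gt_eqF.
  apply/eqP; apply: contra_notT xF => xn; apply/mem_set.
  have x0 : 0 < normc (S f x) by rewrite lt0r xn normc_ge0.
  exists (Num.bound (2 / normc (S f x))) => //; rewrite /F/=.
  rewrite ler_pdivrMr// -ler_pdivrMl// mulrC ltW//.
  have := archi_boundP (divr_ge0 (ler0n R 2) (ltW x0)).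
  move=> /lt_le_trans; apply; by rewrite ler_nat.
rewrite -(cvg_lim _ cvgF)//; apply: lime_le; first by apply/cvg_ex; eexists; exact: cvgF.
apply: nearW => i.
have i0 : 0 < i.+1%:R :> R by [].
have /(contr_Lp_level p1) := cLpZ (i.+1%:R)%:C%C (ltW p1) fp.
have pi0 : 0 < i.+1%:R `^ p :> R by rewrite powR_gt0.
have ip0 : (0 <= (i.+1%:R `^ p : R)%:E)%E by rewrite lee_fin ltW.
have e : (\int[mu]_x (normc ((i.+1%:R%:C%C *: f) x) `^ p)%:E =
    (i.+1%:R `^ p)%:E * \int[mu]_x (normc (f x) `^ p)%:E)%E.
  rewrite -(ge0_integralZl mu measurableT (measurable_normc_powR p mf)
    (fun x _ => normc_powR_ge0 p (f x)) ip0).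
  apply: eq_integral => x _.
  by rewrite Normc.normcM normc_real ger0_norm// powRM ?normc_ge0// EFinM.
rewrite e muleCA => le1.
have {}le1 := le_trans _ le1.
rewrite -(@lee_pmul2l _ (i.+1%:R `^ p)%:E) ?lte_fin//.
apply: le1; rewrite -(ge0_integralZl mu (mF i)
  (measurable_funS measurableT (@subsetT _ _) mp)
  (fun x _ => normc_powR_ge0 p (S f x)) ip0).
rewrite integral_mkcond [leRHS]integral_mkcond.
have SZ := contrZ mu0 S_contr (i.+1%:R)%:C%C Df.
apply: ae_le_integral_ge0 => //.
- apply/(measurable_restrictT _ (mF i)).
  exact/measurable_funeM/(measurable_funS measurableT _ mp).
- move=> x _; apply: erestrict_ge0 => y _.
  by rewrite -EFinM lee_fin mulr_ge0// powR_ge0.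
- by move=> x _; apply: erestrict_ge0 => y _; rewrite lee_fin powR_ge0.
apply: filterS SZ => x /(_ I) Sx _.
have nSx : normc (S (i.+1%:R%:C%C *: f) x) = i.+1%:R * normc (S f x).
  by rewrite Sx [in LHS]/= Normc.normcM normc_real ger0_norm.
rewrite /patch; case: ifPn => [/set_mem|_]; last first.
  by case: ifPn => // _; rewrite lee_fin powR_ge0.
rewrite /F /= => xF; rewrite ifT.
  by rewrite nSx powRM ?normc_ge0// EFinM.
by apply/mem_set; rewrite /= nSx mulrC -ler_pdivrMr.
Qed.

End contraction_Lp.

Section Lp_bounds.
Context {d : measure_display} {Omega : measurableType d} {R : realType}.
Variable mu : {measure set Omega -> \bar R}.
Hypothesis mu0 : (0 < mu setT)%E.
Implicit Types (f g : Omega -> R[i]) (p c : R).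

Lemma cLnorm_le_powR p c f : 0 < p -> 0 <= c ->
  (\int[mu]_x (normc (f x) `^ p)%:E <= (c `^ p)%:E)%E ->
  (cLnorm mu p%:E f <= c%:E)%E.
Proof.
move=> p0 c0 h; rewrite cLnormE ?gt_eqF//.
have -> : c%:E = ((c `^ p)%:E `^ p^-1)%E.
  by rewrite poweR_EFin -powRrM mulfV ?gt_eqF// powRr1.
apply: gt0_ler_poweR => //; rewrite ?invr_ge0 ?(ltW p0)// in_itv/= ?leey ?andbT.
  by apply: integral_ge0 => x _; exact: normc_powR_ge0.
by rewrite lee_fin powR_ge0.
Qed.

(** [K] depends on [p] alone, so it serves all the operators of a semigroup at once. The case
    [p = 1] is separate because [2^(p-1) - 1] vanishes there. *)
Lemma contr_Lp p : 1 <= p -> exists2 K : R, 0 <= K &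
  forall S, L1_Loo_contraction mu S -> forall f, cLp mu p%:E f ->
  cLp mu p%:E (S f) /\ (cLnorm mu p%:E (S f) <= K%:E * cLnorm mu p%:E f)%E.
Proof.
rewrite le_eqVlt => /predU1P[<-|p1].
  exists 1 => // S S_contr f f1; split; first exact: contr_L1 f1.
  by rewrite mul1e; exact: contr_L1_le.
have p0 : 0 < p by rewrite (lt_trans _ p1).
have [C C0 HC] : exists2 C : R, 0 <= C &
    forall S, L1_Loo_contraction mu S -> forall f, cLp mu p%:E f ->
  (\int[mu]_x (normc (S f x) `^ p)%:E <=
   C%:E * \int[mu]_x (normc (f x) `^ p)%:E)%E.
  eexists; last by move=> S S_contr f; exact: contr_Lp_int.
  have r1 : 1 < 2 `^ (p - 1) :> R.
    have q0 : 0 < p - 1 by rewrite subr_gt0.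
    have := @gt0_ltr_powR R (p - 1) q0 1 2; rewrite !nnegrE powR1 => -> //.
    by rewrite ltr1n.
  by rewrite mulr_ge0 ?powR_ge0// divr_ge0 ?powR_ge0// subr_ge0 ltW.
exists (C `^ p^-1); first exact: powR_ge0.
move=> S S_contr f fp.
have mSf : cmeasurable (S f).
  by apply: (contr_cmeasurable S_contr); exact: Lp_sub (ltW p1) fp.
have le1 : (cLnorm mu p%:E (S f) <= (C `^ p^-1)%:E * cLnorm mu p%:E f)%E.
  have int0 g : (0 <= \int[mu]_x (normc (g x) `^ p)%:E)%E.
    by apply: integral_ge0 => x _; exact: normc_powR_ge0.
  rewrite !cLnormE ?gt_eqF// -poweR_EFin -poweRM ?lee_fin//.
  apply: gt0_ler_poweR; rewrite ?invr_ge0 ?(ltW p0)// ?in_itv/= ?leey ?andbT//.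
    by rewrite mule_ge0 ?lee_fin.
  exact: HC.
split => //; split => //; rewrite /= (le_lt_trans le1)// lte_mul_pinfty//.
  by rewrite lee_fin powR_ge0.
by case: fp.
Qed.

Lemma normc_indicM (A : set Omega) f x :
  normc (((fun x => \1_A x : R[i]) * f) x) = \1_A x * normc (f x).
Proof.
rewrite [X in normc X](_ : _ = \1_A x * f x)// Normc.normcM /indic.
by case: (_ \in _); rewrite ?Normc.normc1 ?Normc.normc0.
Qed.

Lemma cLp_indicM p (A : set Omega) f : 0 < p -> measurable A ->
  cLp mu p%:E f -> cLp mu p%:E ((fun x => \1_A x : R[i]) * f).
Proof.
move=> p0 mA fp; apply: (ae_le_cLp p0 _ _ fp).
  by apply: cmeasurableM; [exact: cmeasurable_indic|exact: fp.1].
apply: nearW => x; rewrite normc_indicM ler_piMl ?normc_ge0//.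
Qed.

Let extreme f (n : nat) : set Omega :=
  [set x | n.+1%:R <= normc (f x)] `|` ~` [set x | n.+1%:R^-1 <= normc (f x)].

Let measurable_extreme f n : cmeasurable f -> measurable (extreme f n).
Proof.
move=> mf; apply: measurableU; last apply: measurableC.
all: exact/measurable_set_ge/measurable_normc.
Qed.

Lemma cvg_extreme p f : 0 < p -> cLp mu p%:E f ->
  (\int[mu]_x ((\1_(extreme f n) x * normc (f x)) `^ p)%:E)%E @[n --> \oo] --> 0%E.
Proof.
move=> p0 fp; have /(cLpP _ _ p0)[mf intf] := fp.
have mn n : measurable_fun setT
    (fun x => ((\1_(extreme f n) x * normc (f x)) `^ p)%:E).
  apply/measurable_EFinP; apply: (measurableT_comp (measurable_powR p)).
  apply: measurable_funM; last exact: measurable_normc.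
  by apply: measurable_indic; exact: measurable_extreme.
have lim0 x : ((\1_(extreme f n) x * normc (f x)) `^ p)%:E @[n --> \oo] --> 0%E.
  apply: cvg_near_cst.
  have [f0|fn0] := eqVneq (normc (f x)) 0.
    by apply: nearW => n; rewrite f0 mulr0 powR0// gt_eqF.
  have fp0 : 0 < normc (f x) by rewrite lt0r fn0 normc_ge0.
  exists (Num.bound (normc (f x)) + Num.bound (normc (f x))^-1)%N => // n /= nN.
  rewrite /indic memNset ?mul0r ?powR0 ?gt_eqF//.
  rewrite /extreme => -[/=|/negP]; last rewrite -ltNge.
    apply/negP; rewrite -ltNge; apply: lt_le_trans (archi_boundP (ltW fp0)) _.
    by rewrite ler_nat (leq_trans _ (leqW nN))// leq_addr.
  apply/negP; rewrite -leNgt invf_ple ?posrE//.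
  have : 0 <= (normc (f x))^-1 by rewrite invr_ge0 ltW.
  move=> /archi_boundP /ltW /le_trans; apply.
  by rewrite ler_nat (leq_trans _ (leqW nN))// leq_addl.
have dom x n : (`|((\1_(extreme f n) x * normc (f x)) `^ p)%:E| <=
    (normc (f x) `^ p)%:E)%E.
  rewrite abse_EFin ger0_norm ?powR_ge0// lee_fin.
  apply: ge0_ler_powR; rewrite ?nnegrE ?(ltW p0)//; last first.
  - by rewrite ler_piMl ?normc_ge0// /indic; case: (_ \in _).
  - exact: normc_ge0.
  - by rewrite mulr_ge0 ?normc_ge0.
have int_dom : mu.-integrable setT (fun x => (normc (f x) `^ p)%:E).
  apply/integrableP; split; first exact: measurable_normc_powR.
  by under eq_integral do rewrite gee0_abs ?normc_powR_ge0//.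
have := @dominated_cvg _ _ _ mu setT measurableT
  (fun n x => ((\1_(extreme f n) x * normc (f x)) `^ p)%:E) (cst 0%E)
  (fun x => (normc (f x) `^ p)%:E) mn
  (fun x _ => lim0 x) (fun x _ => isT) int_dom (fun n x _ => dom x n).
by rewrite integral0.
Qed.

(** [g], [w] and [v] are [f] restricted to its middle, large and small values. Large values are
    small in L^1 because [|f| <= |f|^p] where [|f| >= 1]; small values may fail to be integrable
    when [p > 1], but they are uniformly small. *)
Lemma Lp_truncation p f (e : R) : 1 <= p -> cLp mu p%:E f -> 0 < e ->
  exists g w v : Omega -> R[i],
  [/\ f = g + w + v, cLp mu 1 g /\ cLp mu p%:E g,
      (exists2 N : R, 0 <= N & forall x, normc (g x) <= N),
      [/\ cLp mu 1 w, cLp mu p%:E w & (cLnorm mu 1 w <= e%:E)%E] &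
      [/\ cLp mu p%:E v, forall x, normc (v x) <= e &
        (cLnorm mu p%:E (w + v)%R <= e%:E)%E]].
Proof.
move=> p1 fp e0; have p0 : 0 < p by rewrite (lt_le_trans _ p1).
have mf := fp.1.
(* The bound [e] on the integral serves the L^1 norm of [w], the bound [e^p] the L^p norm of
   [w + v]. *)
have m0 : 0 < Num.min e (e `^ p) by rewrite lt_min e0 powR_gt0.
have [n [nB ne]] : exists n,
    (\int[mu]_x ((\1_(extreme f n) x * normc (f x)) `^ p)%:E <=
      (Num.min e (e `^ p))%:E)%E /\ n.+1%:R^-1 <= e.
  near \oo => n; exists n; split; near: n.
    have /fine_cvgP[h1 h2] := cvg_extreme p0 fp.
    move/cvgr0_norm_le : h2 => /(_ _ m0); apply: filterS2 h1 => n h1 h2.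
    rewrite -(fineK h1) lee_fin; exact: le_trans (ler_norm _) h2.
  by apply: filterS (near_infty_natSinv_lt (PosNum e0)) => n /ltW.
pose B := [set x | n.+1%:R <= normc (f x)].
pose A := [set x | n.+1%:R^-1 <= normc (f x)].
have mB : measurable B by exact/measurable_set_ge/measurable_normc.
have mA : measurable A by exact/measurable_set_ge/measurable_normc.
have n1 : 1 <= n.+1%:R :> R by rewrite ler1n.
have n0 : 0 < n.+1%:R :> R by [].
have BA : B `<=` A.
  by move=> x; apply: le_trans; rewrite (le_trans _ n1)// invf_le1.
pose cut (E : set Omega) := (fun x => \1_E x : R[i]) * f.
exists (cut (A `\` B)), (cut B), (cut (~` A)).
have cutp E : measurable E -> cLp mu p%:E (cut E) by move=> ?; exact: cLp_indicM.
have mAB : measurable (A `\` B) by exact: measurableD.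
have nA : measurable (~` A) by exact: measurableC.
have bigw x : normc (cut B x) <= (\1_(extreme f n) x * normc (f x)) `^ p.
  rewrite normc_indicM /indic; case: (boolP (x \in B)) => [xB|_].
    rewrite mem_set; last by left; exact: set_mem xB.
    rewrite !mul1r le1r_powR// (le_trans n1)//.
    exact: set_mem xB.
  by rewrite mul0r powR_ge0.
have wsum x : normc ((cut B + cut (~` A)) x) <= \1_(extreme f n) x * normc (f x).
  rewrite (le_trans (le_normcD _ _))// !normc_indicM -mulrDl.
  rewrite ler_wpM2r ?normc_ge0// /indic.
  case: (boolP (x \in B)) => xB.
    rewrite (@mem_set _ (extreme f n) x); last by left; exact: set_mem xB.
    rewrite memNset ?addr0//; apply; apply: BA; exact: set_mem xB.
  rewrite add0r; case: (boolP (x \in ~` A)) => // xA.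
  by rewrite mem_set//; right; exact: set_mem xA.
split.
- apply/funext => x; rewrite /cut.
  rewrite [RHS](_ : _ = \1_(A `\` B) x * f x + \1_B x * f x + \1_(~` A) x * f x)//.
  rewrite -!mulrDl -[LHS]mul1r; congr (_ * _).
  rewrite /indic in_setD in_setC.
  case: (boolP (x \in A)) => xA /=; case: (boolP (x \in B)) => xB;
    rewrite ?add0r ?addr0//.
  by move/negP : xA; case; apply/mem_set/BA/set_mem.
- split; last exact: cutp.
  apply/cLp1P; split; first by case: (cutp _ mAB).
  have /(cLpP _ _ p0)[_ intf] := fp.
  have c0 : (0 <= (n.+1%:R `^ (p - 1) : R)%:E)%E by rewrite lee_fin powR_ge0.
  apply: (@le_lt_trans _ _
    (\int[mu]_x ((n.+1%:R `^ (p - 1))%:E * (normc (f x) `^ p)%:E))%E); last first.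
    rewrite (ge0_integralZl mu measurableT (measurable_normc_powR p mf)
      (fun x _ => normc_powR_ge0 p (f x)) c0).
    by rewrite lte_mul_pinfty.
  apply: le_integral_ge0 => x _; first by rewrite lee_fin normc_ge0.
  rewrite -EFinM lee_fin normc_indicM /indic.
  case: (boolP (x \in _)) => [/set_mem[xA _]|_]; last first.
    by rewrite mul0r mulr_ge0// powR_ge0.
  rewrite mul1r -[_ `^ p]mulr_powRB1 ?normc_ge0// mulrCA -powRM ?normc_ge0//.
  rewrite ler_peMr ?normc_ge0//.
  apply: (@le_trans _ _ (1 `^ (p - 1))); first by rewrite powR1.
  apply: ge0_ler_powR; rewrite ?nnegrE ?subr_ge0 ?mulr_ge0 ?normc_ge0//.
  by rewrite -ler_pdivrMl// mulr1.
- exists n.+1%:R => // x; rewrite normc_indicM /indic.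
  case: (boolP (x \in _)) => [/set_mem[_ /negP]|_]; last by rewrite mul0r.
  by rewrite mul1r -ltNge; exact: ltW.
- have le1 : (cLnorm mu 1 (cut B) <= e%:E)%E.
    rewrite cLnorm1E.
    apply: (@le_trans _ _ (Num.min e (e `^ p))%:E); last first.
      by rewrite lee_fin ge_min lexx.
    apply: le_trans nB; apply: le_integral_ge0 => x _.
      by rewrite lee_fin normc_ge0.
    by rewrite lee_fin.
  split => //; last exact: cutp.
  split; first by case: (cutp _ mB).
  by rewrite /= (le_lt_trans le1)// ltry.
- split; first exact: cutp.
    move=> x; rewrite normc_indicM /indic.
    case: (boolP (x \in _)) => [/set_mem/negP|_]; last by rewrite mul0r ltW.
    by rewrite -ltNge mul1r => /ltW/le_trans; apply.
  apply: cLnorm_le_powR => //; first exact: ltW.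
  apply: (@le_trans _ _ (Num.min e (e `^ p))%:E); last first.
    by rewrite lee_fin ge_min lexx orbT.
  apply: le_trans nB; apply: le_integral_ge0 => x _; first exact: normc_powR_ge0.
  rewrite lee_fin ge0_ler_powR ?nnegrE ?(ltW p0) ?normc_ge0//.
  by rewrite mulr_ge0 ?normc_ge0.
Unshelve. all: by end_near. Qed.

End Lp_bounds.

(** * Contraction flows and equicontinuity of their orbits in L^p *)

Section flow.
Context {d : measure_display} {Omega : measurableType d} {R : realType}.
Variable mu : {measure set Omega -> \bar R}.
Hypothesis mu0 : (0 < mu setT)%E.
Implicit Types (f g : Omega -> R[i]) (p c : R).

(** Right continuity at 0 suffices as an axiom: since [S s f - S r f = S r (S (s - r) f - f)],
    contractivity makes the modulus of continuity at 0 valid along the whole orbit. *)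
Definition continuous_contraction_flow (S : R -> (Omega -> R[i]) -> Omega -> R[i]) :=
  [/\ forall s, 0 <= s -> L1_Loo_contraction mu (S s),
      forall f, cLp mu 1 f -> S 0 f = f %[ae mu],
      forall r s f, 0 <= r -> 0 <= s -> cLp mu 1 f ->
        S (r + s) f = S r (S s f) %[ae mu] &
      forall f (e : R), cLp mu 1 f -> 0 < e -> exists2 h, 0 < h &
        forall s, 0 <= s <= h -> (cLnorm mu 1 (S s f - f)%R <= e%:E)%E].

Variable S : R -> (Omega -> R[i]) -> Omega -> R[i].
Hypothesis S_flow : continuous_contraction_flow S.

Lemma flow_contr s : 0 <= s -> L1_Loo_contraction mu (S s).
Proof. by case: S_flow => h _ _ _; exact: h. Qed.

Lemma flow_L1_diff f (r s : R) : cLp mu 1 f -> 0 <= r <= s ->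
  (cLnorm mu 1 (S s f - S r f)%R <= cLnorm mu 1 (S (s - r) f - f)%R)%E.
Proof.
move=> f1 /andP[r0 rs]; have s0 : 0 <= s by exact: le_trans rs.
have sr0 : 0 <= s - r by rewrite subr_ge0.
have SL t : 0 <= t -> cLp mu 1 (S t f) by move=> t0; exact: contr_L1 (flow_contr t0) _ f1.
have Sd : cLp mu 1 (S (s - r) f - f) by apply: cLpB => //; exact: SL.
apply: le_trans (contr_L1_le (flow_contr r0) Sd).
rewrite (@eq_cLnorm _ _ _ _ _ _ (S r (S (s - r) f - f)))//.
- by apply: cmeasurableB; [case: (SL s s0)|case: (SL r r0)].
- by case: (contr_L1 mu0 (flow_contr r0) Sd).
have [_ _ semi _] := S_flow.
have := semi r (s - r) f r0 sr0 f1; rewrite addrC subrK => h1.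
have h2 := contrB mu0 (flow_contr r0) (L1_sub mu0 (SL _ sr0)) (L1_sub mu0 f1).
apply: filterS2 h1 h2 => x h1 h2 _.
have h1x : S s f x = S r (S (s - r) f) x := h1 I.
by rewrite (h2 I) [LHS](_ : _ = S s f x - S r f x)// h1x.
Qed.

(** For bounded integrable [g], the difference [S s g - S r g] has modulus at most [2 N], so its
    p-th power is at most [(2 N)^(p-1)] times its modulus and continuity in L^1 suffices. The rest
    [b] is small in L^p and remains so, uniformly in time, by [contr_Lp]. *)
Lemma flow_equicontinuous p f (e : R) : 1 <= p -> cLp mu p%:E f -> 0 < e ->
  exists2 h, 0 < h & forall r s, 0 <= r <= s -> s - r <= h ->
    (cLnorm mu p%:E (S s f - S r f)%R <= e%:E)%E.
Proof.
move=> p1 fp e0; have p0 : 0 < p by rewrite (lt_le_trans _ p1).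
have [K K0 HK] := contr_Lp mu0 p1.
pose e1 := e / (4 * (K + 1)).
have K10 : 0 < 4 * (K + 1) by rewrite mulr_gt0// ltr_wpDl.
have e10 : 0 < e1 by rewrite divr_gt0.
have [g [w [v [fE [g1 gp] [N N0 gN] [_ wp _] [vp _ wv]]]]] :=
  Lp_truncation p1 fp e10.
have wvp : cLp mu p%:E (w + v) by exact: cLpD.
set b := w + v in wv wvp.
have {}fE : f = g + b by rewrite fE addrA.
(* Chosen so that [(2 N)^(p-1) * dl <= (e / 2)^p]; the added 1 keeps the denominator positive when
   [N = 0]. *)
pose dl := (e / 2) `^ p / ((2 * N) `^ (p - 1) + 1).
have N1 : 0 < (2 * N) `^ (p - 1) + 1 by rewrite ltr_wpDl// powR_ge0.
have dl0 : 0 < dl by rewrite divr_gt0// powR_gt0// divr_gt0.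
have [_ _ _ /(_ g dl g1 dl0)[h h0 Hh]] := S_flow.
exists h => // r s /andP[r0 rs] srh.
have s0 : 0 <= s by exact: le_trans rs.
have SDE t : 0 <= t -> S t f = S t g + S t b %[ae mu].
  move=> t0; rewrite fE.
  by apply: (contrD (flow_contr t0)); [exact: L1_sub|exact: Lp_sub wvp].
have Sgp t : 0 <= t -> cLp mu p%:E (S t g).
  by move=> t0; case: (HK _ (flow_contr t0) _ gp).
have Sbp t : 0 <= t -> cLp mu p%:E (S t b).
  by move=> t0; case: (HK _ (flow_contr t0) _ wvp).
have Sfp t : 0 <= t -> cLp mu p%:E (S t f).
  by move=> t0; case: (HK _ (flow_contr t0) _ fp).
have -> : cLnorm mu p%:E (S s f - S r f)%R =
    cLnorm mu p%:E ((S s g - S r g) + (S s b - S r b))%R.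
  apply: eq_cLnorm => //.
  - by apply: cmeasurableB; [case: (Sfp s s0)|case: (Sfp r r0)].
  - apply: cmeasurableD; apply: cmeasurableB.
    + by case: (Sgp s s0).
    + by case: (Sgp r r0).
    + by case: (Sbp s s0).
    + by case: (Sbp r r0).
  apply: filterS2 (SDE s s0) (SDE r r0) => x h1 h2 _.
  have h1x : S s f x = S s g x + S s b x := h1 I.
  have h2x : S r f x = S r g x + S r b x := h2 I.
  rewrite [LHS](_ : _ = S s f x - S r f x)// h1x h2x.
  rewrite [RHS](_ : _ = (S s g x - S r g x) + (S s b x - S r b x))//.
  by rewrite opprD addrACA.
have Dg : cLp mu p%:E (S s g - S r g) by apply: cLpB => //; [exact: Sgp|exact: Sgp].
have Db : cLp mu p%:E (S s b - S r b) by apply: cLpB => //; [exact: Sbp|exact: Sbp].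
apply: (le_trans (cLnormD mu p1 Dg.1 Db.1)).
have -> : e = e / 2 + e / 2 by rewrite -splitr.
rewrite EFinD; apply: leeD; last first.
  apply: (le_trans (cLnormB mu p1 (Sbp s s0).1 (Sbp r r0).1)).
  have Kb t : 0 <= t -> (cLnorm mu p%:E (S t b) <= (K * e1)%:E)%E.
    move=> t0; have [_ h1] := HK _ (flow_contr t0) _ wvp.
    by rewrite (le_trans h1)// EFinM lee_wpmul2l ?lee_fin.
  apply: (le_trans (leeD (Kb s s0) (Kb r r0))).
  rewrite -EFinD lee_fin /e1.
  have -> : K * (e / (4 * (K + 1))) + K * (e / (4 * (K + 1))) =
      (K / (K + 1)) * (e / 2) by field; rewrite gt_eqF// ltr_wpDl.
  rewrite ler_piMl//; first by rewrite divr_ge0// ltW.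
  by rewrite ler_pdivrMr ?ltr_wpDl// mul1r lerDl.
apply: cLnorm_le_powR => //; first by rewrite divr_ge0// ltW.
have gbnd t : 0 <= t -> \forall x \ae mu, normc (S t g x) <= N.
  move=> t0; apply: (contr_Loo_le mu0 (flow_contr t0)) => //; first exact: g1.1.
  exact: nearW.
have c0 : (0 <= ((2 * N) `^ (p - 1))%:E)%E by rewrite lee_fin powR_ge0.
apply: (@le_trans _ _ (((2 * N) `^ (p - 1))%:E *
    \int[mu]_x (normc ((S s g - S r g) x))%:E)%E).
  have mn : measurable_fun setT (fun x => (normc ((S s g - S r g) x))%:E).
    by apply/measurable_EFinP; apply: measurable_normc; exact: Dg.1.
  have n0 x : setT x -> (0 <= (normc ((S s g - S r g) x))%:E)%E.
    by rewrite lee_fin normc_ge0.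
  rewrite -(ge0_integralZl mu measurableT mn n0 c0).
  apply: ae_le_integral_ge0 => //.
  - by apply: measurable_normc_powR; exact: Dg.1.
  - by move=> x _; exact: normc_powR_ge0.
  - by move=> x _; rewrite mule_ge0// lee_fin normc_ge0.
  apply: filterS2 (gbnd s s0) (gbnd r r0) => x h1 h2 _.
  rewrite -EFinM lee_fin -mulr_powRB1 ?normc_ge0// mulrC.
  rewrite ler_wpM2r ?normc_ge0// ge0_ler_powR ?nnegrE ?subr_ge0 ?normc_ge0//.
    by rewrite mulr_ge0.
  by rewrite (le_trans (ler_normcB _ _))// mulr2n mulrDl mul1r lerD.
apply: (@le_trans _ _ (((2 * N) `^ (p - 1))%:E * dl%:E)%E).
  rewrite lee_wpmul2l// -cLnorm1E.
  rewrite (le_trans (flow_L1_diff g1 _)) ?r0//.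
  by apply: Hh; rewrite subr_ge0 rs.
rewrite -EFinM lee_fin /dl mulrCA ler_piMr ?powR_ge0//.
by rewrite ler_pdivrMr// mul1r lerDl.
Qed.

End flow.

(** * The maximal inequality *)

Section maximal_ergodic_inequality.
Context {d : measure_display} {Omega : measurableType d} {R : realType}.
Variable mu : {measure set Omega -> \bar R}.
Hypothesis mu0 : (0 < mu setT)%E.
Variable V : nat -> (Omega -> R[i]) -> Omega -> R[i].
Hypothesis V_contr : forall k, L1_Loo_contraction mu (V k).
Hypothesis V0 : forall f, cLp mu 1 f -> V 0%N f = f %[ae mu].
Hypothesis VS : forall k f, cLp mu 1 f -> V k.+1 f = V k (V 1%N f) %[ae mu].
Variables (a : R) (u : Omega -> R[i]).
Hypotheses (a0 : 0 < a) (u1 : cLp mu 1 u).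

(* Filling scheme: [(fill n).1 x <= a] is the mass deposited at [x] before time
   [n] and [(fill n).2] the mass still travelling; at time [n] as much of it as
   possible is deposited, and the excess is moved by [V 1]. *)
Fixpoint fill (n : nat) : (Omega -> R) * (Omega -> R[i]) :=
  if n is m.+1 then
    let A := (fill m).1 in
    let h := (fill m).2 in
    let D := ctrunc (fun x => a - A x) h in
    (fun x => A x + normc (D x), V 1%N (h - D))
  else (cst 0, u).

Let A n := (fill n).1.
Let h n := (fill n).2.
Let D n := ctrunc (fun x => a - A n x) (h n).

Let AS n x : A n.+1 x = A n x + normc (D n x). Proof. by []. Qed.
Let A_bounds n x : 0 <= A n x <= a.
Proof.
elim: n => [|n /andP[A0 Aa]]; first by rewrite lexx ltW.
rewrite AS addr_ge0 ?normc_ge0//= /D normc_ctrunc ?subr_ge0//.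
by rewrite -lerBrDl ge_min lexx orbT.
Qed.

Let aA_ge0 n x : 0 <= a - A n x.
Proof. by rewrite subr_ge0; case/andP: (A_bounds n x). Qed.

Let normcD_split n x : normc (D n x) + normc ((h n - D n) x) = normc (h n x).
Proof.
rewrite [X in _ + normc X](_ : _ = h n x - D n x)//.
by rewrite /D normc_ctrunc// normc_ctruncB// subrKC.
Qed.

Let L1_sub_fun f g : cmeasurable f -> cLp mu 1 g ->
  (forall x, normc (f x) <= normc (g x)) -> cLp mu 1 f.
Proof. by move=> mf g1 fg; apply: ae_le_cLp g1 => //; exact: nearW. Qed.

Let measurability n : measurable_fun setT (A n) /\ cLp mu 1 (h n).
Proof.
elim: n => [|n [mA h1]]; first by split => //; exact: measurable_cst.
have mD : cmeasurable (D n).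
  by apply: cmeasurable_ctrunc; [exact: measurable_funB|exact: h1.1].
have D1 : cLp mu 1 (D n).
  by apply: (L1_sub_fun _ h1) => // x; rewrite -(normcD_split n x) lerDl normc_ge0.
split; first by apply: measurable_funD => //; exact: measurable_normc.
by apply: (contr_L1 mu0 (V_contr 1)); apply: cLpB.
Qed.

Let D_L1 n : cLp mu 1 (D n).
Proof.
have [mA h1] := measurability n.
apply: (L1_sub_fun _ h1) => [|x]; last first.
  by rewrite -(normcD_split n x) lerDl normc_ge0.
by apply: cmeasurable_ctrunc; [exact: measurable_funB|exact: h1.1].
Qed.

Let e_L1 n : cLp mu 1 (h n - D n).
Proof. by apply: cLpB => //; case: (measurability n). Qed.

(** At each step [|h n|] splits exactly into the moduli of the deposit and of the excess, and [V 1]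
    does not increase the L^1 norm of the excess. *)
Let mass n :
  (\int[mu]_x (A n x)%:E + \int[mu]_x (normc (h n x))%:E <= cLnorm mu 1 u)%E.
Proof.
elim: n => [|n ih]; first by rewrite integral0 add0e cLnorm1E.
apply: le_trans ih; have [mA h1] := measurability n.
have mn (f : Omega -> R[i]) : cmeasurable f ->
    measurable_fun setT (fun x => (normc (f x))%:E).
  by move=> mf; apply/measurable_EFinP; exact: measurable_normc.
have n0 (f : Omega -> R[i]) x : setT x -> (0 <= (normc (f x))%:E)%E.
  by move=> _; rewrite lee_fin normc_ge0.
have A0 x : setT x -> (0 <= (A n x)%:E)%E.
  by rewrite lee_fin; case/andP: (A_bounds n x).
under eq_integral do rewrite AS EFinD.
rewrite (ge0_integralD mu measurableT A0 _ (n0 (D n)) (mn _ (D_L1 n).1)); last first.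
  exact/measurable_EFinP.
under [X in (_ <= _ + X)%E]eq_integral do rewrite -normcD_split EFinD.
rewrite (ge0_integralD mu measurableT (n0 (D n)) (mn _ (D_L1 n).1)
  (n0 (h n - D n)) (mn _ (e_L1 n).1)).
rewrite -addeA leeD2l// leeD2l//.
by have := contr_L1_le (V_contr 1) (e_L1 n); rewrite !cLnorm1E.
Qed.

Let filled := \bigcup_n [set x | a <= A n x].

Let measurable_level n : measurable [set x | a <= A n x].
Proof. by apply: measurable_set_ge; case: (measurability n). Qed.

Let measure_filled : (a%:E * mu filled <= cLnorm mu 1 u)%E.
Proof.
have nd : nondecreasing_seq (fun n => [set x | a <= A n x]).
  apply/nondecreasing_seqP => n; apply/subsetPset => x /= /le_trans; apply.
  by rewrite AS lerDl normc_ge0.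
have cvgF := nondecreasing_cvg_mu measurable_level
  (bigcup_measurable (fun n _ => measurable_level n)) nd (mu := mu).
rewrite -(cvg_lim _ cvgF)// -limeMl//; last by apply/cvg_ex; eexists; exact: cvgF.
apply: lime_le.
  by apply: is_cvgeMl => //; apply/cvg_ex; eexists; exact: cvgF.
apply: nearW => n; apply: le_trans (mass n); rewrite -[leLHS]adde0.
apply: leeD; last by apply: integral_ge0 => x _; rewrite lee_fin normc_ge0.
apply: measure_ge_level; first by case: (measurability n).
  by move=> x; case/andP: (A_bounds n x).
exact: ltW.
Qed.

(** A point still below capacity after the deposit has received all the mass present there. *)
Let excess0 n x : A n.+1 x < a -> (h n - D n) x = 0.
Proof.
rewrite AS /D normc_ctrunc// => An; apply: Normc.eq0_normc.
rewrite [X in normc X](_ : _ = h n x - D n x)// /D normc_ctruncB//.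
rewrite min_l ?subrr//; move: An; rewrite addrC -ltrBrDr.
by case: (leP (normc (h n x)) (a - A n x)); rewrite // ltxx.
Qed.

(** Write [h i = D i + (h i - D i)] and absorb [w k *: D i] into [B k], which keeps it below
    [A i.+1]. At a point that is never filled, the excess contributes nothing for [k = 0]; for
    [k >= 1], [V k] of the excess is [V k.-1 (h i.+1)]. After this shift the sum is the same
    expression at stage [i.+1] with one term fewer, plus [V n (B' n)], which the L^oo contraction
    bounds by [a]. The arbitrary [B] and [w] make the induction close. *)
Let filling n : forall i (B : nat -> Omega -> R[i]) (w : nat -> R[i]),
  (forall k, cmeasurable (B k)) -> (forall k x, normc (B k x) <= A i x) ->
  (forall k, normc (w k) <= 1) ->
  \forall x \ae mu, (forall j, A j x < a) ->
    normc (\sum_(k < n) V k (B k + w k *: h i) x) <= n%:R * a.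
Proof.
elim: n => [|n ih] i B w mB BA w1.
  by apply: nearW => x _; rewrite big_ord0 mul0r Normc.normc0.
have [mA h1] := measurability i.
have AL1 j : cLp mu 1 (fun x => (A j x)%:C%C).
  have [mAj _] := measurability j.
  apply/cLp1P; split; first exact: cmeasurable_real.
  apply: le_lt_trans u1.2; apply: le_trans (mass j); rewrite -[leLHS]adde0.
  apply: leeD; last by apply: integral_ge0 => x _; rewrite lee_fin normc_ge0.
  apply: le_integral_ge0 => x _; first by rewrite lee_fin normc_ge0.
  by rewrite normc_real ger0_norm//; case/andP: (A_bounds j x).
have normA j x : normc (A j x)%:C%C = A j x.
  by rewrite normc_real ger0_norm//; case/andP: (A_bounds j x).
pose B' k := B k + w k *: D i.
have mB' k : cmeasurable (B' k).
  by apply: cmeasurableD => //; apply: cmeasurableZ; exact: (D_L1 i).1.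
have B'A k x : normc (B' k x) <= A i.+1 x.
  rewrite [X in normc X](_ : _ = B k x + w k * D i x)//.
  rewrite (le_trans (le_normcD _ _))// AS lerD// Normc.normcM.
  by rewrite ler_piMl// normc_ge0.
have B'1 k : cLp mu 1 (B' k).
  by apply: (L1_sub_fun _ (AL1 i.+1)) => // x; rewrite normA.
have B1 k : cLp mu 1 (B k).
  by apply: (L1_sub_fun _ (AL1 i)) => // x; rewrite normA.
have h'1 : cLp mu 1 (h i.+1) by case: (measurability i.+1).
pose w' k := w k.+1.
have w'1 k : normc (w' k) <= 1 by exact: w1.
have IH := ih i.+1 B' w' mB' B'A w'1.
have E1 k : V k (B k + w k *: h i) = V k (B' k) + w k *: V k (h i - D i) %[ae mu].
  have De := L1_sub mu0 (e_L1 i).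
  have h1k := contrD (V_contr k) (L1_sub mu0 (B'1 k)) (L1_plus_LooZ mu0 (w k) De).
  have h2k := contrZ mu0 (V_contr k) (w k) De.
  have -> : B k + w k *: h i = B' k + w k *: (h i - D i).
    by rewrite /B' -addrA -scalerDr subrKC.
  apply: filterS2 h1k h2k => x e1 e2 _.
  rewrite (e1 I) [LHS](_ : _ = V k (B' k) x + V k (w k *: (h i - D i)) x)//.
  have -> : V k (w k *: (h i - D i)) x = w k * V k (h i - D i) x := e2 I.
  by [].
have E2 k : V k (B' k + w' k *: h i.+1) = V k (B' k) + w' k *: V k (h i.+1) %[ae mu].
  have De := L1_sub mu0 h'1.
  have h1k := contrD (V_contr k) (L1_sub mu0 (B'1 k)) (L1_plus_LooZ mu0 (w' k) De).
  have h2k := contrZ mu0 (V_contr k) (w' k) De.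
  apply: filterS2 h1k h2k => x e1 e2 _.
  rewrite (e1 I) [LHS](_ : _ = V k (B' k) x + V k (w' k *: h i.+1) x)//.
  have -> : V k (w' k *: h i.+1) x = w' k * V k (h i.+1) x := e2 I.
  by [].
have last_le : \forall x \ae mu, normc (V n (B' n) x) <= a.
  apply: (contr_Loo_le mu0 (V_contr n)) => //; first exact: ltW.
  apply: nearW => x; rewrite (le_trans (B'A n x))//.
  by case/andP: (A_bounds i.+1 x).
have E3 := ae_foralln (fun k => VS k (e_L1 i)).
have {E1} E1 := ae_foralln E1; have {E2} E2 := ae_foralln E2.
have E0 := V0 (e_L1 i).
apply: filterS (filterI IH (filterI E1 (filterI E2 (filterI E3 (filterI E0 last_le))))).
move=> x [IHx [E1x [E2x [E3x [E0x lastx]]]]] Ax.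
have e0 : (h i - D i) x = 0 by exact: excess0.
have -> : \sum_(k < n.+1) V k (B k + w k *: h i) x =
    (\sum_(k < n) V k (B' k + w' k *: h i.+1) x) + V n (B' n) x.
  transitivity (\sum_(k < n.+1) (V k (B' k) x + w k * V k (h i - D i) x)).
    by apply: eq_bigr => k _; exact: E1x k I.
  rewrite big_split/= addrC big_ord_recl [X in X + _ + _](_ : _ = 0); last first.
    have -> : V (@ord0 n) (h i - D i) x = (h i - D i) x := E0x I.
    by rewrite e0 mulr0.
  rewrite add0r [X in _ + X]big_ord_recr/= addrA; congr (_ + _).
  rewrite -big_split/=; apply: eq_bigr => k _.
  have -> : V k (B' k + w' k *: h i.+1) x = V k (B' k) x + w' k * V k (h i.+1) x.
    exact: E2x k I.
  rewrite addrC; congr (_ + _); congr (_ * _).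
  exact: E3x k I.
rewrite (le_trans (le_normcD _ _))// -natr1 mulrDl mul1r lerD//.
exact: IHx.
Qed.

(** [E] is the set of points eventually filled to capacity [a]. It is built before [n] and the
    weights are known, and the weights need not be real or of constant sign; only the null set
    depends on them. *)
Lemma maximal_ergodic_inequality : exists E : set Omega,
  [/\ measurable E, (a%:E * mu E <= cLnorm mu 1 u)%E &
    forall n (w : nat -> R[i]), (forall k, normc (w k) <= 1) ->
    \forall x \ae mu, ~ E x ->
      normc (\sum_(k < n) w k * V k u x) <= n%:R * a].
Proof.
exists filled; split; first exact: bigcup_measurable.
  exact: measure_filled.
move=> n w w1.
have A0 (k : nat) x : normc ((0 : Omega -> R[i]) x) <= A 0%N x by rewrite Normc.normc0.
have F := filling n (fun k : nat => cmeasurable0) A0 w1.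
have Z := ae_foralln (fun k => contrZ mu0 (V_contr k) (w k) (L1_sub mu0 u1)).
apply: filterS2 F Z => x Fx Zx Ex.
have -> : \sum_(k < n) w k * V k u x =
    \sum_(k < n) V k (0 + w k *: h 0%N) x.
  by apply: eq_bigr => k _; rewrite add0r; rewrite (Zx k I).
apply: Fx => j; rewrite ltNge; apply/negP => aA; apply: Ex; exists j => //.
Qed.

End maximal_ergodic_inequality.

(** * Completeness and Bochner integrals *)

Section Lp_completeness.
Context {d : measure_display} {Omega : measurableType d} {R : realType}.
Variable mu : {measure set Omega -> \bar R}.
Implicit Types (f g : Omega -> R[i]) (p c : R).

Lemma powR_continuous_gt0 p (t : R) : 0 < t -> {for t, continuous (@powR R ^~ p)}.
Proof.
move=> t0; apply/differentiable_continuous/derivable1_diffP.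
by apply: derivable_powR; rewrite in_itv/= t0.
Qed.

Lemma sum_half_le (n : nat) : \sum_(0 <= k < n) (2 ^+ k)^-1 <= 2 :> R.
Proof.
suff -> : \sum_(0 <= k < n) (2 ^+ k)^-1 = 2 - 2 * (2 ^+ n)^-1 :> R.
  by rewrite gerBl mulr_ge0// invr_ge0 exprn_ge0.
elim: n => [|n ih]; first by rewrite big_nil expr0; lra.
rewrite big_nat_recr//= ih exprS; field; exact: expf_neq0.
Qed.

(** The series of the [|h n|^p] has a finite integral, as [(2^-n)^p <= 2^-n]; it is therefore finite
    almost everywhere, and its terms tend to 0. *)
Lemma ae_cvg0_of_cLnorm p c (h : nat -> Omega -> R[i]) : 1 <= p -> 0 <= c ->
  (forall n, cmeasurable (h n)) ->
  (forall n, (cLnorm mu p%:E (h n) <= (c / 2 ^+ n)%:E)%E) ->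
  \forall x \ae mu, normc (h n x) @[n --> \oo] --> 0.
Proof.
move=> p1 c0 mh hn; have p0 : 0 < p by rewrite (lt_le_trans _ p1).
pose F x : \bar R := (\sum_(n <oo) (normc (h n x) `^ p)%:E)%E.
have mF : measurable_fun setT F.
  apply: (@ge0_emeasurable_sum _ _ _ setT
    (fun n x => (normc (h n x) `^ p)%:E) xpredT) => n; last first.
    by move=> _; exact: measurable_normc_powR.
  by move=> x _ _; exact: normc_powR_ge0.
have F0 x : (0 <= F x)%E by apply: nneseries_ge0 => n _ _; exact: normc_powR_ge0.
have intF : (\int[mu]_x F x <= (2 * c `^ p)%:E)%E.
  rewrite (integral_nneseries mu measurableT
    (fun n => measurable_normc_powR p (mh n)) (fun n x _ => normc_powR_ge0 p _)).
  apply: lime_le.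
    apply: is_cvg_nneseries => n _ _; apply: integral_ge0 => x _.
    exact: normc_powR_ge0.
  apply: nearW => n.
  apply: (@le_trans _ _ (\sum_(0 <= k < n) (c `^ p * (2 ^+ k)^-1)%:E)%E).
    apply: lee_sum => k _; rewrite -cLnorm_poweR ?gt_eqF//.
    apply: (@le_trans _ _ ((c / 2 ^+ k)%:E `^ p)%E).
      apply: gt0_ler_poweR => //; first exact: ltW.
      - by rewrite in_itv/= cLnorm_ge0 leey.
      - by rewrite in_itv/= leey andbT lee_fin divr_ge0// exprn_ge0.
    rewrite poweR_EFin lee_fin powRM ?invr_ge0 ?exprn_ge0//.
    rewrite ler_wpM2l ?powR_ge0// ge1r_powR//.
    by rewrite invr_gt0 exprn_gt0//= invf_le1 ?exprn_gt0// exprn_ege1// ler1n.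
  rewrite sumEFin lee_fin -mulr_sumr mulrC ler_wpM2r ?powR_ge0//.
  exact: sum_half_le.
have iF : mu.-integrable setT F.
  apply/integrableP; split => //.
  under eq_integral do rewrite gee0_abs//.
  by rewrite (le_lt_trans intF)// ltry.
apply: filterS (integrable_ae measurableT iF) => x /(_ I) Fx.
have tail := @nneseries_tail_cvg _ (fun n => (normc (h n x) `^ p)%:E) xpredT.
have {}tail := tail _ (fun n _ => normc_powR_ge0 p (h n x)).
have {}tail := tail (_ : (F x < +oo)%E).
have Fxy : (F x < +oo)%E by move: Fx; rewrite ge0_fin_numE.
have {tail}/fine_cvgP[t1 t2] := tail Fxy.
apply/cvgr0Pnorm_le => e e0.
have ep0 : 0 < e `^ p by rewrite powR_gt0.
move/cvgr0_norm_le : t2 => /(_ _ ep0); apply: filterS2 t1 => n t1 t2.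
rewrite ger0_norm ?normc_ge0// leNgt; apply/negP => en.
have : normc (h n x) `^ p <= e `^ p.
  apply: le_trans t2; apply: le_trans (ler_norm _); rewrite -lee_fin fineK//.
  apply: (@le_trans _ _ (\sum_(n <= k < n.+1) (normc (h k x) `^ p)%:E)%E).
    by rewrite big_nat1.
  by apply: nneseries_lim_ge => i _ _; exact: normc_powR_ge0.
apply/negP; rewrite -ltNge; apply: gt0_ltr_powR => //.
- by rewrite nnegrE ltW.
- by rewrite nnegrE normc_ge0.
Qed.

Lemma cvg_of_geometric_increments (a : nat -> R) (M : R) :
  (forall n, `|a n.+1 - a n| <= M / 2 ^+ n) -> cvgn a.
Proof.
move=> aM.
have M0 : 0 <= M by have := aM 0%N; rewrite expr0 divr1; exact: le_trans.
have st : cvgn (series (telescope a)).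
  apply: normed_cvg; apply: (@series_le_cvg _ _ (geometric M (2^-1))).
  - by move=> n /=; rewrite normr_ge0.
  - by move=> n; exact: geometric_ge0.
  - by move=> n /=; rewrite exprVn; exact: aM.
  - by apply: is_cvg_geometric_series; rewrite ger0_norm// invf_lt1// ltr1n.
have -> : a = (fun n => a 0%N + series (telescope a) n).
  by apply/funext => n; exact: eq_sum_telescope.
by apply: is_cvgD => //; exact: is_cvg_cst.
Qed.

(** The rate [4^-n] leaves room for a factor [2^n]: the increments times [2^n] still have norms of
    order [2^-n], hence tend to 0 and are bounded almost everywhere. The increments are then
    dominated pointwise by a geometric series. Fatou's lemma transfers the norm estimate to the
    limit. *)
Lemma Lp_complete p c (f : nat -> Omega -> R[i]) : 1 <= p -> 0 <= c ->
  (forall n, cLp mu p%:E (f n)) ->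
  (forall n m, (n <= m)%N ->
    (cLnorm mu p%:E (f m - f n)%R <= (c / 4 ^+ n)%:E)%E) ->
  exists2 J, cLp mu p%:E J &
    forall n, (cLnorm mu p%:E (J - f n)%R <= (c / 4 ^+ n)%:E)%E.
Proof.
move=> p1 c0 fp fc; have p0 : 0 < p by rewrite (lt_le_trans _ p1).
pose h n := (2 ^+ n : R)%:C%C *: (f n.+1 - f n).
have mB n m : cmeasurable (f n - f m).
  by apply: cmeasurableB; [case: (fp n)|case: (fp m)].
have mh n : cmeasurable (h n) by exact: cmeasurableZ.
have hc n : (cLnorm mu p%:E (h n) <= (c / 2 ^+ n)%:E)%E.
  rewrite /h cLnormZ// normc_real ger0_norm ?exprn_ge0//.
  have -> : c / 2 ^+ n = 2 ^+ n * (c / 4 ^+ n).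
    have -> : 4 ^+ n = 2 ^+ n * 2 ^+ n :> R.
      by rewrite -exprMn; congr (_ ^+ _); lra.
    field; exact: expf_neq0.
  by rewrite EFinM lee_wpmul2l ?lee_fin ?exprn_ge0// fc.
have [N [mN N0 sN]] := ae_cvg0_of_cLnorm p1 c0 mh hc.
have cvgf x : ~ N x -> cvgn (fun n => complex.Re (f n x)) /\
    cvgn (fun n => complex.Im (f n x)).
  move=> Nx; have h0 : normc (h n x) @[n --> \oo] --> 0.
    by apply: contrapT => hN; apply: Nx; apply: sN.
  have [M HM] : exists M, forall n, normc (h n x) <= M.
    have /cvg_seq_bounded : cvgn (fun n => normc (h n x)) by apply/cvg_ex; exists 0.
    move=> [M [_ HM]]; exists (M + 1) => n.
    apply: le_trans (ler_norm _) _; apply: HM => //; by rewrite ltrDl.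
  have inc n : normc (f n.+1 x - f n x) <= M / 2 ^+ n.
    rewrite ler_pdivlMr ?exprn_gt0// mulrC; apply: le_trans (HM n).
    rewrite [X in _ <= normc X](_ : _ = (2 ^+ n : R)%:C%C * (f n.+1 x - f n x))//.
    by rewrite Normc.normcM normc_real ger0_norm ?exprn_ge0.
  split; apply: (@cvg_of_geometric_increments _ M) => n; apply: le_trans (inc n).
    by rewrite -ReN -ReD le_normc_Re.
  by rewrite -ImN -ImD le_normc_Im.
pose J x : R[i] := if x \in N then 0 else
  Complex (limn (fun n => complex.Re (f n x))) (limn (fun n => complex.Im (f n x))).
have mJ : cmeasurable J.
  have mNC : measurable (~` N) by exact: measurableC.
  have ReJ : (fun x => complex.Re (J x)) =
      (fun x => limn (fun n => complex.Re (f n x))) \_ (~` N).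
    by apply/funext => x; rewrite /J /patch in_setC; case: ifPn.
  have ImJ : (fun x => complex.Im (J x)) =
      (fun x => limn (fun n => complex.Im (f n x))) \_ (~` N).
    by apply/funext => x; rewrite /J /patch in_setC; case: ifPn.
  split; rewrite ?ReJ ?ImJ; apply/(measurable_restrictT _ mNC).
  - apply: (@measurable_fun_cvg _ _ _ _ (fun n x => complex.Re (f n x))).
      by move=> n; apply: measurable_funS measurableT (@subsetT _ _) _; case: (fp n).1.
    by move=> x Nx; case: (cvgf x Nx).
  - apply: (@measurable_fun_cvg _ _ _ _ (fun n x => complex.Im (f n x))).
      by move=> n; apply: measurable_funS measurableT (@subsetT _ _) _; case: (fp n).1.
    by move=> x Nx; case: (cvgf x Nx).
have lim0 x : ~ N x -> normc (f m x - J x) @[m --> \oo] --> 0.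
  move=> Nx; have [c1 c2] := cvgf x Nx.
  rewrite /J memNset//.
  set a := limn _; set b := limn _.
  apply: (@squeeze_cvgr _ _ _ _ (cst 0) (fun m =>
    `|complex.Re (f m x) - a| + `|complex.Im (f m x) - b|)).
  - apply: nearW => m; rewrite normc_ge0/=.
    by rewrite (le_trans (normc_le_ReIm _))// ReD ImD ReN ImN.
  - exact: cvg_cst.
  - rewrite -[X in _ --> X]addr0; apply: cvgD; apply/norm_cvg0P.
      by apply/subr_cvg0.
    by apply/subr_cvg0.
have limB n x : ~ N x -> normc (f m x - f n x) @[m --> \oo] --> normc (J x - f n x).
  move=> Nx; apply/subr_cvg0/norm_cvg0P.
  apply: (@squeeze_cvgr _ _ _ _ (cst 0) (fun m => normc (f m x - J x))).
  - apply: nearW => m; rewrite normr_ge0/= (le_trans (ler_normc_dist _ _))//.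
    by rewrite opprB addrA subrK.
  - exact: cvg_cst.
  - exact: lim0.
have JN n : (cLnorm mu p%:E (J - f n)%R <= (c / 4 ^+ n)%:E)%E.
  have cn0 : 0 <= c / 4 ^+ n by rewrite divr_ge0// exprn_ge0.
  apply: cLnorm_le_powR => //.
  apply: (@le_trans _ _
    (\int[mu]_x limn_einf (fun m => (normc ((f (m + n)%N - f n) x) `^ p)%:E))%E).
    apply: ae_le_integral_ge0 => //.
    - by apply: measurable_normc_powR; apply: cmeasurableB => //; case: (fp n).
    - by move=> x _; exact: normc_powR_ge0.
    - move=> x _; rewrite limn_einf_lim; apply: lime_ge; first exact: is_cvg_einfs.
      apply: nearW => m; apply: le_ereal_inf_tmp => _ [k /= _ <-].
      exact: normc_powR_ge0.
    exists N; split => // x /= hx; apply: contrapT => Nx; apply: hx => _.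
    rewrite [X in normc X](_ : _ = J x - f n x)//.
    (* Continuity of the power is available at positive points; at 0 the left-hand side vanishes. *)
    have [J0|Jn0] := eqVneq (normc (J x - f n x)) 0.
      rewrite J0 powR0 ?gt_eqF//.
      rewrite limn_einf_lim; apply: lime_ge; first exact: is_cvg_einfs.
      apply: nearW => m; apply: le_ereal_inf_tmp => _ [k /= _ <-].
      exact: normc_powR_ge0.
    have J0 : 0 < normc (J x - f n x) by rewrite lt0r Jn0 normc_ge0.
    have cvgp : (normc ((f (m + n)%N - f n) x) `^ p)%:E @[m --> \oo] -->
        (normc (J x - f n x) `^ p)%:E.
      apply: cvg_EFin; first exact: nearW.
      have := continuous_cvg _ (powR_continuous_gt0 (p := p) J0) (limB n x Nx).
      by rewrite -(cvg_shiftn n); apply.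
    have := cvg_limn_einf_sup cvgp.
    by move=> [-> _].
  apply: (le_trans (fatou mu measurableT _ _)).
  - by move=> m; exact: measurable_normc_powR.
  - by move=> m x _; exact: normc_powR_ge0.
  rewrite limn_einf_lim; apply: lime_le; first exact: is_cvg_einfs.
  apply: nearW => m; apply: ge_ereal_inf.
  exists (\int[mu]_x (normc ((f (m + n)%N - f n) x) `^ p)%:E)%E; first by exists m => /=.
  rewrite -cLnorm_poweR ?gt_eqF// -poweR_EFin.
  apply: gt0_ler_poweR; rewrite ?(ltW p0)// ?in_itv/= ?cLnorm_ge0 ?leey ?andbT//.
  by apply: fc; rewrite leq_addl.
exists J => //.
rewrite -(subrK (f 0%N) J); apply: cLpD => //.
split; first by apply: cmeasurableB => //; case: (fp 0%N).
by rewrite /= (le_lt_trans (JN 0%N))// ltry.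
Qed.

End Lp_completeness.

Section bochner_facts.
Context {d : measure_display} {Omega : measurableType d} {R : realType}.
Variables (mu : {measure set Omega -> \bar R}) (p : R).
Hypothesis p1 : 1 <= p.
Implicit Types (D : set R) (phi psi : @step d Omega R).
Local Notation lambda := (@lebesgue_measure R).
Local Notation N := (cLnorm mu p%:E).

Let p0 : 0 < p. Proof. exact: lt_le_trans p1. Qed.

#[local] Instance ae_lebesgue_filter : Filter (nbhs (almost_everywhere lambda)).
Proof. exact: (ae_filter_ringOfSetsType lambda). Qed.

Let weighted n (A : 'I_n -> set R) (v : 'I_n -> Omega -> R[i]) (s : R) :=
  \sum_(j < n) (\1_(A j) s : R[i]) *: v j.

Let weightedS n (A : 'I_n.+1 -> set R) (v : 'I_n.+1 -> Omega -> R[i]) s w :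
  w + weighted A v s =
  (if s \in A ord0 then w + v ord0 else w) +
  weighted (A \o lift ord0) (v \o lift ord0) s.
Proof.
rewrite /weighted big_ord_recl /indic addrA; case: ifPn => sA.
  by rewrite scale1r.
by rewrite scale0r addr0.
Qed.

Let measurable_mem (A : set R) : measurable A ->
  measurable_fun setT (fun s : R => s \in A).
Proof.
move=> mA; apply: (@measurable_fun_bool _ _ _ _ true); rewrite setTI.
rewrite (_ : _ @^-1` _ = A)//.
by apply/seteqP; split => x /=; [move/set_mem|move/mem_set].
Qed.

Let measurable_cLnorm_weighted n (A : 'I_n -> set R) (v : 'I_n -> Omega -> R[i]) w :
  (forall j, measurable (A j)) ->
  measurable_fun setT (fun s : R => N (w + weighted A v s)).
Proof.
elim: n A v w => [|n ih] A v w mA.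
  by under eq_fun do rewrite /weighted big_ord0 addr0; exact: measurable_cst.
rewrite (_ : (fun _ => _) = fun s => if s \in A ord0
    then N (w + v ord0 + weighted (A \o lift ord0) (v \o lift ord0) s)
    else N (w + weighted (A \o lift ord0) (v \o lift ord0) s)).
  apply: measurable_fun_ifT; first exact: measurable_mem.
    by apply: ih => j; exact: mA.
  by apply: ih => j; exact: mA.
by apply/funext => s; rewrite weightedS; case: ifPn.
Qed.

Let fine_measureD D (A B : set R) : measurable D -> (lambda D < +oo)%E ->
  measurable A -> measurable B -> A `<=` D ->
  fine (lambda A) = fine (lambda (A `&` B)) + fine (lambda (A `\` B)).
Proof.
move=> mD Dfin mA mB AD; rewrite -fineD.
- by rewrite addeC -measureDI.
- rewrite ge0_fin_numE// (le_lt_trans _ Dfin)// le_measure ?inE//.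
    exact: measurableI.
  by move=> x [/AD].
- rewrite ge0_fin_numE// (le_lt_trans _ Dfin)// le_measure ?inE//.
    exact: measurableD.
  by move=> x [/AD].
Qed.

(* The constant [w] makes the induction on the number of pieces go through:
   split [D] along the first piece. *)
Let cLnorm_weighted_le n : forall (A : 'I_n -> set R) (v : 'I_n -> Omega -> R[i])
    w D, measurable D -> (lambda D < +oo)%E -> (forall j, measurable (A j)) ->
  (forall j, cLp mu p%:E (v j)) -> cLp mu p%:E w ->
  (N ((fine (lambda D))%:C%C *: w +
      \sum_(j < n) (fine (lambda (A j `&` D)))%:C%C *: v j)%R <=
   \int[lambda]_(s in D) N (w + weighted A v s)%R)%E.
Proof.
elim: n => [|n ih] A v w D mD Dfin mA vp wp.
  rewrite big_ord0 addr0 cLnormZ//; last by case: wp.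
  under eq_integral do rewrite /weighted big_ord0 addr0.
  rewrite integral_cst// normc_real ger0_norm ?fine_ge0//.
  by rewrite fineK ?ge0_fin_numE// muleC.
set A0 := A ord0; have mA0 : measurable A0 by exact: mA.
have mD1 : measurable (D `&` A0) by exact: measurableI.
have mD2 : measurable (D `\` A0) by exact: measurableD.
have D1fin : (lambda (D `&` A0) < +oo)%E.
  by rewrite (le_lt_trans _ Dfin)// le_measure ?inE//; exact: subIsetl.
have D2fin : (lambda (D `\` A0) < +oo)%E.
  by rewrite (le_lt_trans _ Dfin)// le_measure ?inE//; exact: subDsetl.
have mA' j : measurable ((A \o lift ord0) j) by exact: mA.
have v'p j : cLp mu p%:E ((v \o lift ord0) j) by exact: vp.
have wvp : cLp mu p%:E (w + v ord0) by exact: cLpD.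
have ih1 := ih _ _ _ _ mD1 D1fin mA' v'p wvp.
have ih2 := ih _ _ _ _ mD2 D2fin mA' v'p wp.
have mint B : measurable B -> measurable_fun B (fun s => N (w + weighted A v s)).
  by move=> mB; apply: measurable_funS (measurable_cLnorm_weighted v w mA).
have -> : (\int[lambda]_(s in D) N (w + weighted A v s)%R =
    \int[lambda]_(s in D `&` A0) N (w + weighted A v s)%R +
    \int[lambda]_(s in D `\` A0) N (w + weighted A v s)%R)%E.
  rewrite -ge0_integral_setU//.
  - by rewrite setUIDK.
  - by rewrite setUIDK; exact: mint.
  - by move=> s _; exact: cLnorm_ge0.
  - by apply/disj_setPS => x [[_ xA] [_]].
rewrite [X in (_ <= X + _)%E](_ : _ = \int[lambda]_(s in D `&` A0)
    N (w + v ord0 + weighted (A \o lift ord0) (v \o lift ord0) s)%R)%E; last first.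
  apply: eq_integral => s /set_mem[_ sA].
  by rewrite weightedS ifT//; exact/mem_set.
rewrite [X in (_ <= _ + X)%E](_ : _ = \int[lambda]_(s in D `\` A0)
    N (w + weighted (A \o lift ord0) (v \o lift ord0) s)%R)%E; last first.
  apply: eq_integral => s /set_mem[_ sA].
  by rewrite weightedS ifF//; exact/memNset.
apply: le_trans (leeD ih1 ih2).
have sc (a : R) (f : Omega -> R[i]) : cLp mu p%:E f -> cLp mu p%:E (a%:C%C *: f).
  exact: cLpZ.
have cm E (B : 'I_n -> set R) (f : Omega -> R[i]) : cLp mu p%:E f ->
    cmeasurable ((fine (lambda E))%:C%C *: f +
      \sum_(j < n) (fine (lambda (B j)))%:C%C *: (v \o lift ord0) j).
  move=> fp; suff : cLp mu p%:E ((fine (lambda E))%:C%C *: f +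
      \sum_(j < n) (fine (lambda (B j)))%:C%C *: (v \o lift ord0) j) by case.
  by apply: cLpD => //; [exact: sc|apply: cLp_sum => // j _; exact: sc].
rewrite (le_trans _ (cLnormD mu p1 (cm _ _ _ wvp) (cm _ _ _ wp)))//.
rewrite le_eqVlt; apply/orP; left; apply/eqP; congr (N _).
have -> : fine (lambda D) = fine (lambda (D `&` A0)) + fine (lambda (D `\` A0)).
  exact: (fine_measureD mD).
rewrite big_ord_recl (setIC _ D) rmorphD/= scalerDl scalerDr.
have -> : \sum_(i < n) (fine (lambda (A (lift ord0 i) `&` D)))%:C%C *: v (lift ord0 i) =
  \sum_(i < n) (fine (lambda (A (lift ord0 i) `&` (D `&` A0))))%:C%C *: v (lift ord0 i) +
  \sum_(i < n) (fine (lambda (A (lift ord0 i) `&` (D `\` A0))))%:C%C *: v (lift ord0 i).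
  rewrite -big_split/=; apply: eq_bigr => i _; rewrite -scalerDl -rmorphD/=.
  rewrite (@fine_measureD D _ A0)//.
    by rewrite -setIA -setIDA.
  by apply: measurableI => //; exact: mA.
have ac (x y z t u : Omega -> R[i]) :
    x + y + (z + (t + u)) = x + z + t + (y + u).
  by rewrite -!addrA; congr (_ + _); rewrite [LHS]addrCA; congr (_ + _); exact: addrCA.
exact: ac.
Qed.

Definition stepB phi psi : @step d Omega R :=
  Step (fun j : 'I_(step_size phi + step_size psi) =>
          match fintype.split j with
          | inl a => step_set a | inr b => step_set b end)
       (fun j => match fintype.split j with
          | inl a => step_val a | inr b => - step_val b end).

Let step_sumB phi psi (a : set R -> R[i]) :
  \sum_(j < step_size (stepB phi psi)) a (step_set j) *: step_val j =
  \sum_(j < step_size phi) a (step_set j) *: step_val j -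
  \sum_(j < step_size psi) a (step_set j) *: step_val j.
Proof.
rewrite [LHS]big_split_ord -sumrN; congr (_ + _).
- apply: eq_bigr => j _ /=.
  by have := unsplitK (inl j : 'I_(step_size phi) + 'I_(step_size psi)) => /= ->.
- apply: eq_bigr => j _ /=; rewrite -scalerN.
  by have := unsplitK (inr j : 'I_(step_size phi) + 'I_(step_size psi)) => /= ->.
Qed.

Lemma step_funB phi psi s :
  step_fun (stepB phi psi) s = step_fun phi s - step_fun psi s.
Proof. exact: (step_sumB phi psi (fun A => \1_A s)). Qed.

Lemma step_integralB phi psi :
  step_integral (stepB phi psi) = step_integral phi - step_integral psi.
Proof. exact: (step_sumB phi psi (fun A => (fine (lambda A))%:C%C)). Qed.

Lemma step_onB D phi psi : step_on mu p%:E D phi -> step_on mu p%:E D psi ->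
  step_on mu p%:E D (stepB phi psi).
Proof.
move=> phiD psiD j /=; case: fintype.split => [a|b]; first exact: phiD.
have [? ? vp] := psiD b; split => //.
by rewrite -scaleN1r; exact: cLpZ.
Qed.

Lemma measurable_cLnorm_step phi D : step_on mu p%:E D phi ->
  measurable_fun setT (fun s => N (step_fun phi s)).
Proof.
move=> phiD; have := @measurable_cLnorm_weighted _ (@step_set _ _ _ phi)
  (@step_val _ _ _ phi) 0 (fun j => _).
under eq_fun do rewrite add0r; apply => j.
by have [] := phiD j.
Qed.

Lemma step_integral_Lp phi D : step_on mu p%:E D phi ->
  cLp mu p%:E (step_integral phi).
Proof.
by move=> phiD; apply: cLp_sum => // j _; apply: cLpZ => //; have [] := phiD j.
Qed.

Lemma step_fun_Lp phi D s : step_on mu p%:E D phi ->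
  cLp mu p%:E (step_fun phi s).
Proof.
by move=> phiD; apply: cLp_sum => // j _; apply: cLpZ => //; have [] := phiD j.
Qed.

Lemma cLnorm_step_integral_le phi D : measurable D -> (lambda D < +oo)%E ->
  step_on mu p%:E D phi ->
  (N (step_integral phi) <= \int[lambda]_(s in D) N (step_fun phi s))%E.
Proof.
move=> mD Dfin phiD.
have h := @cLnorm_weighted_le _ (@step_set _ _ _ phi) (@step_val _ _ _ phi) 0 D
  mD Dfin (fun j => let: And3 h _ _ := phiD j in h)
  (fun j => let: And3 _ _ h := phiD j in h) (cLp0 mu p1).
move: h; rewrite scaler0 add0r; under eq_integral do rewrite add0r.
congr (N _ <= _)%E; apply: eq_bigr => j _.
by have [_ AD _] := phiD j; rewrite (setIidl AD).
Qed.

Lemma step_integral_dist_le phi psi D (e : R) :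
  measurable D -> (lambda D < +oo)%E -> 0 <= e ->
  step_on mu p%:E D phi -> step_on mu p%:E D psi ->
  {ae lambda, forall s, D s -> (N (step_fun phi s - step_fun psi s)%R <= e%:E)%E} ->
  (N (step_integral phi - step_integral psi)%R <= e%:E * lambda D)%E.
Proof.
move=> mD Dfin e0 phiD psiD ae; rewrite -step_integralB.
apply: (le_trans (cLnorm_step_integral_le mD Dfin (step_onB phiD psiD))).
apply: integral_ae_le_cst => //; first by move=> s _; exact: cLnorm_ge0.
by apply: filterS ae => s; rewrite step_funB.
Qed.

Lemma bochner_uniform_approx D (F : R -> Omega -> R[i]) J psi (e : R) :
  measurable D -> (lambda D < +oo)%E -> is_bochner_integral mu p%:E D F J ->
  step_on mu p%:E D psi -> 0 <= e ->
  {ae lambda, forall s, D s -> (N (F s - step_fun psi s)%R <= e%:E)%E} ->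
  (N (J - step_integral psi)%R <= e%:E * lambda D)%E.
Proof.
move=> mD Dfin [Fp Jp [phi [phiD _ phiF phiJ]]] psiD e0 ae.
apply/lee_addgt0Pr => eta eta0.
have eta2 : 0 < eta / 2 by rewrite divr_gt0.
have small (u : nat -> \bar R) : u n @[n --> \oo] --> 0%E -> (forall n, 0 <= u n)%E ->
    \forall n \near \oo, (u n <= (eta / 2)%:E)%E.
  move=> /fine_cvgP[u1 u2] u0; move/cvgr0_norm_le : u2 => /(_ _ eta2).
  apply: filterS2 u1 => n u1 u2; rewrite -(fineK u1) lee_fin.
  exact: le_trans (ler_norm _) u2.
have s1 := small _ phiF (fun n => integral_ge0 _ (fun s _ => cLnorm_ge0 mu _ _)).
have s2 := small _ phiJ (fun n => cLnorm_ge0 mu _ _).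
near \oo => n.
have h1 : (\int[lambda]_(s in D) N (F s - step_fun (phi n) s)%R <= (eta / 2)%:E)%E.
  by near: n; exact: s1.
have h2 : (N (J - step_integral (phi n))%R <= (eta / 2)%:E)%E by near: n; exact: s2.
have mJ := Jp.1.
have m1 := (step_integral_Lp (phiD n)).1.
have m2 := (step_integral_Lp psiD).1.
have -> : J - step_integral psi =
    (J - step_integral (phi n)) + (step_integral (phi n) - step_integral psi).
  by rewrite addrA subrK.
apply: (le_trans (cLnormD mu p1 (cmeasurableB mJ m1) (cmeasurableB m1 m2))).
rewrite [eta]splitr EFinD addeA addeC leeD//.
rewrite -step_integralB.
have chiD := step_onB (phiD n) psiD.
apply: (le_trans (cLnorm_step_integral_le mD Dfin chiD)).
have mG : measurable_fun D (fun s => N (step_fun (stepB (phi n) psi) s)).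
  exact: measurable_funS (measurable_cLnorm_step chiD).
pose G s := N (step_fun (stepB (phi n) psi) s).
(* [N (F s - step_fun (phi n) s)] is not known to be measurable in [s], so the integral of its sum
   with [e] cannot be split. The measurable function [maxe (G s - e) 0] lies below it almost
   everywhere, and adding [e] to this function dominates [G]. *)
have mG' : measurable_fun D (fun s => maxe (G s - e%:E) 0)%E.
  apply: measurable_maxe => //; apply: emeasurable_funB => //.
have max0 s : D s -> (0 <= maxe (G s - e%:E) 0)%E by rewrite le_max lexx orbT.
apply: (@le_trans _ _ (\int[lambda]_(s in D) (maxe (G s - e%:E) 0 + e%:E))%E).
  apply: le_integral_ge0 => s _; first exact: cLnorm_ge0.
  rewrite -leeBlDr//; by rewrite le_max lexx.
rewrite ge0_integralD//.
rewrite integral_cst// addeC leeD2l//; apply: le_trans h1.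
apply: ae_le_integral_ge0 => //; first by move=> s _; exact: cLnorm_ge0.
apply: filterS ae => s aes Ds; rewrite ge_max cLnorm_ge0 andbT leeBlDr//.
apply: le_trans (leeD (lexx _) (aes Ds)).
rewrite /G step_funB.
have ms := (step_fun_Lp s (phiD n)).1; have mp := (step_fun_Lp s psiD).1.
have mF := (Fp s Ds).1.
rewrite -(cLnormN mu p0 (cmeasurableB mF ms)) opprB.
rewrite (le_trans _ (cLnormD mu p1 (cmeasurableB ms mF) (cmeasurableB mF mp)))//.
by rewrite addrA subrK.
Unshelve. all: by end_near. Qed.

Lemma bochner_integrable_of_uniform D (F : R -> Omega -> R[i])
    (psi : nat -> @step d Omega R) (c : R) :
  measurable D -> (lambda D < +oo)%E -> 0 <= c ->
  (forall s, D s -> cLp mu p%:E (F s)) ->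
  (forall n, step_on mu p%:E D (psi n)) ->
  (forall n, {ae lambda, forall s, D s ->
    (N (F s - step_fun (psi n) s)%R <= (c / 4 ^+ n)%:E)%E}) ->
  bochner_integrable mu p%:E D F.
Proof.
move=> mD Dfin c0 Fp psiD ae.
pose L := fine (lambda D); have L0 : 0 <= L by exact: fine_ge0.
have LE : lambda D = L%:E by rewrite fineK// ge0_fin_numE.
have cn0 n : 0 <= c / 4 ^+ n by rewrite divr_ge0// exprn_ge0.
have cvg4 (b : R) : (b / 4 ^+ n)%:E @[n --> \oo] --> 0%E.
  apply: cvg_EFin; first exact: nearW.
  rewrite (_ : _ \o _ = geometric b (4^-1)).
    by apply: cvg_geometric; rewrite ger0_norm// invf_lt1// ltr1n.
  by apply/funext => n /=; rewrite exprVn.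
(* For [n <= m] the n-th and m-th step functions differ by at most [c / 4^n + c / 4^m <= 2 c / 4^n];
   integration over [D] multiplies this by [L]. *)
have [J Jp HJ] : exists2 J, cLp mu p%:E J & forall n,
    (N (J - step_integral (psi n))%R <= ((2 * c * L) / 4 ^+ n)%:E)%E.
  apply: Lp_complete => //; first by rewrite !mulr_ge0.
    by move=> n; exact: step_integral_Lp.
  move=> n m nm.
  have -> : (2 * c * L / 4 ^+ n)%:E = ((2 * (c / 4 ^+ n))%:E * lambda D)%E.
    by rewrite LE -EFinM; congr (_%:E); ring.
  apply: step_integral_dist_le => //; first by rewrite mulr_ge0.
  apply: filterS2 (ae n) (ae m) => s an am Ds.
  have ms := (step_fun_Lp s (psiD m)).1; have mn := (step_fun_Lp s (psiD n)).1.
  have mF := (Fp s Ds).1.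
  have -> : step_fun (psi m) s - step_fun (psi n) s =
      (F s - step_fun (psi n) s) - (F s - step_fun (psi m) s).
    by rewrite opprB [RHS]addrC addrA subrK.
  apply: (le_trans (cLnormB mu p1 (cmeasurableB mF mn) (cmeasurableB mF ms))).
  rewrite mulr2n mulrDl mul1r EFinD leeD ?an// (le_trans (am Ds))// lee_fin.
  by rewrite ler_wpM2l// lef_pV2 ?posrE ?exprn_gt0// ler_weXn2l// ler1n.
exists J; split => //; exists psi; split => //.
- apply: filterS (ae_foralln ae) => s aes Ds.
  apply: (@squeeze_cvge _ _ _ _ (cst 0%E) _ (fun n => (c / 4 ^+ n)%:E)) => //.
    by apply: nearW => n; rewrite cLnorm_ge0 aes.
  exact: cvg_cst.
- apply: (@squeeze_cvge _ _ _ _ (cst 0%E) _ (fun n => (c * L / 4 ^+ n)%:E)) => //.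
    apply: nearW => n; rewrite integral_ge0/=; last by move=> s _; exact: cLnorm_ge0.
    have -> : (c * L / 4 ^+ n)%:E = ((c / 4 ^+ n)%:E * lambda D)%E.
      by rewrite LE -EFinM; congr (_%:E); ring.
    by apply: integral_ae_le_cst => // s _; exact: cLnorm_ge0.
  exact: cvg_cst.
- apply: (@squeeze_cvge _ _ _ _ (cst 0%E) _ (fun n => ((2 * c * L) / 4 ^+ n)%:E)) => //.
    by apply: nearW => n; rewrite cLnorm_ge0 HJ.
  exact: cvg_cst.
Qed.

End bochner_facts.

(** * Riemann sums of the weighted orbit *)

Section level_partition.
Context {d : measure_display} {X : measurableType d} {R : realType}.
Implicit Types (x : X -> R) (D : set X).

Definition band x (k : nat) : set X :=
  [set s | k%:R <= x s] `\` [set s | k.+1%:R <= x s].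

Lemma bandP x k s : band x k s <-> k%:R <= x s < k.+1%:R.
Proof.
rewrite /band /=; split => [[-> /negP]|/andP[-> h]]; first by rewrite ltNge.
by split => //; apply/negP; rewrite -ltNge.
Qed.

Lemma band_uniq x k l s : band x k s -> band x l s -> k = l.
Proof. by move=> /bandP /truncn_def <- /bandP /truncn_def <-. Qed.

Lemma band_truncn x s : 0 <= x s -> band x (Num.truncn (x s)) s.
Proof. by move=> x0; apply/bandP; exact: truncn_itv. Qed.

Lemma measurable_band x k : measurable_fun setT x -> measurable (band x k).
Proof. by move=> mx; apply: measurableD; exact: measurable_set_ge. Qed.

Definition finite_partition (T : finType) (P : T -> set X) D :=
  [/\ forall q, measurable (P q), forall q, P q `<=` D,
      forall s, D s -> exists q, P q s &
      forall q r s, P q s -> P r s -> q = r].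

Lemma integral_partition (mu : {measure set X -> \bar R}) (T : finType)
    (P : T -> set X) D (g : X -> \bar R) : finite_partition P D ->
  measurable_fun D g -> (forall s, D s -> 0 <= g s)%E ->
  (\int[mu]_(s in D) g s = \sum_q \int[mu]_(s in P q) g s)%E.
Proof.
move=> [mP PD DP Pu] mg g0.
have DE : D = \big[setU/set0]_(q <- index_enum T) P q.
  apply/seteqP; split => s; rewrite -bigcup_seq.
    move=> /DP[q Pq]; exists q => //=; exact: mem_index_enum.
  by move=> [q _]; exact: PD.
rewrite DE in mg g0 *; apply: ge0_integral_bigsetU => //.
  exact: index_enum_uniq.
apply/trivIsetP => q r _ _ qr; apply/seteqP; split => // s [Pq Pr].
by move/eqP : qr; apply; exact: Pu Pq Pr.
Qed.

Lemma measure_partition (mu : {measure set X -> \bar R}) (T : finType)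
    (P : T -> set X) D : measurable D -> finite_partition P D ->
  (mu D = \sum_q mu (P q))%E.
Proof.
move=> mD PD; have := @integral_partition mu T P D (cst 1%E) PD.
rewrite integral_cst// mul1e => ->//; apply: eq_bigr => q _.
by rewrite integral_cst ?mul1e//; case: PD.
Qed.

(** Real and imaginary parts are rounded down on the grid of step [e / 2] starting at [- C]. The
    rounded value need not be a value of [b], but each coordinate stays within [C], whence the bound
    [2 * C]. *)
Lemma level_partition (b : X -> R[i]) (C e : R) : cmeasurable b -> 0 <= C ->
  (forall s, normc (b s) <= C) -> 0 < e ->
  exists (T : finType) (L : T -> set X) (z : T -> R[i]),
  [/\ finite_partition L setT, forall q, normc (z q) <= 2 * C &
      forall q s, L q s -> normc (b s - z q) <= e].
Proof.
move=> [mRe mIm] C0 bC e0.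
have dl0 : 0 < e / 2 by rewrite divr_gt0.
set dl := e / 2 in dl0.
pose x s := (complex.Re (b s) + C) / dl.
pose y s := (complex.Im (b s) + C) / dl.
pose M := (Num.truncn (2 * C / dl)).+1.
have bnd (u : R) : `|u| <= C -> 0 <= (u + C) / dl <= 2 * C / dl.
  rewrite ler_norml => /andP[uC Cu].
  rewrite divr_ge0 ?(ltW dl0)//=; last by rewrite -lerBlDr sub0r.
  by rewrite ler_pM2r ?invr_gt0// mulr2n mulrDl mul1r lerD2r.
have xb s : 0 <= x s <= 2 * C / dl by apply: bnd; exact: le_trans (le_normc_Re _) (bC s).
have yb s : 0 <= y s <= 2 * C / dl by apply: bnd; exact: le_trans (le_normc_Im _) (bC s).
pose val (k : nat) : R := k%:R * dl - C.
have valC (k : 'I_M) : `|val k| <= C.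
  have kM : (k : nat)%:R * dl <= 2 * C.
    rewrite -ler_pdivlMr//; apply: (@le_trans _ _ (Num.truncn (2 * C / dl))%:R).
      by rewrite ler_nat -ltnS.
    by rewrite truncn_le divr_ge0 ?mulr_ge0// ltW.
  rewrite ler_norml /val; apply/andP; split.
    by rewrite lerBrDl subrr mulr_ge0// ltW.
  by rewrite lerBlDr; lra.
have close (u : R) (k : nat) : k%:R <= (u + C) / dl < k.+1%:R -> `|u - val k| <= dl.
  rewrite ler_pdivlMr// ltr_pdivrMr// -natr1 mulrDl mul1r => /andP[h1 h2].
  rewrite /val ler_norml; apply/andP; split; lra.
exists ('I_M * 'I_M)%type, (fun q : 'I_M * 'I_M => band x q.1 `&` band y q.2),
  (fun q : 'I_M * 'I_M => Complex (val q.1) (val q.2)); split.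
- split => //.
  + move=> q; apply: measurableI; apply: measurable_band; apply: measurable_funM => //.
      exact: measurable_funD.
    exact: measurable_funD.
  + move=> s _; have /andP[x0 xM] := xb s; have /andP[y0 yM] := yb s.
    have kx : (Num.truncn (x s) < M)%N by rewrite ltnS le_truncn.
    have ky : (Num.truncn (y s) < M)%N by rewrite ltnS le_truncn.
    exists (Ordinal kx, Ordinal ky) => /=.
    by split; exact: band_truncn.
  + move=> [k l] [k' l'] s /= [bk bl] [bk' bl'].
    by congr pair; apply/val_inj; [exact: band_uniq bk bk'|exact: band_uniq bl bl'].
- move=> q; rewrite (le_trans (normc_le_ReIm _))//= mulr2n mulrDl mul1r lerD//.
- move=> q s /= [/bandP bk /bandP bl].
  rewrite (le_trans (normc_le_ReIm _))// ReD ImD ReN ImN/= [e]splitr lerD//.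
    exact: close.
  exact: close.
Qed.

End level_partition.

Section step_of_partition.
Context {d : measure_display} {Omega : measurableType d} {R : realType}.
Local Notation lambda := (@lebesgue_measure R).

Definition fin_step (T : finType) (P : T -> set R) (v : T -> Omega -> R[i]) :
    @step d Omega R :=
  Step (fun j : 'I_#|T| => P (enum_val j)) (fun j => v (enum_val j)).

Lemma fin_step_fun (T : finType) (P : T -> set R) (v : T -> Omega -> R[i]) D q s :
  finite_partition P D -> P q s -> step_fun (fin_step P v) s = v q.
Proof.
move=> [_ _ _ Pu] Pq; rewrite /step_fun/=.
rewrite -(@big_enum_val _ _ _ T predT (fun r => (\1_(P r) s : R[i]) *: v r)).
rewrite (bigD1 q)//= big1 ?addr0; first by rewrite /indic mem_set// scale1r.
move=> r /eqP rq; rewrite /indic memNset ?scale0r// => Pr.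
by apply: rq; exact: Pu Pr Pq.
Qed.

Lemma fin_step_integral (T : finType) (P : T -> set R) (v : T -> Omega -> R[i]) :
  step_integral (fin_step P v) = \sum_q (fine (lambda (P q)))%:C%C *: v q.
Proof.
rewrite /step_integral/=.
by rewrite -(@big_enum_val _ _ _ T predT (fun r => (fine (lambda (P r)))%:C%C *: v r)).
Qed.

End step_of_partition.

Section grid.
Context {d : measure_display} {Omega : measurableType d} {R : realType}.
Variable mu : {measure set Omega -> \bar R}.
Hypothesis mu0 : (0 < mu setT)%E.
Variable S : R -> (Omega -> R[i]) -> Omega -> R[i].
Variables (p : R) (p1 : 1 <= p) (f : Omega -> R[i]) (B : R).
Local Notation N := (cLnorm mu p%:E).
Hypothesis Sfp : forall s, 0 <= s -> cLp mu p%:E (S s f).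
Hypothesis SfB : forall s, 0 <= s -> (N (S s f) <= B%:E)%E.
Variables (b : R -> R[i]) (C : R).
Hypotheses (mb : cmeasurable b) (C0 : 0 <= C) (bC : forall s, normc (b s) <= C).
Local Notation lambda := (@lebesgue_measure R).

(** The cells cross time intervals of length [1 / (m + 1)] with level sets of [b], so that both
    factors of [b s *: S s f] are nearly constant on each. Summing over the level sets gives [c i],
    while [l i] is the length of the i-th interval inside [0, t]; the times [i / (m + 1)] do not
    depend on [t]. The last bound holds because [|z q - lam| <= |b s - lam| + e] on each cell. *)
Lemma grid_approximation (m : nat) (e t : R) (lam : R[i]) : 0 < e -> 0 < t ->
  (forall r s, 0 <= r <= s -> s - r <= m.+1%:R^-1 ->
    (N (S s f - S r f)%R <= e%:E)%E) ->
  exists (psi : @step d Omega R) (n : nat) (c : nat -> R[i]) (l : nat -> R),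
  [/\ step_on mu p%:E `[0, t] psi,
      forall s, 0 <= s <= t ->
        (N (b s *: S s f - step_fun psi s)%R <= (e * (B + 2 * C))%:E)%E,
      step_integral psi = \sum_(i < n) c i *: S (i%:R / m.+1%:R) f &
      [/\ n%:R <= t * m.+1%:R + 1 /\ forall i, (i < n)%N -> i%:R / m.+1%:R <= t,
          forall i, normc (c i) <= 2 * C * l i,
          forall i, 0 <= l i <= m.+1%:R^-1,
          \sum_(i < n) l i = t &
          ((\sum_(i < n) normc (c i - lam * (l i)%:C%C))%:E <=
           \int[lambda]_(s in `[0%R, t]) (normc (b s - lam)%R)%:E + (e * t)%:E)%E]].
Proof.
move=> e0 t0 Sclose.
have M0 : 0 < m.+1%:R :> R by [].
have [T [L [z [[mL _ Lcov Lu] z2C bz]]]] := level_partition mb C0 bC e0.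
pose x (s : R) := s * m.+1%:R.
have mx : measurable_fun setT x by exact: measurable_funM.
(* The successor adds the interval that contains [t], possibly cut off; hence the [+ 1] in the bound
   on [n]. *)
pose n := (Num.truncn (t * m.+1%:R)).+1.
pose J (i : nat) : set R := band x i `&` `[0, t]%classic.
have mJ i : measurable (J i) by apply: measurableI => //; exact: measurable_band.
have JP i s : J i s -> [/\ 0 <= s <= t, i%:R / m.+1%:R <= s &
    s - i%:R / m.+1%:R <= m.+1%:R^-1].
  move=> [/bandP/andP[h1 h2]]; rewrite /= in_itv/= => st; split => //.
    by rewrite ler_pdivrMr.
  rewrite lerBlDr -[X in X + _]mul1r -mulrDl ler_pdivlMr// nat1r.
  by rewrite ltW.
pose P (i : nat) q : set R := J i `&` L q.
have mP i q : measurable (P i q) by exact: measurableI.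
have partJ i : finite_partition (P i) (J i).
  split => //; first by move=> q s [].
    by move=> s Js; have [q Lq] := Lcov s I; exists q.
  by move=> q r s [_ Lq] [_ Lr]; exact: Lu Lq Lr.
have partD : finite_partition (fun q : 'I_n * T => P q.1 q.2) `[0, t]%classic.
  split => //; first by move=> q s [[]].
    move=> s /= st; have [q Lq] := Lcov s I.
    move: (st); rewrite in_itv/= => /andP[s0 s1].
    have x0 : 0 <= x s by rewrite mulr_ge0.
    have kn : (Num.truncn (x s) < n)%N by rewrite ltnS le_truncn// ler_pM2r.
    exists (Ordinal kn, q); split => //; split => //=; exact: band_truncn.
  move=> [i q] [j r] s /= [[bi _] Lq] [[bj _] Lr].
  congr pair; last exact: Lu Lq Lr.
  by apply/val_inj; exact: band_uniq bi bj.
have lamD : lambda `[0, t]%classic = t%:E.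
  by rewrite lebesgue_measure_itv/= lte_fin t0 -EFinB subr0.
have Pfin i q : lambda (P i q) \is a fin_num.
  rewrite ge0_fin_numE// (@le_lt_trans _ _ (lambda `[0, t]%classic))//.
    apply: le_measure; rewrite ?inE//; first exact: mP.
    by move=> s [[]].
  by rewrite lamD ltry.
pose v (q : 'I_n * T) := z q.2 *: S (q.1%:R / m.+1%:R) f.
pose l i := \sum_q fine (lambda (P i q)).
pose c i := \sum_q (fine (lambda (P i q)))%:C%C * z q.
have vp q : cLp mu p%:E (v q) by apply: cLpZ => //; apply: Sfp; rewrite divr_ge0.
have lJ i : (l i)%:E = lambda (J i).
  rewrite (measure_partition (lambda) (mJ i) (partJ i)) -sumEFin.
  by apply: eq_bigr => q _; rewrite fineK.
exists (fin_step (fun q : 'I_n * T => P q.1 q.2) v), n, c, l; split.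
- by move=> j; split; [exact: mP|move=> s [[]]|exact: vp].
- move=> s st.
  have [_ _ cov _] := partD.
  have /cov[q Pq] : `[0, t]%classic s by rewrite /= in_itv.
  rewrite (@fin_step_fun _ _ _ _ _ v _ q s partD Pq) /v.
  have [Js Lq] := Pq; have [_ ris sri] := JP _ _ Js.
  have s0 : 0 <= s by case/andP: st.
  have r0 : 0 <= q.1%:R / m.+1%:R :> R by rewrite divr_ge0.
  set r := _ / _ in r0 ris sri *.
  have -> : b s *: S s f - z q.2 *: S r f =
      (b s - z q.2) *: S s f + z q.2 *: (S s f - S r f).
    by rewrite scalerBl scalerBr addrA subrK.
  have m1 := (Sfp s0).1; have m2 := (Sfp r0).1.
  have m12 : cmeasurable (S s f - S r f) by exact: cmeasurableB.
  have p0 : 0 < p by rewrite (lt_le_trans _ p1).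
  apply: (le_trans (cLnormD mu p1 (cmeasurableZ _ m1) (cmeasurableZ _ m12))).
  rewrite mulrDr EFinD; apply: leeD.
    rewrite cLnormZ// EFinM; apply: lee_pmul; rewrite ?lee_fin ?normc_ge0 ?cLnorm_ge0//.
      exact: bz.
    exact: SfB.
  rewrite cLnormZ// mulrC EFinM; apply: lee_pmul; rewrite ?lee_fin ?normc_ge0 ?cLnorm_ge0//.
  by apply: Sclose; rewrite ?r0.
- rewrite fin_step_integral -(pair_bigA _ (fun (i : 'I_n) q =>
    (fine (lambda (P i q)))%:C%C *: v (i, q)))/=.
  apply: eq_bigr => i _; rewrite /c scaler_suml; apply: eq_bigr => q _.
  by rewrite /v /= scalerA.
split.
- split.
    by rewrite /n -natr1 lerD2r truncn_le mulr_ge0// ltW.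
  move=> i; rewrite ltnS => it; rewrite ler_pdivrMr//.
  apply: (@le_trans _ _ (Num.truncn (t * m.+1%:R))%:R); first by rewrite ler_nat.
  by rewrite truncn_le mulr_ge0// ltW.
- move=> i; rewrite /c (le_trans (ler_normc_sum _ _ _))// /l mulr_sumr.
  apply: ler_sum => q _; rewrite Normc.normcM normc_real ger0_norm ?fine_ge0//.
  by rewrite mulrC ler_wpM2r// fine_ge0.
- move=> i; rewrite sumr_ge0/=; last by move=> q _; exact: fine_ge0.
  rewrite -lee_fin lJ.
  apply: (@le_trans _ _ (lambda `[(i%:R / m.+1%:R), (i.+1%:R / m.+1%:R)]%classic)).
    apply: le_measure; rewrite ?inE//; first exact: mJ.
    move=> s Js; have [_ h1 h2] := JP _ _ Js; rewrite /=.
    rewrite in_itv/= h1/=; move: h2; rewrite lerBlDr => /le_trans; apply.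
    by rewrite -[i.+1%:R]natr1 mulrDl mul1r addrC.
  rewrite lebesgue_measure_itv/= lte_fin ifT; last first.
    by rewrite ltr_pM2r ?invr_gt0// ltr_nat.
  by rewrite -EFinB -mulrBl -[i.+1%:R]natr1 addrAC subrr add0r mul1r.
- apply: EFin_inj; rewrite -lamD.
  rewrite (measure_partition lambda _ partD)//.
  rewrite -(pair_bigA _ (fun (i : 'I_n) q => lambda (P i q)))/= -sumEFin.
  apply: eq_bigr => i _; rewrite -sumEFin.
  by apply: eq_bigr => q _; rewrite fineK.
- have mg : measurable_fun `[0, t]%classic (fun s : R => (normc (b s - lam))%:E).
    apply/measurable_EFinP; apply: measurable_funS measurableT (@subsetT _ _) _.
    apply: (@measurable_normc _ _ _ (fun s => b s - lam)).
    by apply: cmeasurableB => //; exact: cmeasurable_cst.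
  have -> : (\int[lambda]_(s in `[0%R, t]) (normc (b s - lam)%R)%:E + (e * t)%:E =
     \int[lambda]_(s in `[0%R, t]) ((normc (b s - lam)%R)%:E + e%:E))%E.
    have g0 (s : R) : `[0, t]%classic s -> (0 <= (normc (b s - lam))%:E)%E.
      by move=> _; rewrite lee_fin normc_ge0.
    have ge0 (s : R) : `[0, t]%classic s -> (0 <= e%:E)%E.
      by move=> _; rewrite lee_fin ltW.
    have mD : measurable (`[0, t]%classic : set R) by [].
    rewrite (ge0_integralD lambda mD g0 mg ge0 (measurable_cst _)).
    by rewrite integral_cst// EFinM -lamD.
  rewrite (integral_partition lambda partD); first last.
  - by move=> s _; rewrite -EFinD lee_fin addr_ge0 ?normc_ge0// ltW.
  - by apply: emeasurable_funD.
  rewrite -(pair_bigA _ (fun (i : 'I_n) q =>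
    \int[lambda]_(s in P i q) ((normc (b s - lam)%R)%:E + e%:E))%E)/= -sumEFin.
  apply: lee_sum => i _.
  apply: (@le_trans _ _ (\sum_q (normc (z q - lam) * fine (lambda (P i q)))%:E)%E).
    rewrite sumEFin lee_fin /c /l rmorph_sum mulr_sumr -sumrB.
    apply: le_trans (ler_normc_sum _ _ _) _; apply: ler_sum => q _.
    rewrite mulrC -mulrBl Normc.normcM ler_wpM2l ?normc_ge0//.
    by rewrite normc_real ger0_norm// fine_ge0.
  apply: lee_sum => q _; rewrite EFinM fineK// -(integral_cst lambda (mP i q)).
  apply: le_integral_ge0 => s Ps; first by rewrite lee_fin normc_ge0.
  rewrite -EFinD lee_fin.
  have -> : z q - lam = (b s - lam) - (b s - z q).
    by rewrite opprB [RHS]addrC addrA subrK.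
  rewrite (le_trans (ler_normcB _ _))// lerD2l; apply: bz.
  by case: Ps.
Qed.

End grid.

(** * Local Besicovitch weights *)

Section lebesgue_borel.
Context {R : realType}.
Local Notation lambda := (@lebesgue_measure R).
#[local] Existing Instance ae_lebesgue_filter.

Lemma lebesgue_measurable_split (A : set R) :
  (measurable (A : set (@lebesgueR R))) ->
  exists X M : set R, [/\ measurable X, measurable M, lambda M = 0%E,
    X `<=` A & A `<=` X `|` M].
Proof.
move=> mA.
have : (completed_algebra_gen lambda).-sigma.-measurable A by exact: mA.
rewrite g_sigma_completed_algebra_genE => -[X mX [Z [M [mM M0 ZM]]]] <-.
exists X, M; split => //.
by move=> x [Xx|/ZM]; [left|right].
Qed.

Lemma borel_lebesgue_measurable (A : set R) :
  measurable A -> measurable (A : set (@lebesgueR R)).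
Proof.
move=> mA; suff : (completed_algebra_gen lambda).-sigma.-measurable A by [].
rewrite g_sigma_completed_algebra_genE.
exists A => //; exists set0; last by rewrite setU0.
exact: negligible_set0.
Qed.

(** The preimages of the rational half-lines are countably many, each Borel up to a Borel null set;
    [M] is the union of these null sets. Allowing any larger [M'] lets one null set serve the real
    part, the imaginary part and the bound on the modulus. *)
Lemma lebesgue_measurable_fun_borel (D : set R) (g : R -> R) : measurable D ->
  measurable_fun (D : set (@lebesgueR R)) (g : @lebesgueR R -> R) ->
  exists M : set R, [/\ measurable M, lambda M = 0%E &
    forall M', measurable M' -> M `<=` M' -> measurable_fun (D `\` M') g].
Proof.
move=> mD mg.
pose q n : rat := odflt 0 (unpickle n).
have ex n : exists XM : set R * set R,
    [/\ measurable XM.1, measurable XM.2, lambda XM.2 = 0%E,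
        XM.1 `<=` D `&` g @^-1` `]ratr (q n), +oo[ &
        D `&` g @^-1` `]ratr (q n), +oo[ `<=` XM.1 `|` XM.2].
  have [X [M ?]] := lebesgue_measurable_split
    (mg (borel_lebesgue_measurable mD) _ (measurable_itv `]ratr (q n), +oo[)).
  by exists (X, M).
have [XM HXM] := choice ex.
have mM : measurable (\bigcup_n (XM n).2).
  by apply: bigcupT_measurable => n; have [] := HXM n.
exists (\bigcup_n (XM n).2); split => //.
  have : lambda.-negligible (\bigcup_n (XM n).2).
    apply: negligible_bigcup => n; have [_ mn n0 _ _] := HXM n.
    by exists (XM n).2; split.
  by move=> [Z [mZ Z0 sub]]; apply: (subset_measure0 _ mZ sub Z0).
move=> M' mM' MM'.
apply: (measurability _ (RGenOInfty.measurableE R)) => _ [_ [a ->] <-] /=.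
rewrite (_ : _ `&` _ = \bigcup_n
    (if a < ratr (q n) then (XM n).1 `\` M' else set0)).
  apply: bigcupT_measurable => n; case: ifPn => // _.
  by apply: measurableD => //; have [] := HXM n.
apply/seteqP; split => s /=.
  rewrite in_itv/= andbT => -[[Ds M's]] /rat_in_itvoo[r]; rewrite in_itv/= => /andP[ar rg].
  have rE : q (pickle r) = r by rewrite /q pickleK.
  exists (pickle r) => //; rewrite rE ar; split => //.
  have [_ _ _ _ sub] := HXM (pickle r).
  have /sub[//|Ms] : (D `&` g @^-1` `]ratr (q (pickle r)), +oo[) s.
    by split => //=; rewrite in_itv/= andbT rE.
  by exfalso; apply: M's; apply: MM'; exists (pickle r).
move=> [n _]; case: ifPn => // aq [Xs M's].
have [_ _ _ sub _] := HXM n.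
have [Ds] := sub s Xs; rewrite /= !in_itv/= !andbT => qg.
by split => //; exact: lt_trans qg.
Qed.

Lemma essup_norm_ae (beta : R -> R[i]) (C : R) : (essup_norm beta < C%:E)%E ->
  0 < C /\ {ae lambda, forall s, 0 <= s -> normc (beta s) <= C}.
Proof.
move=> bC; split.
  rewrite -lte_fin; apply: le_lt_trans bC; exact: Lnorm_ge0.
have l0 : (0 < lambda setT)%E.
  by rewrite -set_itvNyy lebesgue_measure_itv/= addye ?ltry.
move: bC; rewrite /essup_norm unlock l0 => /ltW/ess_supP.
apply: filterS => s /= + s0.
rewrite /patch ifT; last by rewrite mem_set//= in_itv/= s0.
by rewrite abse_EFin ger0_norm ?normc_ge0.
Qed.

(** Setting [b] to 0 off the good set makes it Borel and bounded by [C] everywhere, while its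
    integrals are those of [beta]. *)
Lemma borel_representative (beta : R -> R[i]) (C : R) :
  lebesgue_cmeasurable beta -> (essup_norm beta < C%:E)%E ->
  exists b : R -> R[i], [/\ cmeasurable b, forall s, normc (b s) <= C &
    {ae lambda, forall s, 0 <= s -> beta s = b s}].
Proof.
move=> [mRe mIm] /essup_norm_ae[C0 [M3 [mM3 M30 sM3]]].
have mD : measurable (`[0, +oo[%classic : set R) by [].
have [M1 [mM1 M10 H1]] := lebesgue_measurable_fun_borel mD mRe.
have [M2 [mM2 M20 H2]] := lebesgue_measurable_fun_borel mD mIm.
pose M := M1 `|` M2 `|` M3.
have mM : measurable M by apply: measurableU => //; exact: measurableU.
have M0 : lambda M = 0%E.
  by rewrite null_set_setU// ?null_set_setU//; exact: measurableU.
pose G := `[0%R, +oo[%classic `\` M.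
have mG : measurable G by exact: measurableD.
pose b (s : R) : R[i] := if s \in G then beta s else 0.
exists b; split.
- have ReE : (fun s => complex.Re (b s)) = (fun s => complex.Re (beta s)) \_ G.
    by apply/funext => s; rewrite /b /patch; case: ifPn.
  have ImE : (fun s => complex.Im (b s)) = (fun s => complex.Im (beta s)) \_ G.
    by apply/funext => s; rewrite /b /patch; case: ifPn.
  split; rewrite ?ReE ?ImE; apply/(measurable_restrictT _ mG).
    by apply: H1 => //; rewrite /M -setUA; exact: subsetUl.
  by apply: H2 => //; rewrite /M setUAC; exact: subsetUr.
- move=> s; rewrite /b; case: ifPn => [/set_mem[]|_]; last first.
    by rewrite Normc.normc0 ltW.
  rewrite /= in_itv/= andbT => s0 Ms; apply: contrapT => h.
  by apply: Ms; right; apply: sM3 => /= /(_ s0).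
- exists M; split => // s /= h; apply: contrapT => Ms; apply: h => s0.
  by rewrite /b mem_set//; split => //=; rewrite in_itv/= s0.
Qed.

Lemma trig_polynomial_cvg0 (q : R -> R[i]) (e : R) : trig_polynomial q -> 0 < e ->
  exists2 t0, 0 < t0 & forall s, 0 <= s < t0 -> normc (q s - q 0) <= e.
Proof.
move=> [n [w [lam [theta [_ qE]]]]] e0.
pose phi (s : R) := \sum_(j < n) normc (w j) *
  (`|cos (theta j * s) - 1| + `|sin (theta j * s)|).
have cphi : phi s @[s --> (0 : R)] --> 0.
  have lin (a : R) : a * s @[s --> (0 : R)] --> 0.
    by rewrite -[X in _ --> X](mulr0 a); apply: cvgMr; exact: cvg_id.
  have term j : normc (w j) * (`|cos (theta j * s) - 1| + `|sin (theta j * s)|)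
      @[s --> (0 : R)] --> 0.
    rewrite -[X in _ --> X](mulr0 (normc (w j))); apply: cvgMr.
    rewrite -[X in _ --> X]addr0; apply: cvgD; apply/norm_cvg0P.
      apply/subr_cvg0; rewrite -[X in _ --> X](@cos0 R).
      exact: (continuous_cvg _ (@continuous_cos R 0) (lin (theta j))).
    rewrite -[X in _ --> X](@sin0 R).
    exact: (continuous_cvg _ (@continuous_sin R 0) (lin (theta j))).
  rewrite /phi; elim: (index_enum _) => [|j r ih].
    by under eq_fun do rewrite big_nil; exact: cvg_cst.
  under eq_fun do rewrite big_cons.
  have := cvgD (term j) ih; rewrite addr0; apply; exact: nbhs_filter.
move/cvgr0_norm_le : cphi => /(_ _ e0) /nbhs_ballP[t0 /= t00 H].
exists t0 => // s /andP[s0 st].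
have := H s; rewrite /ball/= sub0r normrN ger0_norm// => /(_ st).
move=> /(le_trans (ler_norm _)); apply: le_trans.
rewrite !qE// -sumrB (le_trans (ler_normc_sum _ _ _))// ler_sum// => j _.
rewrite mulr0 -mulrBr Normc.normcM ler_wpM2l ?normc_ge0//.
rewrite (le_trans (normc_le_ReIm _))// ReD ImD ReN ImN /expi/= cos0 sin0.
by rewrite subr0.
Qed.

Lemma besicovitch_approximation (beta b : R -> R[i]) (e : R) :
  bounded_locally_besicovitch beta -> cmeasurable b ->
  {ae lambda, forall s, 0 <= s -> beta s = b s} -> 0 < e ->
  exists w : R[i], \forall t \near 0^'+,
    (\int[lambda]_(s in `[0%R, t]) (normc (b s - w)%R)%:E <= (e * t)%:E)%E.
Proof.
move=> [_ _ HB] mb bE e0.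
have e2 : 0 < e / 2 by rewrite divr_gt0.
have [q qt] := HB _ e2.
move=> /ereal_inf_lt[_ [V V0 <-]] supV.
have [t0 t00 qc] := trig_polynomial_cvg0 qt e2.
exists (q 0); near=> t.
have tpos : 0 < t by near: t; exact: nbhs_right_gt.
have tt0 : t < t0 by near: t; exact: nbhs_right_lt.
have Vt : V t by near: t; exact: V0.
have intq : (\int[lambda]_(s in `[0%R, t]) (normc (beta s - q s)%R)%:E <=
    (e / 2 * t)%:E)%E.
  have : ((t^-1)%:E * \int[lambda]_(s in `[0%R, t]) (normc (beta s - q s)%R)%:E <=
      (e / 2)%:E)%E.
    by apply: le_trans (ltW supV); apply: ereal_sup_ubound; exists t.
  by rewrite lee_pdivrMl// -EFinM mulrC.
have mD : measurable (`[0, t]%classic : set R) by [].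
have lamD : lambda `[0, t]%classic = t%:E.
  by rewrite lebesgue_measure_itv/= lte_fin tpos -EFinB subr0.
have mg : measurable_fun `[0, t]%classic (fun s : R => normc (b s - q 0)).
  apply: measurable_funS measurableT (@subsetT _ _) _.
  apply: (@measurable_normc _ _ _ (fun s => b s - q 0)).
  by apply: cmeasurableB => //; exact: cmeasurable_cst.
(* Since [beta - q] need not be Borel, the constant [e / 2] is split off on the side of [b]: the
   positive part of [|b - q 0| - e / 2] is Borel and almost everywhere at most [|beta - q|]. *)
have mg' : measurable_fun `[0, t]%classic
    (fun s : R => (Num.max (normc (b s - q 0) - e / 2) 0)%:E).
  apply/measurable_EFinP; apply: measurable_maxr => //.
  exact: measurable_funB.
have g0 (s : R) : `[0, t]%classic s ->
    (0 <= (Num.max (normc (b s - q 0) - e / 2) 0)%:E)%E.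
  by move=> _; rewrite lee_fin le_max lexx orbT.
have c0 (s : R) : `[0, t]%classic s -> (0 <= (e / 2)%:E)%E.
  by move=> _; rewrite lee_fin ltW.
apply: (@le_trans _ _ (\int[lambda]_(s in `[0%R, t])
    ((Num.max (normc (b s - q 0) - e / 2) 0)%:E + (e / 2)%:E))%E).
  apply: le_integral_ge0 => s _; first by rewrite lee_fin normc_ge0.
  by rewrite -EFinD lee_fin -lerBlDr le_max lexx.
rewrite (ge0_integralD lambda mD g0 mg' c0 (measurable_cst _)).
rewrite [e in (e * t)%:E]splitr mulrDl EFinD; apply: leeD; last first.
  by rewrite integral_cst// [leRHS]EFinM -lamD.
apply: le_trans intq; apply: ae_le_integral_ge0 => //.
  by move=> s _; rewrite lee_fin normc_ge0.
apply: filterS bE => s bE; rewrite /= in_itv/= => /andP[s0 st].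
rewrite lee_fin ge_max normc_ge0 andbT -bE// lerBlDr.
have -> : beta s - q 0 = (beta s - q s) + (q s - q 0) by rewrite addrA subrK.
rewrite (le_trans (le_normcD _ _))//.
by rewrite lerD2l qc// s0 (le_lt_trans st).
Unshelve. all: by end_near. Qed.

(** Constants [w n] of precision [2^-n] are compared by averaging over one short interval on which
    both approximations hold; they form a Cauchy sequence, and [lam] is its limit. *)
Lemma besicovitch_lebesgue_point (beta b : R -> R[i]) :
  bounded_locally_besicovitch beta -> cmeasurable b ->
  {ae lambda, forall s, 0 <= s -> beta s = b s} ->
  exists lam : R[i], forall e : R, 0 < e -> \forall t \near 0^'+,
    (\int[lambda]_(s in `[0%R, t]) (normc (b s - lam)%R)%:E <= (e * t)%:E)%E.
Proof.
move=> HB mb bE.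
have half0 n : 0 < (2 ^+ n)^-1 :> R by rewrite invr_gt0 exprn_gt0.
have [w Hw] := choice (fun n => besicovitch_approximation HB mb bE (half0 n)).
have lamD (t : R) : 0 < t -> lambda `[0, t]%classic = t%:E.
  by move=> t0; rewrite lebesgue_measure_itv/= lte_fin t0 -EFinB subr0.
have mg (t : R) (z : R[i]) : measurable_fun `[0, t]%classic
    (fun s : R => (normc (b s - z))%:E).
  apply/measurable_EFinP; apply: measurable_funS measurableT (@subsetT _ _) _.
  apply: (@measurable_normc _ _ _ (fun s => b s - z)).
  by apply: cmeasurableB => //; exact: cmeasurable_cst.
have g0 (t : R) (z : R[i]) (s : R) : `[0, t]%classic s -> (0 <= (normc (b s - z))%:E)%E.
  by move=> _; rewrite lee_fin normc_ge0.
have w_close n m : normc (w n - w m) <= (2 ^+ n)^-1 + (2 ^+ m)^-1.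
  near (0 : R)^'+ => t.
  have t0 : 0 < t by near: t; exact: nbhs_right_gt.
  have hn : (\int[lambda]_(s in `[0%R, t]) (normc (b s - w n)%R)%:E <=
      ((2 ^+ n)^-1 * t)%:E)%E by near: t; exact: Hw.
  have hm : (\int[lambda]_(s in `[0%R, t]) (normc (b s - w m)%R)%:E <=
      ((2 ^+ m)^-1 * t)%:E)%E by near: t; exact: Hw.
  rewrite -(ler_pM2r t0) mulrDl -lee_fin [leLHS]EFinM EFinD -(lamD t)//.
  apply: le_trans (leeD hn hm).
  rewrite -(ge0_integralD lambda _ (g0 t _) (mg t _) (g0 t _) (mg t _))//.
  rewrite -integral_cst//; apply: le_integral_ge0 => s _.
    by rewrite lee_fin normc_ge0.
  rewrite -EFinD lee_fin [leRHS]addrC.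
  rewrite (_ : w n - w m = (b s - w m) - (b s - w n)) ?ler_normcB//.
  by rewrite opprB [RHS]addrC addrA subrK.
have winc n : normc (w n.+1 - w n) <= 2 / 2 ^+ n.
  have -> : 2 / 2 ^+ n = (2 ^+ n)^-1 + (2 ^+ n)^-1 :> R.
    have two (x : R) : 2 * x = x + x by lra.
    exact: two.
  rewrite (le_trans (w_close _ _))// lerD2r.
  by rewrite lef_pV2 ?posrE ?exprn_gt0// ler_weXn2l// ler1n.
have cRe : cvgn (fun n => complex.Re (w n)).
  apply: (@cvg_of_geometric_increments _ _ 2) => n; apply: le_trans (winc n).
  by rewrite -ReN -ReD le_normc_Re.
have cIm : cvgn (fun n => complex.Im (w n)).
  apply: (@cvg_of_geometric_increments _ _ 2) => n; apply: le_trans (winc n).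
  by rewrite -ImN -ImD le_normc_Im.
pose lam : R[i] := Complex (limn (fun n => complex.Re (w n)))
  (limn (fun n => complex.Im (w n))).
exists lam => e e0.
have e3 : 0 < e / 3 by rewrite divr_gt0.
have [n [h1 h2 h3]] : exists n, [/\ (2 ^+ n)^-1 <= e / 3,
    `|complex.Re (w n) - complex.Re lam| <= e / 3 &
    `|complex.Im (w n) - complex.Im lam| <= e / 3].
  near \oo => n; exists n; split; near: n.
  - have : geometric 1 (2^-1 : R) n @[n --> \oo] --> 0.
      by apply: cvg_geometric; rewrite ger0_norm// invf_lt1// ltr1n.
    move/cvgr0_norm_le => /(_ _ e3); apply: filterS => n /=.
    by rewrite mul1r exprVn; exact: le_trans (ler_norm _).
  - move/cvgrPdist_le : cRe => /(_ _ e3); apply: filterS => n /=.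
    by rewrite distrC.
  - move/cvgrPdist_le : cIm => /(_ _ e3); apply: filterS => n /=.
    by rewrite distrC.
near=> t.
have t0 : 0 < t by near: t; exact: nbhs_right_gt.
have hn : (\int[lambda]_(s in `[0%R, t]) (normc (b s - w n)%R)%:E <=
    ((2 ^+ n)^-1 * t)%:E)%E by near: t; exact: Hw.
have wl : normc (w n - lam) <= e / 3 + e / 3.
  by rewrite (le_trans (normc_le_ReIm _))// ReD ImD ReN ImN lerD.
have c0 (s : R) : `[0, t]%classic s -> (0 <= (normc (w n - lam))%:E)%E.
  by move=> _; rewrite lee_fin normc_ge0.
apply: (@le_trans _ _ (\int[lambda]_(s in `[0%R, t])
    ((normc (b s - w n))%:E + (normc (w n - lam))%:E))%E).
  apply: le_integral_ge0 => s _; first by rewrite lee_fin normc_ge0.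
  rewrite -EFinD lee_fin.
  have -> : b s - lam = (b s - w n) + (w n - lam) by rewrite addrA subrK.
  exact: le_normcD.
rewrite (ge0_integralD lambda _ (g0 t _) (mg t _) c0 (measurable_cst _))//.
apply: (@le_trans _ _ ((e / 3 * t)%:E + ((e / 3 + e / 3) * t)%:E)%E).
  apply: leeD; first by rewrite (le_trans hn)// lee_fin ler_pM2r.
  rewrite integral_cst//.
  apply: (@le_trans _ _ ((normc (w n - lam))%:E * t%:E)%E).
    by rewrite -(lamD t).
  by rewrite -EFinM lee_fin ler_pM2r.
by rewrite -EFinD lee_fin -mulrDl ler_pM2r//; lra.
Unshelve. all: by end_near. Qed.

End lebesgue_borel.

(** * Local convergence *)

Section discrete_averages.
Context {d : measure_display} {Omega : measurableType d} {R : realType}.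
Variable mu : {measure set Omega -> \bar R}.
Hypothesis mu0 : (0 < mu setT)%E.
Variable S : R -> (Omega -> R[i]) -> Omega -> R[i].
Hypothesis S_flow : continuous_contraction_flow mu S.

(** A window of length [K] and its shift differ by [j] terms at each end; the identity also covers
    [j > K]. *)
Lemma sum_shift (V : zmodType) (x : nat -> V) (K j : nat) :
  \sum_(i < K) x (i + j)%N - \sum_(i < K) x i =
  \sum_(i < j) (x (i + K)%N - x i).
Proof.
rewrite sumrB; apply/eqP; rewrite subr_eq addrAC eq_sym subr_eq.
have split k l : \sum_(i < k + l) x i = \sum_(i < k) x i + \sum_(i < l) x (i + k)%N.
  by rewrite big_split_ord; congr (_ + _); apply: eq_bigr => i _; rewrite [in RHS]addnC.
by rewrite addrC -split addnC split addrC.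
Qed.

(** Strong continuity bounds [S s g - g] in norm only; averaging makes the increments small
    pointwise. Applying [S (j h)] shifts the window of [K] terms, so that only [2 j] terms bounded
    by [G] survive. All bounds are independent of [h]. *)
Lemma discrete_average (h a : R) (g : Omega -> R[i]) (G : R) : 0 < h -> 0 < a ->
  cLp mu 1 g -> 0 <= G -> (forall x, normc (g x) <= G) ->
  exists A : Omega -> R[i],
  [/\ cLp mu 1 A,
      forall e : R, (forall s, 0 <= s <= a ->
        (cLnorm mu 1 (S s g - g)%R <= e%:E)%E) ->
        (cLnorm mu 1 (g - A)%R <= e%:E)%E,
      \forall x \ae mu, normc (A x) <= G,
      forall j, \forall x \ae mu, normc (S (j%:R * h) A x) <= G &
      forall j, \forall x \ae mu,
        normc (S (j%:R * h) A x - A x) <= 2 * (j%:R * h) / a * G].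
Proof.
move=> h0 a0 g1 G0 gG.
have contr := flow_contr S_flow.
have ih0 (i : nat) : 0 <= i%:R * h by rewrite mulr_ge0// ltW.
(* The points [i h] with [i < K] stay in [0, a], where the estimate on [S s g - g] applies, while
   [a <= K h] turns [1 / K] into at most [h / a]. *)
pose K := (Num.truncn (a / h)).+1.
have K0 : 0 < K%:R :> R by [].
have aK : a <= K%:R * h by rewrite -ler_pdivrMr// ltW// truncnS_gt.
have Ka (i : 'I_K) : i%:R * h <= a.
  rewrite -ler_pdivlMr//; apply: (@le_trans _ _ (Num.truncn (a / h))%:R).
    by rewrite ler_nat -ltnS.
  by rewrite truncn_le divr_ge0// ltW.
pose Sg i := S (i%:R * h) g.
have Sg1 i : cLp mu 1 (Sg i) by exact: contr_L1 (contr _ (ih0 i)) _ g1.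
have SgG : \forall x \ae mu, forall i, normc (Sg i x) <= G.
  apply: ae_foralln => i; apply: (contr_Loo_le mu0 (contr _ (ih0 i))) => //.
    exact: g1.1.
  exact: nearW.
pose Sum := \sum_(i < K) Sg i.
have Sum1 : cLp mu 1 Sum by apply: cLp_sum.
pose A := (K%:R^-1 : R)%:C%C *: Sum.
have A1 : cLp mu 1 A by exact: cLpZ.
have AE x : A x = (K%:R^-1)%:C%C * \sum_(i < K) Sg i x.
  by rewrite /A [LHS]/(_ * Sum x) /Sum fct_sumE.
have nK (z : R[i]) : normc ((K%:R^-1)%:C%C * z) = K%:R^-1 * normc z.
  by rewrite Normc.normcM normc_real ger0_norm// invr_ge0.
have AG : \forall x \ae mu, normc (A x) <= G.
  apply: filterS SgG => x Sx; rewrite AE nK ler_pdivrMl//.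
  rewrite (le_trans (ler_normc_sum _ _ _))//.
  apply: (@le_trans _ _ (\sum_(i < K) G)); first exact: ler_sum.
  by rewrite sumr_const card_ord mulr_natl.
exists A; split => //.
- move=> e He.
  have -> : g - A = (K%:R^-1 : R)%:C%C *: \sum_(i < K) (g - Sg i).
    rewrite sumrB scalerBr sumr_const card_ord -[g *+ _]scaler_nat scalerA.
    rewrite (_ : _ * _ = 1) ?scale1r//.
    rewrite -(rmorph_nat (real_complex R)) -rmorphM mulVf ?rmorph1//.
    by rewrite gt_eqF.
  have mS i : cmeasurable (g - Sg i).
    by apply: cmeasurableB; [exact: g1.1|exact: (Sg1 i).1].
  rewrite cLnormZ//; last exact: cmeasurable_sum.
  rewrite normc_real ger0_norm ?invr_ge0// lee_pdivrMl//.
  rewrite (le_trans (cLnorm_sum mu _ _ _))//.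
  apply: (@le_trans _ _ (\sum_(i < K) e%:E)%E).
    apply: lee_sum => i _; rewrite -opprB cLnormN//.
      by apply: He; rewrite ih0 Ka.
    by apply: cmeasurableB; [exact: (Sg1 i).1|exact: g1.1].
  by rewrite sumEFin sumr_const card_ord -EFinM mulr_natl.
- by move=> j; apply: (contr_Loo_le mu0 (contr _ (ih0 j))) => //; exact: A1.1.
move=> j; have Sj := contr _ (ih0 j).
have h1 := contrZ mu0 Sj (K%:R^-1 : R)%:C%C (L1_sub mu0 Sum1).
have h2 := contr_sum mu0 Sj (index_enum 'I_K) (fun i => L1_sub mu0 (Sg1 i)).
have h3 : \forall x \ae mu, forall i, S (j%:R * h) (Sg i) x = Sg (i + j)%N x.
  apply: ae_foralln => i; have [_ _ semi _] := S_flow.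
  apply: filterS (semi _ _ _ (ih0 j) (ih0 i) g1) => x /(_ I) <-.
  by rewrite /Sg -mulrDl -natrD addnC.
apply: filterS2 (filterI h1 h2) (filterI h3 SgG) => x [h1x h2x] [h3x Sx].
have {}h1x : S (j%:R * h) A x = (K%:R^-1)%:C%C * S (j%:R * h) Sum x := h1x I.
have {}h2x : S (j%:R * h) Sum x = \sum_(i < K) Sg (i + j)%N x.
  rewrite (h2x I) fct_sumE; apply: eq_bigr => i _; exact: h3x.
rewrite h1x h2x AE -mulrBr nK (sum_shift (fun i => Sg i x)) ler_pdivrMl//.
rewrite (le_trans (ler_normc_sum _ _ _))//.
apply: (@le_trans _ _ (\sum_(i < j) (G + G))).
  apply: ler_sum => i _; rewrite (le_trans (ler_normcB _ _))// lerD//; exact: Sx.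
rewrite sumr_const card_ord.
have -> : K%:R * (2 * (j%:R * h) / a * G) = (K%:R * h / a) * ((G + G) *+ j).
  by rewrite -[in RHS]mulr_natl; field; rewrite gt_eqF.
rewrite ler_peMl ?mulrn_wge0 ?addr_ge0//.
by rewrite ler_pdivlMr// mul1r.
Qed.

(** Algebra at one point of [Omega], where [X], [Y], [Z] are the orbits of the three parts [A], [u],
    [v] of [f]. The five errors are the oscillation of the weight, the drift of [A], the maximal
    inequality for [u], the uniform smallness of [v], and the replacement of [A] by [f]. *)
Lemma discrete_estimate (n : nat) (c X Y Z : nat -> R[i]) (l : nat -> R)
    (lam A u v : R[i]) (C q t G r y dl : R) :
  0 <= C -> 0 <= G ->
  \sum_(i < n) normc (c i - lam * (l i)%:C%C) <= q -> \sum_(i < n) l i = t ->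
  (forall i, 0 <= l i) -> (forall i, normc (c i) <= C * l i) ->
  (forall i, (i < n)%N -> normc (X i) <= G) ->
  (forall i, (i < n)%N -> normc (X i - A) <= r) ->
  normc (\sum_(i < n) c i * Y i) <= y ->
  (forall i, normc (Z i) <= dl) -> normc u <= dl -> normc v <= dl ->
  normc (\sum_(i < n) c i * (X i + Y i + Z i) - lam * t%:C%C * (A + u + v)) <=
  q * G + normc lam * (t * r) + y + C * (t * dl) + normc lam * (t * (dl + dl)).
Proof.
move=> C0 G0 cq lt l0 cl XG Xr Yy Zd ud vd.
have t0 : 0 <= t by rewrite -lt sumr_ge0.
have -> : \sum_(i < n) c i * (X i + Y i + Z i) - lam * t%:C%C * (A + u + v) =
  \sum_(i < n) (c i - lam * (l i)%:C%C) * X i +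
  lam * \sum_(i < n) (l i)%:C%C * (X i - A) +
  \sum_(i < n) c i * Y i + \sum_(i < n) c i * Z i + - (lam * t%:C%C * (u + v)).
  have -> : \sum_(i < n) c i * (X i + Y i + Z i) =
      \sum_(i < n) c i * X i + \sum_(i < n) c i * Y i + \sum_(i < n) c i * Z i.
    by rewrite -!big_split/=; apply: eq_bigr => i _; rewrite !mulrDr.
  have -> : \sum_(i < n) (c i - lam * (l i)%:C%C) * X i =
      \sum_(i < n) c i * X i - lam * \sum_(i < n) (l i)%:C%C * X i.
    rewrite mulr_sumr -sumrB; apply: eq_bigr => i _.
    by rewrite mulrBl mulrA.
  have -> : \sum_(i < n) (l i)%:C%C * (X i - A) =
      \sum_(i < n) (l i)%:C%C * X i - t%:C%C * A.
    rewrite -lt rmorph_sum mulr_suml -sumrB; apply: eq_bigr => i _.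
    by rewrite mulrBr.
  ring.
apply: le_trans (le_normcD _ _) _; apply: lerD; last first.
  rewrite normcN -mulrA !Normc.normcM ler_wpM2l ?normc_ge0//.
  rewrite normc_real ger0_norm// ler_wpM2l//.
  by rewrite (le_trans (le_normcD _ _))// lerD.
apply: le_trans (le_normcD _ _) _; apply: lerD; last first.
  apply: le_trans (ler_normc_sum _ _ _) _.
  rewrite -lt mulr_suml mulr_sumr; apply: ler_sum => i _.
  by rewrite Normc.normcM mulrA ler_pM ?normc_ge0.
apply: le_trans (le_normcD _ _) _; apply: lerD => //.
apply: le_trans (le_normcD _ _) _; apply: lerD.
  apply: le_trans (ler_normc_sum _ _ _) _.
  apply: (@le_trans _ _ (\sum_(i < n) normc (c i - lam * (l i)%:C%C) * G)).
    apply: ler_sum => i _; rewrite Normc.normcM ler_wpM2l ?normc_ge0//.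
    exact: XG.
  by rewrite -mulr_suml ler_wpM2r.
rewrite Normc.normcM ler_wpM2l ?normc_ge0//.
apply: le_trans (ler_normc_sum _ _ _) _.
rewrite -lt mulr_suml; apply: ler_sum => i _.
by rewrite Normc.normcM normc_real ger0_norm// ler_wpM2l// Xr.
Qed.

End discrete_averages.

Section local_ergodic.
Context {d : measure_display} {Omega : measurableType d} {R : realType}.
Variable mu : {measure set Omega -> \bar R}.
Hypothesis mu0 : (0 < mu setT)%E.
Variable S : R -> (Omega -> R[i]) -> Omega -> R[i].
Hypothesis S_flow : continuous_contraction_flow mu S.
Variables (p : R) (p1 : 1 <= p) (f : Omega -> R[i]).
Hypothesis fp : cLp mu p%:E f.
Local Notation N := (cLnorm mu p%:E).
Local Notation lambda := (@lebesgue_measure R).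
#[local] Existing Instance ae_lebesgue_filter.

Let contr := flow_contr S_flow.

Lemma orbit_bounded : exists2 B : R, 0 <= B & forall s, 0 <= s ->
  cLp mu p%:E (S s f) /\ (N (S s f) <= B%:E)%E.
Proof.
have [K K0 HK] := contr_Lp mu0 p1.
exists (K * fine (N f)); first by rewrite mulr_ge0// fine_ge0// cLnorm_ge0.
move=> s s0; have [h1 h2] := HK _ (contr s0) _ fp.
split => //; rewrite EFinM fineK// ge0_fin_numE ?cLnorm_ge0//.
by case: fp.
Qed.

(** The mesh [2^-n] absorbs the surplus grid point; the oscillation [4^-n] is the rate required by
    [Lp_complete]. *)
Lemma fine_grids : exists m : nat -> nat, forall n,
  (m n).+1%:R^-1 <= (2 ^+ n)^-1 :> R /\
  forall r s, 0 <= r <= s -> s - r <= (m n).+1%:R^-1 ->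
    (N (S s f - S r f)%R <= ((4 ^+ n)^-1)%:E)%E.
Proof.
have ex n : exists k : nat, k.+1%:R^-1 <= (2 ^+ n)^-1 :> R /\
    forall r s, 0 <= r <= s -> s - r <= k.+1%:R^-1 ->
      (N (S s f - S r f)%R <= ((4 ^+ n)^-1)%:E)%E.
  have e0 : 0 < (4 ^+ n)^-1 :> R by rewrite invr_gt0 exprn_gt0.
  have [h h0 Hh] := flow_equicontinuous mu0 S_flow p1 fp e0.
  have k0 : 0 < Num.min h (2 ^+ n)^-1 by rewrite lt_min h0 invr_gt0 exprn_gt0.
  near \oo => k; exists k.
  have : k.+1%:R^-1 <= Num.min h (2 ^+ n)^-1.
    by near: k; apply: filterS (near_infty_natSinv_lt (PosNum k0)) => k /ltW.
  rewrite le_min => /andP[kh k2]; split => // r s rs srk.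
  by apply: Hh => //; exact: le_trans kh.
by have [m Hm] := choice ex; exists m.
Unshelve. all: by end_near. Qed.

Variables (beta b : R -> R[i]) (C : R).
Hypotheses (mb : cmeasurable b) (C0 : 0 <= C) (bC : forall s, normc (b s) <= C).
Hypothesis bE : {ae lambda, forall s, 0 <= s -> beta s = b s}.

Let inv4_gt0 n : 0 < (4 ^+ n)^-1 :> R. Proof. by rewrite invr_gt0 exprn_gt0. Qed.

Section fixed_grids.
Variables (B : R) (m : nat -> nat).
Hypothesis B0 : 0 <= B.
Hypothesis SB : forall s, 0 <= s -> cLp mu p%:E (S s f) /\ (N (S s f) <= B%:E)%E.
Hypothesis Hm : forall n, (m n).+1%:R^-1 <= (2 ^+ n)^-1 :> R /\
  forall r s, 0 <= r <= s -> s - r <= (m n).+1%:R^-1 ->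
    (N (S s f - S r f)%R <= ((4 ^+ n)^-1)%:E)%E.

Let F s := beta s *: S s f.

Let approximants (lam : R[i]) t : 0 < t ->
  exists (psi : nat -> @step d Omega R) (k : nat -> nat) (c : nat -> nat -> R[i])
    (l : nat -> nat -> R), forall n,
  [/\ step_on mu p%:E `[0, t] (psi n),
      {ae lambda, forall s, (`[0, t]%classic : set R) s ->
        (N (F s - step_fun (psi n) s)%R <= ((B + 2 * C) / 4 ^+ n)%:E)%E},
      step_integral (psi n) =
        \sum_(i < k n) c n i *: S (i%:R / (m n).+1%:R) f &
      [/\ (k n)%:R <= t * (m n).+1%:R + 1 /\
            forall i, (i < k n)%N -> i%:R / (m n).+1%:R <= t,
          forall i, normc (c n i) <= 2 * C * l n i,
          forall i, 0 <= l n i <= (m n).+1%:R^-1,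
          \sum_(i < k n) l n i = t &
          ((\sum_(i < k n) normc (c n i - lam * (l n i)%:C%C))%:E <=
           \int[lambda]_(s in `[0%R, t]) (normc (b s - lam)%R)%:E +
             ((4 ^+ n)^-1 * t)%:E)%E]].
Proof.
move=> t0.
have grid n := grid_approximation p1 (fun s s0 => (SB s0).1) (fun s s0 => (SB s0).2)
  mb C0 bC lam (inv4_gt0 n) t0 (Hm n).2.
have [psi Hpsi] := choice grid.
have [k Hk] := choice Hpsi.
have [c Hc] := choice Hk.
have [l Hl] := choice Hc.
exists psi, k, c, l => n; have [h1 h2 h3 h4] := Hl n; split => //.
apply: filterS bE => s bEs; rewrite /= in_itv/= => st.
rewrite /F bEs; last by case/andP: st.
by rewrite mulrC; exact: h2.
Qed.

Let lam_itv (t : R) : 0 < t -> lambda `[0, t]%classic = t%:E.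
Proof. by move=> t0; rewrite lebesgue_measure_itv/= lte_fin t0 -EFinB subr0. Qed.

Let BC0 : 0 <= B + 2 * C. Proof. by rewrite addr_ge0// mulr_ge0. Qed.

Lemma weighted_orbit_integrable_on_grid t : 0 < t ->
  bochner_integrable mu p%:E `[0, t] F.
Proof.
move=> t0; have [psi [k [c [l H]]]] := approximants 0 t0.
apply: (@bochner_integrable_of_uniform _ _ _ mu p p1 _ _ psi (B + 2 * C)) => //.
- by rewrite lam_itv// ltry.
- move=> s; rewrite /= in_itv/= => /andP[s0 _]; apply: cLpZ => //.
  by case: (SB s0).
- by move=> n; case: (H n).
- by move=> n; case: (H n).
Qed.

Let Riemann_sums_cvg t J (psi : nat -> @step d Omega R) : 0 < t ->
  is_bochner_integral mu p%:E `[0, t] F J ->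
  (forall n, step_on mu p%:E `[0, t] (psi n)) ->
  (forall n, {ae lambda, forall s, (`[0, t]%classic : set R) s ->
        (N (F s - step_fun (psi n) s)%R <= ((B + 2 * C) / 4 ^+ n)%:E)%E}) ->
  \forall x \ae mu,
    normc (J x - step_integral (psi n) x) @[n --> \oo] --> 0.
Proof.
move=> t0 FJ psiD ae; have Jp : cLp mu p%:E J by case: FJ.
apply: (@ae_cvg0_of_cLnorm _ _ _ mu p ((B + 2 * C) * t)
  (fun n => J - step_integral (psi n)) p1).
- by rewrite mulr_ge0// ltW.
- move=> n; apply: cmeasurableB; first exact: Jp.1.
  exact: (step_integral_Lp p1 (psiD n)).1.
move=> n.
apply: (@le_trans _ _ (((B + 2 * C) / 4 ^+ n)%:E * lambda `[0%R, t]%classic)%E).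
  have en0 : 0 <= (B + 2 * C) / 4 ^+ n by rewrite divr_ge0// exprn_ge0.
  have Dfin : (lambda `[0%R, t]%classic < +oo)%E by rewrite lam_itv// ltry.
  exact: (bochner_uniform_approx p1 _ Dfin FJ (psiD n) en0 (ae n)).
rewrite lam_itv// -EFinM lee_fin mulrAC ler_wpM2l//.
  by rewrite mulr_ge0// ltW.
by rewrite lef_pV2 ?posrE ?exprn_gt0// lerXn2r ?nnegrE// ler_nat.
Qed.

Variable lam : R[i].
Hypothesis lam_point : forall e : R, 0 < e -> \forall t \near 0^'+,
  (\int[lambda]_(s in `[0%R, t]) (normc (b s - lam)%R)%:E <= (e * t)%:E)%E.

(** The union of the [E n] may have infinite measure. The tail intersections increase with [j], and
    the j-th one is contained in [E j], so their union keeps the bound [e]. *)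
Let liminf_set (E : nat -> set Omega) (e : R) : 0 <= e ->
  (forall n, measurable (E n)) -> (forall n, mu (E n) <= e%:E)%E ->
  exists E' : set Omega, [/\ measurable E', (mu E' <= e%:E)%E &
    forall x, ~ E' x -> forall j, exists2 n, (j <= n)%N & ~ E n x].
Proof.
move=> e0 mE Ee; pose I j := \bigcap_(n in [set n | (j <= n)%N]) E n.
have mI j : measurable (I j).
  by apply: bigcap_measurable => [|n _]; [exists j => /=|exact: mE].
exists (\bigcup_j I j); split; first exact: bigcup_measurable.
- have nd : nondecreasing_seq I.
    move=> i j ij; apply/subsetPset => x Ix n jn; apply: Ix.
    exact: leq_trans jn.
  have cvgI := nondecreasing_cvg_mu mI (bigcup_measurable (fun n _ => mI n)) nd (mu := mu).
  rewrite -(cvg_lim _ cvgI)//; apply: lime_le.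
    by apply/cvg_ex; eexists; exact: cvgI.
  apply: nearW => j; apply: le_trans (Ee j).
  by rewrite /= le_measure ?inE// => x Ix; apply: Ix => /=.
move=> x E'x j; apply: contrapT => h; apply: E'x; exists j => // n jn.
by apply: contrapT => En; apply: h; exists n.
Qed.

Lemma exceptional_set (eta eps : R) : 0 < eta -> 0 < eps ->
  exists E : set Omega, [/\ measurable E, (mu E <= eps%:E)%E &
    \forall t \near 0^'+, forall J, is_bochner_integral mu p%:E `[0, t] F J ->
      \forall x \ae mu, ~ E x -> normc (lam * f x - (t^-1)%:C%C * J x) <= eta].
Proof.
move=> eta0 eps0.
pose C1 := 2 * C + 1; have C10 : 0 < C1 by rewrite ltr_wpDl// mulr_ge0.
pose Ln := normc lam; have Ln0 : 0 <= Ln by exact: normc_ge0.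
have CL0 : 0 < C1 + Ln by rewrite ltr_pwDl.
(* The errors proportional to [dl] add up to [2 * t * (C1 + Ln) * dl], which is a quarter of
   [t * eta]. *)
have [dl dlE] : exists dl : R, dl = eta / (8 * (C1 + Ln)) by eexists.
have dl0 : 0 < dl by rewrite dlE divr_gt0// mulr_gt0.
(* Both [g - A n] and [w] will have L^1 norm at most [dl * eps / 2], so the maximal inequality at
   level [dl] gives exceptional sets of measure at most [eps]. *)
have de0 : 0 < dl * eps / 2 by rewrite divr_gt0// mulr_gt0.
have e10 : 0 < Num.min dl (dl * eps / 2) by rewrite lt_min dl0.
have [g [w [v [fE [g1 _] [G G0 gG] [w1 _ wle] [vp vle _]]]]] :=
  Lp_truncation p1 fp e10.
have {}vle x : normc (v x) <= dl.
  by rewrite (le_trans (vle x))// ge_min lexx.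
have {}wle : (cLnorm mu 1 w <= (dl * eps / 2)%:E)%E.
  by rewrite (le_trans wle)// lee_fin ge_min lexx orbT.
have [a a0 ga] : exists2 a, 0 < a & forall s, 0 <= s <= a ->
    (cLnorm mu 1 (S s g - g)%R <= (dl * eps / 2)%:E)%E.
  by have [_ _ _ h] := S_flow; exact: h.
pose h n : R := (m n).+1%:R^-1.
have h0 n : 0 < h n by rewrite invr_gt0.
have ih0 n (i : nat) : 0 <= i%:R * h n by rewrite mulr_ge0// ltW.
have [A HA] := choice (fun n =>
  discrete_average mu0 S_flow (h0 n) a0 g1 G0 gG).
have A1 n : cLp mu 1 (A n) by case: (HA n).
pose u n := (g - A n) + w.
have u1 n : cLp mu 1 (u n) by apply: cLpD => //; exact: cLpB.
have ule n : (cLnorm mu 1 (u n) <= (dl * eps)%:E)%E.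
  have mgA : cmeasurable (g - A n) by apply: cmeasurableB; [exact: g1.1|exact: (A1 n).1].
  apply: (le_trans (cLnormD mu (lexx 1) mgA w1.1)).
  rewrite [X in (_ <= X%:E)%E]splitr [leRHS]EFinD leeD//.
  by have [_ gA _ _ _] := HA n; exact: gA.
pose V n (k : nat) := S (k%:R * h n).
have Vc n k : L1_Loo_contraction mu (V n k) by exact: contr.
have V0 n r : cLp mu 1 r -> V n 0%N r = r %[ae mu].
  by move=> r1; rewrite /V mul0r; have [_ s0 _ _] := S_flow; exact: s0.
have VS n k r : cLp mu 1 r -> V n k.+1 r = V n k (V n 1%N r) %[ae mu].
  move=> r1; rewrite /V -natr1 mulrDl; have [_ _ semi _] := S_flow.
  exact: (semi _ _ _ (ih0 n k) (ih0 n 1%N) r1).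
have [E HE] := choice (fun n =>
  maximal_ergodic_inequality mu0 (Vc n) (V0 n) (VS n) dl0 (u1 n)).
have Eeps n : (mu (E n) <= eps%:E)%E.
  have [_ h1 _] := HE n; have := le_trans h1 (ule n).
  by rewrite EFinM lee_pmul2l ?lte_fin.
have [E' [mE' E'eps E'x]] := liminf_set (ltW eps0)
  (fun n => let: And3 h _ _ := HE n in h) Eeps.
exists E'; split => //.
pose eta' := eta / (8 * (G + 1)).
have G10 : 0 < G + 1 by rewrite ltr_wpDl.
have eta'0 : 0 < eta' by rewrite divr_gt0// mulr_gt0.
(* Up to time [t1] the drift of [A n], at most [2 * t / a * G], costs at most [eta / 8] after
   multiplication by [Ln]. *)
pose t1 := a * eta / (16 * ((Ln + 1) * (G + 1))).
have Ln10 : 0 < Ln + 1 by rewrite ltr_wpDl.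
have t10 : 0 < t1 by rewrite divr_gt0 ?mulr_gt0.
near=> t => J FJ.
have t0 : 0 < t by near: t; exact: nbhs_right_gt.
have tt1 : t <= t1 by near: t; exact: nbhs_right_le.
have intb : (\int[lambda]_(s in `[0%R, t]) (normc (b s - lam)%R)%:E <=
    (eta' * t)%:E)%E by near: t; exact: lam_point.
have [psi [k [c [l H]]]] := approximants lam t0.
have psiD n : step_on mu p%:E `[0, t] (psi n) by case: (H n).
have aeJ := Riemann_sums_cvg t0 FJ psiD
  (fun n => let: And4 _ h _ _ := H n in h).
have aeS : \forall x \ae mu, forall n i,
    V n i f x = V n i (A n) x + V n i (u n) x + V n i v x.
  apply: ae_foralln => n; apply: ae_foralln => i.
  have DA := L1_sub mu0 (A1 n); have Du := L1_sub mu0 (u1 n).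
  have Dv := Lp_sub mu0 p1 vp.
  have -> : f = (A n + u n) + v by rewrite fE /u addrA subrKC.
  have e1 := contrD (Vc n i) (L1_plus_LooD mu0 DA Du) Dv.
  have e2 := contrD (Vc n i) DA Du.
  apply: filterS2 e1 e2 => x /(_ I) e1 /(_ I) e2.
  rewrite e1 [LHS](_ : _ = V n i (A n + u n) x + V n i v x)//.
  by rewrite e2.
have aev : \forall x \ae mu, forall n i, normc (V n i v x) <= dl.
  apply: ae_foralln => n; apply: ae_foralln => i.
  apply: (contr_Loo_le mu0 (Vc n i)); [exact: ltW|exact: vp.1|exact: nearW].
have aeAG : \forall x \ae mu, forall n i, normc (V n i (A n) x) <= G.
  by apply: ae_foralln => n; apply: ae_foralln => i; have [_ _ _ h1 _] := HA n; exact: h1.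
have aeAd : \forall x \ae mu, forall n i,
    normc (V n i (A n) x - A n x) <= 2 * (i%:R * h n) / a * G.
  by apply: ae_foralln => n; apply: ae_foralln => i; have [_ _ _ _ h1] := HA n; exact: h1.
(* With a single term of weight 1, the maximal inequality bounds [u n] itself, as [V n 0] is the
   identity. *)
have aeu : \forall x \ae mu, forall n, ~ E n x -> normc (u n x) <= dl.
  apply: ae_foralln => n; have [_ _ h1] := HE n.
  have one1 (j : nat) : normc (1 : R[i]) <= 1 by rewrite Normc.normc1.
  apply: filterS2 (h1 1%N _ one1) (V0 n _ (u1 n)) => x h1x /(_ I) Vx Ex.
  by move: (h1x Ex); rewrite big_ord1 !mul1r Vx.
have aeM : \forall x \ae mu, forall n, ~ E n x ->
    normc (\sum_(i < k n) c n i * V n i (u n) x) <= C1 * h n * ((k n)%:R * dl).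
  apply: ae_foralln => n; have [_ _ h1] := HE n.
  have Ch0 : 0 < C1 * h n by rewrite mulr_gt0.
  (* Since [|c n i| <= 2 * C * h n], this normalization yields admissible weights; [C1 = 2 * C + 1]
     stays positive when [C = 0]. *)
  pose wt i := ((C1 * h n)^-1)%:C%C * c n i.
  have wt1 i : normc (wt i) <= 1.
    rewrite /wt Normc.normcM normc_real ger0_norm ?invr_ge0 ?(ltW Ch0)//.
    rewrite ler_pdivrMl// mulr1.
    have [_ _ _ [_ cl l0 _ _]] := H n.
    rewrite (le_trans (cl i))//; case/andP: (l0 i) => l0i lhi.
    by rewrite ler_pM ?mulr_ge0// lerDl.
  apply: filterS (h1 (k n) _ wt1) => x h1x Ex; have := h1x Ex.
  under eq_bigr do rewrite /wt -mulrA.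
  rewrite -mulr_sumr Normc.normcM normc_real ger0_norm ?invr_ge0 ?(ltW Ch0)//.
  by rewrite ler_pdivrMl.
apply: filterS (filterI aeJ (filterI aeS (filterI aev (filterI aeAG
  (filterI aeAd (filterI aeu aeM)))))) => x.
move=> [Jx [Sx [vx [AGx [Adx [ux Mx]]]]]] Ex.
have te8 : 0 < t * eta / 8 by rewrite divr_gt0// mulr_gt0.
have half_cvg (K : R) : 0 <= K -> forall e, 0 < e ->
    \forall n \near \oo, K * (2 ^+ n)^-1 <= e.
  move=> K0 e e0.
  have : geometric K (2^-1 : R) n @[n --> \oo] --> 0.
    by apply: cvg_geometric; rewrite ger0_norm// invf_lt1// ltr1n.
  move/cvgr0_norm_le => /(_ _ e0); apply: filterS => n /=.
  by rewrite exprVn; exact: le_trans (ler_norm _).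
(* The rank [j0] may depend on [t] and [x]: outside [E'] some later [n] still has [x] outside [E n].
   The third bound disposes of the surplus grid point. *)
have [j0 Hj0] : exists j0 : nat, forall n, (j0 <= n)%N ->
    [/\ normc (J x - step_integral (psi n) x) <= t * eta / 8,
        G * (2 ^+ n)^-1 <= eta / 8 & C1 * dl * (2 ^+ n)^-1 <= t * eta / 8].
  have e8 : 0 < eta / 8 by rewrite divr_gt0.
  move/cvgr0_norm_le : Jx => /(_ _ te8) n1.
  have n2 := half_cvg G G0 _ e8.
  have n3 := half_cvg (C1 * dl) (mulr_ge0 (ltW C10) (ltW dl0)) _ te8.
  have [j0 _ Hj] := filterI n1 (filterI n2 n3).
  exists j0 => n /Hj[q1 [q2 q3]]; split => //.
  exact: le_trans (ler_norm _) q1.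
have [n j0n Enx] := E'x x Ex j0.
have [Jn Gn Cn] := Hj0 n j0n.
have [_ _ intE [[kt ikt] cl l0 lt cq]] := H n.
have q_le : \sum_(i < k n) normc (c n i - lam * (l n i)%:C%C) <=
    eta' * t + (4 ^+ n)^-1 * t.
  by rewrite -lee_fin (le_trans cq)// EFinD leeD2r.
have intx : step_integral (psi n) x = \sum_(i < k n) c n i *
    (V n i (A n) x + V n i (u n) x + V n i v x).
  by rewrite intE fct_sumE; apply: eq_bigr => i _; rewrite -Sx.
have AGx' i : (i < k n)%N -> normc (V n i (A n) x) <= G by move=> _; exact: AGx.
have Adx' i : (i < k n)%N -> normc (V n i (A n) x - A n x) <= 2 * t / a * G.
  move=> ik; rewrite (le_trans (Adx n i))// ler_wpM2r// ler_wpM2r ?invr_ge0 ?(ltW a0)//.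
  by rewrite ler_wpM2l//; exact: ikt.
have cl' i : normc (c n i) <= C1 * l n i.
  rewrite (le_trans (cl i))// ler_wpM2r//; first by case/andP: (l0 i).
  by rewrite lerDl.
have l0' i : 0 <= l n i by case/andP: (l0 i).
have est := discrete_estimate (Y := fun i => V n i (u n) x) (ltW C10) G0 q_le
  lt l0' cl' AGx' Adx' (Mx n Enx)
  (vx n) (ux n Enx) (vle x).
have fx : f x = A n x + u n x + v x.
  by rewrite fE /u addrA subrKC.
rewrite -intx -fx in est.
have normB (z1 z2 z3 : R[i]) : normc (z3 - z1) <= normc (z1 - z2) + normc (z2 - z3).
  by rewrite -normcN opprB -[z1 - z3](subrKA z2) le_normcD.
have tot := normB (J x) (step_integral (psi n) x) (lam * t%:C%C * f x).
have -> : lam * f x - (t^-1)%:C%C * J x = (t^-1)%:C%C * (lam * t%:C%C * f x - J x).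
  rewrite mulrBr; congr (_ - _).
  have -> : (t^-1)%:C%C * (lam * t%:C%C * f x) = (t^-1 * t)%:C%C * (lam * f x).
    by rewrite rmorphM; ring.
  by rewrite mulVf ?mul1r// gt_eqF.
rewrite Normc.normcM normc_real ger0_norm ?invr_ge0 ?(ltW t0)// ler_pdivrMl//.
apply: (le_trans tot); apply: (le_trans (lerD Jn est)).
(* The budget is 7/8 of [t * eta]: one eighth each for the Riemann sum, for the two parts of the
   weight's oscillation, for the drift and for the surplus point, and two eighths for the terms in
   [dl]. *)
have P42 : (4 ^+ n)^-1 <= (2 ^+ n)^-1 :> R.
  by rewrite lef_pV2 ?posrE ?exprn_gt0// lerXn2r ?nnegrE// ler_nat.
have hk : h n * (k n)%:R <= t + (2 ^+ n)^-1.
  have [hn _] := Hm n.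
  apply: le_trans (_ : h n * (t * (m n).+1%:R + 1) <= _); first by rewrite ler_wpM2l// ltW.
  by rewrite mulrDr mulr1 mulrCA /h mulVf ?pnatr_eq0// mulr1 lerD2l.
have q1 : eta' * t * G <= t * eta / 8.
  rewrite /eta' mulrAC -mulrA -[leRHS]mulrA [leRHS]mulrC -[leRHS]mulrA.
  have -> : eta / (8 * (G + 1)) * (G * t) = eta / 8 * (G / (G + 1)) * t.
    by field; rewrite gt_eqF.
  have G1 : G / (G + 1) <= 1 by rewrite ler_pdivrMr// mul1r lerDl.
  have : eta / 8 * (G / (G + 1)) <= eta / 8 by rewrite ler_piMr// divr_ge0// ltW.
  move=> h1; have := ler_wpM2r (ltW t0) h1; lra.
have q2 : (4 ^+ n)^-1 * t * G <= t * eta / 8.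
  have h1 : (4 ^+ n)^-1 * G <= eta / 8.
    by rewrite (le_trans _ Gn)// mulrC ler_wpM2l.
  have := ler_wpM2r (ltW t0) h1; lra.
have q3 : Ln * (t * (2 * t / a * G)) <= t * eta / 8.
  have h1 : Ln * (2 * t / a * G) <= eta / 8.
    apply: (@le_trans _ _ ((Ln + 1) * (2 * t1 / a * (G + 1)))).
      have at0 : 0 <= 2 * t / a by rewrite divr_ge0 ?mulr_ge0// ltW.
      apply: ler_pM; [by []|exact: mulr_ge0|by rewrite lerDl|].
      apply: ler_pM; [by []|by []| |by rewrite lerDl].
      by rewrite ler_wpM2r ?invr_ge0 ?(ltW a0)// ler_wpM2l.
    rewrite le_eqVlt; apply/orP; left; apply/eqP; rewrite /t1.
    by field; rewrite !gt_eqF.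
  have := ler_wpM2r (ltW t0) h1; lra.
have q4 : C1 * h n * ((k n)%:R * dl) <= C1 * dl * t + t * eta / 8.
  have h1 := ler_wpM2l (mulr_ge0 (ltW C10) (ltW dl0)) hk; lra.
have q5 : 2 * (t * ((C1 + Ln) * dl)) = t * eta / 4.
  rewrite dlE; field; rewrite gt_eqF//.
have tpos : 0 < t * eta by rewrite mulr_gt0.
by rewrite -/Ln; lra.
Unshelve. all: by end_near. Qed.

End fixed_grids.

Lemma weighted_orbit_bochner_integrable t : 0 < t ->
  bochner_integrable mu p%:E `[0, t] (fun s => beta s *: S s f).
Proof.
move=> t0; have [B B0 SB] := orbit_bounded; have [m Hm] := fine_grids.
exact: (weighted_orbit_integrable_on_grid B0 SB Hm).
Qed.

Lemma local_ergodic_exceptional_set (lam : R[i]) :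
  (forall e : R, 0 < e -> \forall t \near 0^'+,
    (\int[lambda]_(s in `[0%R, t]) (normc (b s - lam)%R)%:E <= (e * t)%:E)%E) ->
  forall eta eps : R, 0 < eta -> 0 < eps ->
  exists E : set Omega, [/\ measurable E, (mu E <= eps%:E)%E &
    \forall t \near 0^'+, \forall x \ae mu, ~ E x ->
      normc (lam * f x - average mu p%:E S beta f t x) <= eta].
Proof.
move=> lam_point eta eps eta0 eps0.
have [B B0 SB] := orbit_bounded; have [m Hm] := fine_grids.
have [E [mE Ee HE]] := exceptional_set B0 SB Hm lam_point eta0 eps0.
exists E; split => //; near=> t.
have t0 : 0 < t by near: t; exact: nbhs_right_gt.
have Ht : forall J, is_bochner_integral mu p%:E `[0, t] (fun s => beta s *: S s f) J ->
  \forall x \ae mu, ~ E x -> normc (lam * f x - (t^-1)%:C%C * J x) <= eta.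
  by near: t; exact: HE.
apply: (Ht (bochner_integral mu p%:E `[0, t] (fun s => beta s *: S s f))).
(* Integrability excludes the default value 0 of [bochner_integral]. *)
exact: (xgetPex 0 (weighted_orbit_bochner_integrable t0)).
Unshelve. all: by end_near. Qed.

End local_ergodic.

(** * From Dunford-Schwartz semigroups to almost uniform convergence *)

Section dunford_schwartz_semigroup.
Context {d : measure_display} {Omega : measurableType d} {R : realType}.
Variable mu : {measure set Omega -> \bar R}.
Hypothesis mu0 : (0 < mu setT)%E.

Lemma dunford_schwartz_flow (T Text : R -> (Omega -> R[i]) -> Omega -> R[i]) :
  (forall s, 0 <= s -> dunford_schwartz mu (T s)) ->
  (forall s, 0 <= s -> dunford_schwartz_extension mu (T s) (Text s)) ->
  semigroup mu T -> strongly_continuous_L1 mu T ->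
  continuous_contraction_flow mu Text.
Proof.
move=> T_DS ext [T0 TD] T_cont.
have contr s : 0 <= s -> L1_Loo_contraction mu (Text s).
  move=> s0; have [lin extE Loo _] := ext s s0; have [[TL1 _ _] TL1c _] := T_DS s s0.
  split => // g g1.
  rewrite (@eq_cLnorm _ _ _ _ _ _ (T s g))//; first exact: TL1c.
  - have [SD _ _] := lin; exact: L1_plus_Loo_cmeasurable (SD _ (L1_sub mu0 g1)).
  - by case: (TL1 _ g1).
  - exact: extE.
have TE s g : 0 <= s -> cLp mu 1 g -> Text s g = T s g %[ae mu].
  by move=> s0 g1; have [_ extE _ _] := ext s s0; exact: extE.
have T1 s g : 0 <= s -> cLp mu 1 g -> cLp mu 1 (T s g).
  by move=> s0; have [[h _ _] _ _] := T_DS s s0; exact: h.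
have Text1 s g : 0 <= s -> cLp mu 1 g -> cLp mu 1 (Text s g).
  by move=> s0 g1; exact: contr_L1 (contr s s0) _ g1.
split => //.
- move=> g g1; apply: filterS2 (TE 0 g (lexx 0) g1) (T0 g g1) => x h1 h2 _.
  by rewrite (h1 I) (h2 I).
- move=> r s g r0 s0 g1.
  have [[_ Tae _] _ _] := T_DS r r0.
  have e1 := TE _ _ (addr_ge0 r0 s0) g1.
  have e2 := TD r s g r0 s0 g1.
  have e3 := Tae _ _ (Text1 s g s0 g1) (T1 s g s0 g1) (TE s g s0 g1).
  have e4 := TE r _ r0 (Text1 s g s0 g1).
  apply: filterS (filterI (filterI e1 e2) (filterI e3 e4)) => x.
  by move=> [[h1 h2] [h3 h4]] _; rewrite h1// h2// h4// h3.
move=> g e g1 e0; have /fine_cvgP := T_cont g 0 g1 (lexx 0).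
move=> [Tfin] /cvgr0_norm_le /(_ e e0) Tle.
have [h /= h0 H] : \forall s \near (0 : R), 0 <= s ->
    (cLnorm mu 1 (T s g - T 0 g)%R <= e%:E)%E.
  have near_both : \forall s \near (0 : R), (`[0, +oo[%classic : set R) s ->
      cLnorm mu 1 (T s g - T 0 g) \is a fin_num /\
      `|fine (cLnorm mu 1 (T s g - T 0 g))| <= e .
    exact: (@filterI _ _ (within_filter _ (nbhs_filter (0 : R))) _ _ Tfin Tle).
  apply: filterS near_both => s H s0.
  have sD : (`[0, +oo[%classic : set R) s by rewrite /= in_itv/= s0.
  have [/fineK <- le] := H sD.
  by rewrite lee_fin (le_trans (ler_norm _) le).
exists (h / 2); first by rewrite divr_gt0.
move=> s /andP[s0 sh].
have sball : ball (0 : R) h s.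
  rewrite /ball/= sub0r normrN ger0_norm// (le_lt_trans sh)//.
  by rewrite ltr_pdivrMr// ltr_pMr// ltr1n.
apply: le_trans (H s sball s0).
apply: ae_le_cLnorm => //.
- by apply: cmeasurableB; [case: (Text1 s g s0 g1)|case: g1].
apply: filterS2 (TE s g s0 g1) (T0 g g1) => x h1 h2.
by rewrite [X in normc X <= _](_ : _ = Text s g x - g x)//
  [X in _ <= normc X](_ : _ = T s g x - T 0 g x)// h1// h2.
Qed.

End dunford_schwartz_semigroup.

(** The sets obtained for [eta = 1 / (n + 1)] and [eps = e / 2^(n+1)] have a union of measure at
    most [e], off which every precision is reached. A null set depending on [i] is harmless because
    the convergence is in essential supremum for each [i]. *)
Lemma almost_uniformly_cvg_of_exceptional_sets {d : measure_display}
    {Omega : measurableType d} {R : realType} (mu : {measure set Omega -> \bar R})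
    (I : Type) (F : set_system I) (u : I -> Omega -> R[i]) (g : Omega -> R[i]) :
  (0 < mu setT)%E -> Filter F ->
  (forall eta eps : R, 0 < eta -> 0 < eps -> exists E : set Omega,
    [/\ measurable E, (mu E <= eps%:E)%E &
      \forall i \near F, \forall x \ae mu, ~ E x -> normc (g x - u i x) <= eta]) ->
  almost_uniformly_cvg mu F u g.
Proof.
move=> mu0 FF H e e0.
have en0 n : 0 < e / (2 ^ n.+1)%:R by rewrite divr_gt0// ltr0n expn_gt0.
have n10 n : 0 < n.+1%:R^-1 :> R by rewrite invr_gt0.
have [E HE] := choice (fun n => H _ _ (n10 n) (en0 n)).
have mE n : measurable (E n) by case: (HE n).
have mUE : measurable (\bigcup_n E n) by exact: bigcup_measurable.
exists (~` \bigcup_n E n); split; first exact: measurableC.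
  rewrite setCK (le_trans (measure_sigma_subadditive mu mE mUE (@subset_refl _ _)))//.
  apply: (le_trans (lee_nneseries (v := fun n => (e / (2 ^ n.+1)%:R)%:E) _ _)) => //.
    by move=> n _; case: (HE n).
  exact: epsilon_trick0 (ltW e0).
apply/fine_cvgP.
have small (eta : R) : 0 < eta -> \forall i \near F,
    (cLnorm mu +oo (fun x => \1_(~` \bigcup_n E n) x * (g x - u i x))%R <= eta%:E)%E.
  move=> eta0; near \oo => n.
  have n_eta : n.+1%:R^-1 <= eta.
    by near: n; apply: filterS (near_infty_natSinv_lt (PosNum eta0)) => n /ltW.
  have [_ _] := HE n; apply: filterS => i Hi.
  apply/(cLnormyP _ _ mu0); apply: filterS Hi => x Hx.
  rewrite Normc.normcM indicE; case: (boolP (x \in _)) => [|_]; last first.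
    by rewrite Normc.normc0 mul0r ltW.
  rewrite inE Normc.normc1 mul1r => UEx; apply: le_trans n_eta; apply: Hx => Ex.
  by apply: UEx; exists n.
split.
  apply: filterS (small 1 ltr01) => i Hi.
  by rewrite ge0_fin_numE ?cLnorm_ge0// (le_lt_trans Hi)// ltry.
apply/cvgr0Pnorm_le => eta eta0; apply: filterS (small eta eta0) => i Hi.
rewrite ger0_norm ?fine_ge0 ?cLnorm_ge0//.
rewrite -lee_fin fineK// ge0_fin_numE ?cLnorm_ge0//.
by rewrite (le_lt_trans Hi)// ltry.
Unshelve. all: by end_near. Qed.

Theorem theorem5p2 (d : measure_display) (Omega : measurableType d)
    (R : realType) (mu : {measure set Omega -> \bar R})
    (mu_sigma_finite : sigma_finite setT mu) (mu_infinite : mu setT = +oo%E)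
    (T Text : R -> (Omega -> R[i]) -> Omega -> R[i])
    (T_DS : forall s, 0 <= s -> dunford_schwartz mu (T s))
    (Text_ext : forall s, 0 <= s ->
       dunford_schwartz_extension mu (T s) (Text s))
    (T_semigroup : semigroup mu T)
    (T_continuous : strongly_continuous_L1 mu T)
    (beta : R -> R[i]) (C : R)
    (beta_besicovitch : bounded_locally_besicovitch beta)
    (beta_lt : (essup_norm beta < C%:E)%E)
    (p : R) (p_ge1 : 1 <= p) (f : Omega -> R[i]) (f_Lp : cLp mu p%:E f) :
  (forall t, 0 < t ->
     bochner_integrable mu p%:E `[0, t] (fun s => beta s *: Text s f)) /\
  exists lam : R[i],
    almost_uniformly_cvg mu 0^'+ (average mu p%:E Text beta f) (lam *: f).
Proof.
have mu0 : (0 < mu setT)%E by rewrite mu_infinite ltry.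
have flow := dunford_schwartz_flow mu0 T_DS Text_ext T_semigroup T_continuous.
have [beta_meas _ _] := beta_besicovitch.
have [b [mb bC bE]] := borel_representative beta_meas beta_lt.
have C0 : 0 <= C := le_trans (normc_ge0 (b 0)) (bC 0).
split.
  exact: (weighted_orbit_bochner_integrable mu0 flow p_ge1 f_Lp mb C0 bC bE).
have [lam lam_point] := besicovitch_lebesgue_point beta_besicovitch mb bE.
exists lam; apply: almost_uniformly_cvg_of_exceptional_sets => // eta eps eta0 eps0.
exact: (local_ergodic_exceptional_set mu0 flow p_ge1 f_Lp mb C0 bC bE lam_point).
Qed.
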